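(* Let $n\ge 1$, let $B(\zeta)$ be a nondegenerate quadratic form in $\mathbb{C}^n$ and let $p\geq 1$ be an integer. Put $k:=2p$ and $Q_k(\zeta):=(B(\zeta))^p$. Let $\Omega\subset\mathbb{C}^n$ be a domain containing $0$, let $a_\alpha$ be holomorphic functions in $\Omega$ for every multi-index $\alpha\in\mathbb{N}_0^n$ with $|\alpha|\le p$, and consider the holomorphic partial differential operator $$Lu = Q_k(D)u+\sum_{|\alpha|\le p}a_\alpha(z)D^\alpha u .$$ Suppose $P(z)=P_k(z)$ is a homogeneous polynomial of degree $k=2p$ that is $B$-elliptic. Then, for any domain $U\subset\Omega$ with $0\in U$, there is a subdomain $U'\subset U$ with $0\in U'$ such that for every $f\in\mathcal{O}(U)$ the equation $$L(Pq)=f \quad\text{in } U'$$ has a unique solution $q\in\mathcal{O}(U')$.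
   Context: $\mathcal{O}(U)$ denotes the space of holomorphic functions in an open set $U\subset\mathbb{C}^n$. For $\alpha\in\mathbb{N}_0^n$, $|\alpha|=\alpha_1+\dots+\alpha_n$ and $D^\alpha=\partial^{|\alpha|}/\partial z_1^{\alpha_1}\cdots\partial z_n^{\alpha_n}$ (complex partial derivatives); $Q(D)$ is the constant coefficient operator obtained from a polynomial $Q(\zeta)$ by substituting $\partial/\partial z_j$ for $\zeta_j$. A nondegenerate quadratic form is $B(\zeta)=\zeta^tB\zeta$ with $B$ an invertible symmetric $n\times n$ complex matrix. Put $\Sigma(\tau)=\sum_{j=1}^n\tau_j^2$. A homogeneous polynomial $P_{2p}(z)$ (complex coefficients) of degree $2p\ge 2$ is called $B$-elliptic if, for some invertible complex $n\times n$ matrix $A$ such that $B(A\tau)=\Sigma(\tau)$, the polynomial $P_{2p}(A^{-t}x)$ is real-valued for $x\in\mathbb{R}^n$ and there is a constant $\delta>0$ such that $$P_{2p}(A^{-t}x)\ge\delta (B(Ax))^p=\delta|x|^{2p},\qquad x\in\mathbb{R}^n,$$ where $A^{-t}$ is the transpose of the inverse matrix $A^{-1}$. *)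

(* Defs.v *)
(* MathComp-Analysis; multivariate polynomials from multinomials, imported
   without their notations, which clash with those of MathComp-Analysis. *)
From HB Require Import structures.
From mathcomp Require Export all_boot all_order all_algebra.
From mathcomp Require Export all_classical all_reals all_analysis.
From mathcomp.real_closed Require Export complex.
From mathcomp.multinomials Require Export -(notations) mpoly.

Set Implicit Arguments.
Unset Strict Implicit.
Unset Printing Implicit Defensive.

Export Order.TTheory GRing.Theory Num.Theory.
Export numFieldNormedType.Exports.

Local Open Scope classical_set_scope.
Local Open Scope ring_scope.

(* R[i] packed as a numClosedFieldType, so that it inherits the topology and
   the normed module structure (over itself) of any numeric field. *)
Definition Cplx (R : realType) : numClosedFieldType := R[i].
Arguments Cplx R : simpl never.

Definition real_col (R : realType) (n : nat) (x : 'cV[R]_n) : 'cV[Cplx R]_n :=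
  map_mx (fun t : R => (t%:C)%C : Cplx R) x.

Definition domain (R : realType) (n : nat) (U : set 'cV[Cplx R]_n) : Prop :=
  [/\ open U, connected U & U !=set0].

(* Elements of O(U) are represented by total functions on C^n whose values
   outside the open set U are irrelevant; equality in O(U) is equality on U.
   Differentiability is Fréchet differentiability over Cplx R. *)
Definition holomorphic_on (R : realType) (n : nat) (U : set 'cV[Cplx R]_n)
    (f : 'cV[Cplx R]_n -> Cplx R) : Prop :=
  forall z, U z -> differentiable f z.

Definition partial (R : realType) (n : nat) (j : 'I_n)
    (u : 'cV[Cplx R]_n -> Cplx R) : 'cV[Cplx R]_n -> Cplx R :=
  'D_(delta_mx j 0) u.

Definition mpartial (R : realType) (n : nat) (alpha : multinom n)
    (u : 'cV[Cplx R]_n -> Cplx R) : 'cV[Cplx R]_n -> Cplx R :=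
  foldr (fun j v => iter (alpha j) (partial j) v) u (enum 'I_n).

Definition diff_op (R : realType) (n : nat) (Q : mpoly n (Cplx R))
    (u : 'cV[Cplx R]_n -> Cplx R) (z : 'cV[Cplx R]_n) : Cplx R :=
  \sum_(alpha <- msupp Q) mcoeff alpha Q * mpartial alpha u z.

Definition peval (R : realType) (n : nat) (P : mpoly n (Cplx R))
    (z : 'cV[Cplx R]_n) : Cplx R :=
  meval (fun j => z j 0) P.

(* zeta^t B zeta, where zeta is the column of the n indeterminates. *)
Definition qform (R : realType) (n : nat) (B : 'M[Cplx R]_n) :
    mpoly n (Cplx R) :=
  let zeta : 'cV[mpoly n (Cplx R)]_n := \col_j mpolyX (Cplx R) (mnm1 j) in
  (zeta^T *m map_mx (@mpolyC n (Cplx R)) B *m zeta) 0 0.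

Lemma peval_qform (R : realType) (n : nat) (B : 'M[Cplx R]_n)
    (z : 'cV[Cplx R]_n) :
  peval (qform B) z = (z^T *m B *m z) 0 0.
Proof.
rewrite /peval /qform !mxE rmorph_sum; apply: eq_bigr => j _.
rewrite rmorphM !mxE rmorph_sum; congr (_ * _); last exact: mevalXU.
apply: eq_bigr => i _; rewrite rmorphM !mxE; congr (_ * _); first exact: mevalXU.
exact: mevalC.
Qed.

(* The order on Cplx R is the one of a numeric field: a <= b means that b - a
   is real and nonnegative. *)
Definition B_elliptic (R : realType) (n : nat) (B : 'M[Cplx R]_n) (p : nat)
    (P : mpoly n (Cplx R)) : Prop :=
  exists A : 'M[Cplx R]_n,
    [/\ A \in unitmx,
        forall tau : 'cV[Cplx R]_n,
          peval (qform B) (A *m tau) = \sum_(j < n) tau j 0 ^+ 2,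
        forall x : 'cV[R]_n,
          peval P ((invmx A)^T *m real_col x) \is Num.real
      & exists delta : R, 0 < delta /\
          forall x : 'cV[R]_n,
            (delta%:C)%C * peval (qform B) (A *m real_col x) ^+ p
              <= peval P ((invmx A)^T *m real_col x) ].

(* bmultinom n k is the finite type of multi-indices of length < k. *)
Definition hol_op (R : realType) (n : nat) (B : 'M[Cplx R]_n) (p : nat)
    (a : multinom n -> 'cV[Cplx R]_n -> Cplx R)
    (u : 'cV[Cplx R]_n -> Cplx R) (z : 'cV[Cplx R]_n) : Cplx R :=
  diff_op (qform B ^+ p) u z
  + \sum_(alpha : bmultinom n p.+1) a alpha z * mpartial alpha u z.

(* Main.v *)
(** Expand at the origin in forms. With Q = B^p, the map q |-> Q(D)(P q)
    preserves the degree. After the linear change of variables A it becomes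
    q |-> Lap^p (P q) with P >= delta |x|^(2p) on real points, and pairing
    P q with q in L^2 of the sphere shows that it is invertible on forms of
    degree m, with an inverse of norm O((m+1)^(-p)). The lower order terms
    cost at most p derivatives, that is a factor (m+1)^p, and in degree m they
    only see the part of q of degree < m. So the equation is solved uniquely
    degree by degree, and the solution grows geometrically at a rate that
    depends on the a_alpha but not on f; this rate determines the ball U'.
    Uniqueness of the formal solution and the identity theorem give
    uniqueness on U'. *)
From HB Require Import structures.
Require Import Defs.
From mathcomp Require Import zify ring lra.

Set Implicit Arguments.
Unset Strict Implicit.
Unset Printing Implicit Defensive.

Local Open Scope classical_set_scope.
Local Open Scope ring_scope.

(** * Moduli of complex numbers *)

Section Modulus.
Variable R : realType.
Implicit Types z w : Cplx R.

(** The power (m+1)^(-p) comes from a duality argument on the sphere. In the inner product of the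
    sphere a factor [r2] is invisible, and [lap] is symmetric between forms of equal degree. Hence,
    for j >= 1, every form q of degree m has a companion w of degree m with |w| <= |q| / (m+1) and
    <f, q> = <Lap f, w> for all forms f of degree m + 2j. Applied p times to f = P q this bounds <P
    q, q> from above, and P >= delta bounds it from below by delta |q|^2. The mean over the sphere
    is a Gaussian expectation divided by a radial moment, so it is defined by the moments of
    monomials; the price is a proof that polynomials nonnegative on real points have nonnegative
    expectation. Two norms are in play: [N], of the sphere, for the estimate, and [nrm], of the
    coefficients, for convergence. Passing between them costs K^m in degree m, and multiplying by a
    form of degree j costs K^j. Both losses are geometric and only change the rate, while the
    constant of the estimate itself is independent of m. *)

Definition re z : R := complex.Re z.
Definition im z : R := complex.Im z.
Definition cR (x : R) : Cplx R := (x%:C)%C.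
Definition ci : Cplx R := Complex 0 1.
Definition cabs z : R := ComplexField.Normc.normc z.

Lemma re_im_eq z w : re z = re w -> im z = im w -> z = w.
Proof. by case: z w => a b [c d] /= -> ->. Qed.

Lemma cplxE z : z = cR (re z) + ci * cR (im z).
Proof.
case: z => a b; apply: re_im_eq.
  by change (a = a + (0 * b - 1 * 0)); ring.
by change (b = 0 + (0 * 0 + 1 * b)); ring.
Qed.

Lemma reD z w : re (z + w) = re z + re w. Proof. by case: z w => a b [c d]. Qed.
Lemma imD z w : im (z + w) = im z + im w. Proof. by case: z w => a b [c d]. Qed.
Lemma reN z : re (- z) = - re z. Proof. by case: z. Qed.
Lemma imN z : im (- z) = - im z. Proof. by case: z. Qed.
Lemma reB z w : re (z - w) = re z - re w. Proof. by rewrite reD reN. Qed.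
Lemma imB z w : im (z - w) = im z - im w. Proof. by rewrite imD imN. Qed.
Lemma reM z w : re (z * w) = re z * re w - im z * im w.
Proof. by case: z w => a b [c d]. Qed.
Lemma imM z w : im (z * w) = re z * im w + im z * re w.
Proof. by case: z w => a b [c d]. Qed.
Lemma re0 : re 0 = 0. Proof. by []. Qed.
Lemma im0 : im 0 = 0. Proof. by []. Qed.
Lemma re1 : re 1 = 1. Proof. by []. Qed.
Lemma im1 : im 1 = 0. Proof. by []. Qed.
Lemma re_ci : re ci = 0. Proof. by []. Qed.
Lemma im_ci : im ci = 1. Proof. by []. Qed.
Lemma re_cR x : re (cR x) = x. Proof. by []. Qed.
Lemma im_cR x : im (cR x) = 0. Proof. by []. Qed.
Lemma re_conj z : re z^* = re z. Proof. by case: z. Qed.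
Lemma im_conj z : im z^* = - im z. Proof. by case: z. Qed.

Lemma re_sum (I : Type) (r : seq I) (P : pred I) (F : I -> Cplx R) :
  re (\sum_(i <- r | P i) F i) = \sum_(i <- r | P i) re (F i).
Proof. exact: (big_morph re reD re0). Qed.

Lemma im_sum (I : Type) (r : seq I) (P : pred I) (F : I -> Cplx R) :
  im (\sum_(i <- r | P i) F i) = \sum_(i <- r | P i) im (F i).
Proof. exact: (big_morph im imD im0). Qed.

Lemma cR0 : cR 0 = 0. Proof. by []. Qed.
Lemma cR1 : cR 1 = 1. Proof. by []. Qed.
Lemma cRD x y : cR (x + y) = cR x + cR y. Proof. exact: rmorphD. Qed.
Lemma cRB x y : cR (x - y) = cR x - cR y. Proof. exact: rmorphB. Qed.
Lemma cRM x y : cR (x * y) = cR x * cR y. Proof. exact: rmorphM. Qed.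
Lemma cRX x k : cR (x ^+ k) = cR x ^+ k. Proof. exact: rmorphXn. Qed.
Lemma cRn k : cR k%:R = k%:R. Proof. exact: rmorph_nat. Qed.
Lemma cRV x : cR x^-1 = (cR x)^-1. Proof. exact: fmorphV. Qed.
Lemma cR_inj : injective cR. Proof. by move=> x y []. Qed.
Lemma cR_prod (I : Type) (r : seq I) (P : pred I) (F : I -> R) :
  cR (\prod_(i <- r | P i) F i) = \prod_(i <- r | P i) cR (F i).
Proof. exact: (big_morph cR cRM cR1). Qed.
Lemma cR_sum (I : Type) (r : seq I) (P : pred I) (F : I -> R) :
  cR (\sum_(i <- r | P i) F i) = \sum_(i <- r | P i) cR (F i).
Proof. exact: (big_morph cR cRD cR0). Qed.

Lemma re_cRM x z : re (cR x * z) = x * re z.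
Proof. by rewrite reM re_cR im_cR mul0r subr0. Qed.
Lemma im_cRM x z : im (cR x * z) = x * im z.
Proof. by rewrite imM re_cR im_cR mul0r addr0. Qed.

Lemma norm_cabs z : `|z| = cR (cabs z). Proof. by []. Qed.

Lemma cR_le x y : (cR x <= cR y) = (x <= y).
Proof. exact: lecR. Qed.
Lemma cR_lt x y : (cR x < cR y) = (x < y).
Proof. exact: ltcR. Qed.

Lemma cabs_ge0 z : 0 <= cabs z.
Proof. by rewrite -cR_le -norm_cabs normr_ge0. Qed.
Lemma cabs0 : cabs 0 = 0.
Proof. by apply: cR_inj; rewrite -norm_cabs normr0. Qed.
Lemma cabs1 : cabs 1 = 1.
Proof. by apply: cR_inj; rewrite -norm_cabs normr1. Qed.
Lemma cabs_eq0 z : (cabs z == 0) = (z == 0).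
Proof. by rewrite -(inj_eq cR_inj) -norm_cabs normr_eq0. Qed.
Lemma cabs_gt0 z : (0 < cabs z) = (z != 0).
Proof. by rewrite lt_def cabs_eq0 cabs_ge0 andbT. Qed.
Lemma cabsD z w : cabs (z + w) <= cabs z + cabs w.
Proof. by rewrite -cR_le cRD -!norm_cabs ler_normD. Qed.
Lemma cabsN z : cabs (- z) = cabs z.
Proof. by apply: cR_inj; rewrite -!norm_cabs normrN. Qed.
Lemma cabsB z w : cabs (z - w) <= cabs z + cabs w.
Proof. by rewrite -(cabsN w) cabsD. Qed.
Lemma cabs_distC z w : cabs (z - w) = cabs (w - z).
Proof. by rewrite -cabsN opprB. Qed.
Lemma cabsM z w : cabs (z * w) = cabs z * cabs w.
Proof. by apply: cR_inj; rewrite cRM -!norm_cabs normrM. Qed.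
Lemma cabsV z : cabs z^-1 = (cabs z)^-1.
Proof. by apply: cR_inj; rewrite cRV -!norm_cabs normfV. Qed.
Lemma cabsX z k : cabs (z ^+ k) = cabs z ^+ k.
Proof. by apply: cR_inj; rewrite cRX -!norm_cabs normrX. Qed.
Lemma cabs_cR x : cabs (cR x) = `|x|.
Proof.
apply: cR_inj; rewrite -norm_cabs normc_def /= expr0n addr0 sqrtr_sqr //.
Qed.
Lemma cabs_n k : cabs k%:R = k%:R.
Proof. by rewrite -cRn cabs_cR normr_nat. Qed.
Lemma cabs_ci : cabs ci = 1.
Proof.
by apply: cR_inj; rewrite -norm_cabs normc_def /= expr0n add0r expr1n sqrtr1.
Qed.
Lemma cabs_sum (I : Type) (r : seq I) (P : pred I) (F : I -> Cplx R) :
  cabs (\sum_(i <- r | P i) F i) <= \sum_(i <- r | P i) cabs (F i).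
Proof.
elim/big_rec2: _ => [|i y x _ h]; first by rewrite cabs0.
by rewrite (le_trans (cabsD _ _))// lerD2l.
Qed.
Lemma cabs_prod (I : Type) (r : seq I) (P : pred I) (F : I -> Cplx R) :
  cabs (\prod_(i <- r | P i) F i) = \prod_(i <- r | P i) cabs (F i).
Proof. exact: (big_morph cabs cabsM cabs1). Qed.

Lemma cabs_sqr z : cabs z ^+ 2 = re z ^+ 2 + im z ^+ 2.
Proof. by apply: cR_inj; rewrite cRX -norm_cabs -add_Re2_Im2. Qed.
Lemma re_le_cabs z : `|re z| <= cabs z.
Proof.
rewrite -ler_sqr ?nnegrE ?cabs_ge0// cabs_sqr real_normK ?num_real//.
by rewrite lerDl sqr_ge0.
Qed.
Lemma im_le_cabs z : `|im z| <= cabs z.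
Proof.
rewrite -ler_sqr ?nnegrE ?cabs_ge0// cabs_sqr real_normK ?num_real//.
by rewrite lerDr sqr_ge0.
Qed.
Lemma cabs_le_reim z : cabs z <= `|re z| + `|im z|.
Proof.
rewrite -ler_sqr ?nnegrE ?cabs_ge0 ?addr_ge0// cabs_sqr.
rewrite sqrrD !real_normK ?num_real//.
have : 0 <= `|re z| * `|im z| *+ 2 by rewrite mulrn_wge0// mulr_ge0.
lra.
Qed.
Lemma conjM_cabs z : z * z^* = cR (cabs z ^+ 2).
Proof. by rewrite -normCK norm_cabs cRX. Qed.

Lemma conjM z w : (z * w)^* = z^* * w^*.
Proof. by apply: re_im_eq; rewrite ?re_conj ?im_conj !(reM, imM, re_conj, im_conj); ring. Qed.
Lemma conjD z w : (z + w)^* = z^* + w^*.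
Proof. by apply: re_im_eq; rewrite ?re_conj ?im_conj !(reD, imD, re_conj, im_conj)// opprD. Qed.
Lemma conj_cR x : (cR x)^* = cR x.
Proof. by apply: re_im_eq; rewrite ?re_conj// im_conj im_cR oppr0. Qed.
Lemma conj_n k : (k%:R : Cplx R)^* = k%:R.
Proof. by rewrite -cRn conj_cR. Qed.
Lemma conjMn z k : (z *+ k)^* = z^* *+ k.
Proof. by rewrite -[z *+ k]mulr_natl conjM conj_n mulr_natl. Qed.
Lemma conj1 : (1 : Cplx R)^* = 1. Proof. exact: (conj_n 1). Qed.
Lemma conj0 : (0 : Cplx R)^* = 0. Proof. exact: (conj_n 0). Qed.
Lemma conjX z k : (z ^+ k)^* = z^* ^+ k.
Proof. by elim: k => [|k IH]; rewrite ?expr0 ?conj1// !exprS conjM IH. Qed.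
Lemma conj_prod (I : Type) (r : seq I) (P : pred I) (F : I -> Cplx R) :
  (\prod_(i <- r | P i) F i)^* = \prod_(i <- r | P i) (F i)^*.
Proof. exact: (big_morph _ conjM conj1). Qed.

Lemma cR_ge0_le z : (0 <= z) = (im z == 0) && (0 <= re z).
Proof. by rewrite lecE. Qed.
End Modulus.
Arguments cabs : simpl never.

(** * Gaussian expectations of polynomials *)

Section Gauss1.
Variable R : realType.
Implicit Types p f g : {poly R}.

(* Moments of the standard Gaussian. Expectations of polynomials are defined
   through them algebraically, so that no integration is needed. *)
Fixpoint gmom2 (k : nat) : R * R :=
  if k is k'.+1 then let: (a, b) := gmom2 k' in (b, k'.+1%:R * a) else (1, 0).
Definition gmom k : R := (gmom2 k).1.

Lemma gmomSS k : gmom k.+2 = k.+1%:R * gmom k.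
Proof.
rewrite /gmom /=; case: (gmom2 k) => a b /=; by [].
Qed.
Lemma gmom0 : gmom 0 = 1. Proof. by []. Qed.
Lemma gmom1 : gmom 1 = 0. Proof. by []. Qed.

Lemma gmomS k : gmom k.+1 = k%:R * gmom k.-1.
Proof. by case: k => [|k]; rewrite ?gmom1 ?mul0r// gmomSS. Qed.

Definition gexp1 p : R := \sum_(i < size p) p`_i * gmom i.

Lemma gexp1wE N p : (size p <= N)%N -> gexp1 p = \sum_(i < N) p`_i * gmom i.
Proof.
move=> sp; rewrite /gexp1 (big_ord_widen _ (fun i => p`_i * gmom i) sp).
rewrite big_mkcond; apply: eq_bigr => i _.
by case: ltnP => // h; rewrite nth_default ?mul0r.
Qed.

Lemma gexp1D f g : gexp1 (f + g) = gexp1 f + gexp1 g.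
Proof.
rewrite !(@gexp1wE (maxn (size f) (size g))) ?leq_maxl ?leq_maxr ?size_polyD//.
by rewrite -big_split; apply: eq_bigr => i _; rewrite coefD mulrDl.
Qed.

Lemma gexp1Z c f : gexp1 (c *: f) = c * gexp1 f.
Proof.
rewrite (@gexp1wE (size f)) ?size_scale_leq// mulr_sumr.
by apply: eq_bigr => i _; rewrite coefZ mulrA.
Qed.

Lemma gexp1Mn f k : gexp1 (f *+ k) = k%:R * gexp1 f.
Proof. by rewrite -gexp1Z scaler_nat. Qed.

Lemma gexp10 : gexp1 0 = 0.
Proof. by rewrite -(scale0r 0) gexp1Z mul0r. Qed.

Lemma gexp1C c : gexp1 c%:P = c.
Proof.
by rewrite (@gexp1wE 1) ?size_polyC_leq1// big_ord1 coefC eqxx gmom0 mulr1.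
Qed.

(** Gaussian integration by parts, from the recursion of the moments. *)
Lemma gexp1_MX f : gexp1 (f * 'X) = gexp1 f^`().
Proof.
have : (size f <= size f)%N by [].
move: {2}(size f) => N sf.
rewrite (@gexp1wE N.+1); last first.
  by rewrite (leq_trans (size_polyMleq _ _))// size_polyX addn2.
rewrite big_ord_recl coefMX mul0r add0r (@gexp1wE N); last first.
  by rewrite (leq_trans (size_poly _ _))// (leq_trans (leq_pred _)).
case: N sf => [|N] sf; first by rewrite !big_ord0.
rewrite big_ord_recl big_ord_recr /= coefMX /= gmom1 mulr0 add0r.
have -> : f^`()`_N = 0 by rewrite coef_deriv nth_default ?mul0rn.
rewrite mul0r addr0.
apply: eq_bigr => i _; rewrite coefMX /= coef_deriv /bump /= !add1n gmomSS.
by rewrite -[_ *+ i.+1 in RHS]mulr_natr mulrA.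
Qed.

(** Plancherel's identity for Hermite polynomials: up to the square root of k!, the expectation of
    the k-th derivative is the k-th Hermite coefficient. Writing f = f1 X + c and integrating by
    parts reduces to f1 and its derivative, both of smaller size. It makes the expectation of a
    square a sum of squares. *)
Lemma gexp1_plancherel N f g (M : nat) : (size f <= N)%N -> (N <= M)%N ->
  gexp1 (f * g) =
  \sum_(k < M) (k`!%:R)^-1 * gexp1 (f^`(k)) * gexp1 (g^`(k)).
Proof.
elim: N f g M => [|N IH] f g M.
  rewrite leqn0 size_poly_eq0 => /eqP -> _; rewrite mul0r gexp10 big1// => k _.
  by rewrite derivnC; case: ifP => _; rewrite gexp10 mulr0 mul0r.
case: M => // M sf; rewrite ltnS => NM.
have [f1 [c fE]] : exists f1, exists c, f = f1 * 'X + c%:P.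
  by elim/poly_ind: f {IH sf} => [|p c _];
    [exists 0, 0; rewrite mul0r add0r | exists p, c].
have sf1 : (size f1 <= N)%N.
  have [->|f10] := eqVneq f1 0; first by rewrite size_poly0.
  have := size_MXaddC f1 c; rewrite -fE (negbTE f10) /= => h.
  by rewrite h ltnS in sf.
have sf1' : (size f1^`() <= N)%N.
  by rewrite (leq_trans (leq_trans (size_poly _ _) (leq_pred _))).
rewrite {1}fE mulrDl gexp1D mul_polyC gexp1Z mulrAC gexp1_MX derivM gexp1D.
rewrite (IH _ _ M.+1 sf1' (leqW NM)) (IH _ _ M sf1 NM).
rewrite !big_ord_recl /= fact0 invr1 !mul1r ?derivn0 ?derivn1.
have -> : gexp1 f = gexp1 f1^`() + c by rewrite fE gexp1D gexp1_MX gexp1C.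
set S1 := \sum_(i < M) _; set S2 := \sum_(i < M) _; set S3 := \sum_(i < M) _.
suff -> : S3 = S1 + S2 by ring.
rewrite -big_split /=; apply: eq_bigr => k _; rewrite /bump /= !add1n.
rewrite fE -!derivnS derivnMXaddC gexp1D gexp1_MX gexp1Mn.
rewrite -!derivnS -!derivSn mulrDr mulrDl addrC; congr (_ + _); congr (_ * _).
rewrite !add0n mulrA; congr (_ * _).
by rewrite factS natrM invfM mulrAC mulVf ?pnatr_eq0// mul1r.
Qed.

Lemma gexp1_sqr_ge0 g : 0 <= gexp1 (g ^+ 2).
Proof.
rewrite expr2 (gexp1_plancherel _ (leqnn _) (leqnn _)); apply: sumr_ge0 => k _.
by rewrite -mulrA mulr_ge0 ?invr_ge0 ?ler0n// -expr2 sqr_ge0.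
Qed.

(** Continuity from one side, the right for e = 1 and the left for e = -1. It recovers the sign at a
    root a of a quotient by X - a, which is known only away from a. *)
Lemma poly_ge0_at q (a e : R) : e ^+ 2 = 1 ->
  (forall h, 0 < h <= 1 -> 0 <= q.[a + e * h]) -> 0 <= q.[a].
Proof.
move=> e2 hq; rewrite leNgt; apply/negP => qa.
have : root (q - q.[a]%:P) a by rewrite /root !hornerE subrr.
case/factor_theorem => s qE.
have [M HM] := poly_itv_bound s (a - 1) (a + 1).
have e1 : `|e| = 1 by apply/eqP; rewrite -sqrp_eq1// real_normK ?num_real// e2.
have M0 : 0 <= M.
  by rewrite (le_trans _ (HM a _)) ?normr_ge0// lerBlDr lerDl ler01.
(* Small enough that the variation M h of q is less than half of -q(a). *)
pose h := Num.min 1 (- q.[a] / (2 * (M + 1))).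
have h0 : 0 < h by rewrite lt_min ltr01 divr_gt0//; lra.
have h1 : h <= 1 by rewrite ge_min lexx.
have h2 : h * (2 * (M + 1)) <= - q.[a].
  by rewrite -ler_pdivlMr ?ge_min ?lexx ?orbT//; lra.
have := hq h; rewrite h0 h1 => /(_ isT).
have /(congr1 (horner^~ (a + e * h))) := qE; rewrite !hornerE /= => qh.
have se : `|s.[a + e * h] * (e * h)| <= M * h.
  rewrite normrM; apply: ler_pM => //.
    apply: HM; have := ler_norm (e * h); have := ler_normr (e * h) (e * h).
    rewrite !normrM e1 mul1r (gtr0_norm h0) => _ k1.
    have := ler_norm (- (e * h)); rewrite normrN normrM e1 mul1r (gtr0_norm h0).
    by move=> k2; apply/andP; split; lra.
  by rewrite normrM e1 mul1r (gtr0_norm h0).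
move: se; rewrite ler_norml => /andP[_ se].
have -> : q.[a + e * h] = q.[a] + s.[a + e * h] * (e * h).
  by rewrite -[LHS](subrK q.[a]) qh; ring.
move=> k; nra.
Qed.

(* A real root of p is double, so (X - a)^2 divides p; a complex root a + i b
   gives the factor (X - a)^2 + b^2. *)
Lemma gexp1_ge0_sqr N p g : (size p <= N)%N -> (forall x, 0 <= p.[x]) ->
  0 <= gexp1 (p * g ^+ 2).
Proof.
elim: N p g => [|N IH] p g.
  by rewrite leqn0 size_poly_eq0 => /eqP -> _; rewrite mul0r gexp10.
move=> sp p0.
have [sp1|sp1] := leqP (size p) 1.
  rewrite (size1_polyC sp1) mul_polyC gexp1Z mulr_ge0 ?gexp1_sqr_ge0//.
  by have := p0 0; rewrite {1}(size1_polyC sp1) hornerC.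
have pn0 : p != 0 by rewrite -size_poly_gt0 (ltn_trans _ sp1).
have subN (d p2 : {poly R}) : p = p2 * d -> (1 < size d)%N -> (size p2 <= N)%N.
  move=> pE sd; have : p != 0 by []; rewrite pE mulf_eq0 negb_or => /andP[h2 h].
  by move: sp; rewrite pE size_mul//; move: sd; move: (size d) (size p2) => u v; lia.
pose pc : {poly Cplx R} := map_poly (real_complex R) p.
have /closed_rootP [z] : size pc != 1 by rewrite size_map_poly neq_ltn sp1 orbT.
move=> rz.
have [imz|imz] := eqVneq (im z) 0.
  pose a := re z.
  have rp : root p a.
    move: rz; rewrite /pc (_ : z = real_complex R a) ?fmorph_root//.
    by apply: re_im_eq.
  have [p1 p1E] := factor_theorem _ _ rp.
  (* p1 is nonnegative to the right of a and nonpositive to the left. *)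
  have p1r : root p1 a.
    have h1 : 0 <= p1.[a].
      apply: (@poly_ge0_at p1 a 1); rewrite ?expr1n// => h /andP[h0 _].
      have := p0 (a + 1 * h); rewrite p1E !hornerE => h2.
      by rewrite -(pmulr_lge0 _ h0); apply: le_trans h2 _; rewrite le_eqVlt; apply/orP; left; apply/eqP; ring.
    have h2 : 0 <= (- p1).[a].
      apply: (@poly_ge0_at _ a (-1)); rewrite ?sqrrN ?expr1n// => h /andP[h0 _].
      have := p0 (a + -1 * h); rewrite p1E !hornerE => h2.
      by rewrite -(pmulr_lge0 _ h0); apply: le_trans h2 _; rewrite le_eqVlt; apply/orP; left; apply/eqP; ring.
    by rewrite /root; apply/eqP; move: h2; rewrite hornerN; lra.
  have [p2 p2E] := factor_theorem _ _ p1r.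
  have pE : p = p2 * ('X - a%:P) ^+ 2 by rewrite p1E p2E expr2 mulrA.
  rewrite pE -mulrA -exprMn; apply: IH.
    by apply: (subN _ _ pE); rewrite size_exp_XsubC.
  have h0 x : x != a -> 0 <= p2.[x].
    move=> xa; have := p0 x; rewrite pE hornerM horner_exp hornerXsubC.
    by rewrite pmulr_lge0// exprn_even_gt0//= subr_eq0.
  move=> x; have [->|/h0//] := eqVneq x a.
  apply: (@poly_ge0_at p2 a 1); rewrite ?expr1n// => h /andP[h1 _].
  by apply: h0; rewrite mul1r -subr_eq0 addrAC subrr add0r gt_eqF.
pose a := re z; pose b := im z.
pose D : {poly R} := ('X - a%:P) ^+ 2 + (b ^+ 2)%:P.
have sD : size D = 3%N.
  rewrite size_polyDl size_exp_XsubC// (leq_ltn_trans (size_polyC_leq1 _))//.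
have Dz : (map_poly (real_complex R) D).[z] = 0 :> Cplx R.
  rewrite rmorphD rmorphXn rmorphB /= map_polyX !map_polyC /= !hornerE.
  rewrite -[(a%:C)%C]/(cR a) -[((b ^+ 2)%:C)%C]/(cR (b ^+ 2)).
  apply: re_im_eq; rewrite !expr2 !(reD, reN, reM, imD, imN, imM, re_cR, im_cR) /a /b ?re0 ?im0; ring.
(* The remainder has degree at most 1 and vanishes at the non-real point z: the imaginary part kills
   its coefficient of X, then the real part its constant. *)
have rE : modp p D = 0.
  have sr : (size (modp p D) <= 2)%N.
    by rewrite -ltnS -sD ltn_modp -size_poly_gt0 sD.
  move: (rz); rewrite /root /pc {1}(divp_eq p D) rmorphD rmorphM /= hornerD hornerM.
  rewrite Dz mulr0 add0r => /eqP.
  rewrite (@horner_coef_wide _ 2); last by rewrite size_map_poly.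
  rewrite big_ord_recl big_ord1 !coef_map /= expr0 mulr1 expr1.
  move=> e'; have e : cR (modp p D)`_0 + cR (modp p D)`_1 * z = 0 := e'.
  have := congr1 (@im R) e; rewrite imD im_cR im_cRM im0 add0r.
  move/eqP; rewrite mulf_eq0 (negbTE imz) orbF => /eqP e1.
  have := congr1 (@re R) e; rewrite reD re_cR re_cRM e1 mul0r addr0 re0 => e0.
  apply/polyP => -[|[|i]]; rewrite coef0 ?e0 ?e1//.
  by rewrite nth_default// (leq_trans sr).
have pE : p = (divp p D) * D by rewrite {1}(divp_eq p D) rE addr0.
(* Both summands of D are squares and are absorbed into g^2; this is why the induction carries the
   factor g^2. *)
rewrite pE; have -> : divp p D * D * g ^+ 2 =
    divp p D * (('X - a%:P) * g) ^+ 2 + divp p D * (b%:P * g) ^+ 2.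
  by rewrite /D rmorphXn /=; ring.
have sq : (size (divp p D) <= N)%N by apply: (subN D) => //; rewrite sD.
have q0 x : 0 <= (divp p D).[x].
  have := p0 x; rewrite {1}pE hornerM pmulr_lge0// /D hornerD horner_exp hornerXsubC hornerC.
  by rewrite ltr_wpDl ?sqr_ge0// exprn_even_gt0.
by rewrite gexp1D addr_ge0// IH.
Qed.

Lemma gexp1_ge0 p : (forall x, 0 <= p.[x]) -> 0 <= gexp1 p.
Proof.
move=> p0; rewrite -[p]mulr1 -(expr1n _ 2).
exact: (gexp1_ge0_sqr _ (leqnn _)).
Qed.
End Gauss1.

(** * Polynomials in n independent Gaussian variables *)

Section GaussN.
Variables (R : realType) (n : nat).
Local Notation C := (Cplx R).
Local Notation mp := (mpoly n C).
Implicit Types (f g : mp) (m : multinom n).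

Definition hom (d : nat) : qualifier 0 mp := ishomog1 d mdeg.
Definition mX (j : 'I_n) : mp := mpolyX C (mnm1 j).

Lemma mp_ind (P : mp -> Prop) :
  P 0 -> (forall c m, P (c *: mpolyX C m)) ->
  (forall f g, P f -> P g -> P (f + g)) -> forall f, P f.
Proof.
move=> h0 h1 h2; apply: mpolyind => // c m f _ _; exact: h2.
Qed.

Lemma hom_ind d (P : mp -> Prop) :
  P 0 -> (forall c m, mdeg m = d -> P (c *: mpolyX C m)) ->
  (forall f g, P f -> P g -> P (f + g)) -> forall f, f \is hom d -> P f.
Proof.
move=> h0 h1 h2 f /dhomogP hf; rewrite (mpolyE f) big_seq.
by apply: big_ind => // m /hf; apply: h1.
Qed.

Section LinForm.
Variable w : multinom n -> C.
(** The linear form with prescribed values w on the monomials; the Gaussian expectation and the mean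
    over the sphere are two instances. *)
Definition lform f : C := locked (\sum_(m <- msupp f) mcoeff m f * w m).

Lemma lformE k f : (mmeasure mdeg f <= k)%N ->
  lform f = \sum_(m : bmultinom n k) mcoeff m f * w m.
Proof.
move=> le_pi; pose I : subFinType _ := bmultinom n k.
rewrite /lform -lock (ssrcomplements.big_mksub I) ?msupp_uniq //=; first last.
  by move=> x /msize_mdeg_lt /leq_trans; apply.
by rewrite big_rmcond //= => j /memN_msupp_eq0 ->; rewrite mul0r.
Qed.

Lemma lformD f g : lform (f + g) = lform f + lform g.
Proof.
pose k := maxn (mmeasure mdeg f) (mmeasure mdeg g).
rewrite !(@lformE k) ?leq_maxl ?leq_maxr ?mmeasureD_le//.
by rewrite -big_split; apply: eq_bigr => m _; rewrite mcoeffD mulrDl.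
Qed.

Lemma lformZ c f : lform (c *: f) = c * lform f.
Proof.
rewrite !(@lformE (mmeasure mdeg f)) ?mmeasureZ_le// mulr_sumr.
by apply: eq_bigr => m _; rewrite mcoeffZ mulrA.
Qed.

Lemma lform0 : lform 0 = 0.
Proof. by rewrite -(scale0r 0) lformZ mul0r. Qed.

Lemma lformX m : lform (mpolyX C m) = w m.
Proof. by rewrite /lform -lock msuppX big_seq1 mcoeffX eqxx mul1r. Qed.

Lemma lformN f : lform (- f) = - lform f.
Proof. by rewrite -scaleN1r lformZ mulN1r. Qed.

Lemma lformB f g : lform (f - g) = lform f - lform g.
Proof. by rewrite lformD lformN. Qed.

Lemma lform_sum (I : Type) (r : seq I) (P : pred I) (F : I -> mp) :
  lform (\sum_(i <- r | P i) F i) = \sum_(i <- r | P i) lform (F i).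
Proof. exact: (big_morph lform lformD lform0). Qed.
End LinForm.

Definition gwt m : R := \prod_(i < n) gmom R (m i).
Definition gE : mp -> C := lform (fun m => cR (gwt m)).

Lemma gE_stein j f : gE (mX j * f) = gE (mderiv j f).
Proof.
elim/mp_ind: f => [|c m|f g IHf IHg]; first by rewrite mulr0 mderiv0.
  rewrite -scalerAr mderivZ mderivX /gE !lformZ /mX -mpolyXD !lformX.
  congr (_ * _); rewrite -cRn -cRM; congr cR.
  rewrite /gwt (bigD1 j) //= [in RHS](bigD1 j) //= mnmDE mnmBE mnm1E eqxx.
  rewrite add1n gmomS subn1 mulrA; congr (_ * _); apply: eq_bigr => i ij.
  by rewrite mnmDE mnmBE mnm1E eq_sym (negbTE ij) add0n subn0.
by rewrite mulrDr mderivD /gE !lformD -/gE IHf IHg.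
Qed.

Lemma gexp1_sum (I : Type) (r : seq I) (F : I -> {poly R}) :
  gexp1 (\sum_(i <- r) F i) = \sum_(i <- r) gexp1 (F i).
Proof. exact: (big_morph _ (@gexp1D R) (gexp10 R)). Qed.

Lemma gexp1Xn k : gexp1 ('X^k : {poly R}) = gmom R k.
Proof.
rewrite (@gexp1wE _ k.+1) ?size_polyXn// big_ord_recr /= coefXn eqxx mul1r.
by rewrite big1 ?add0r// => i _; rewrite coefXn ltn_eqF ?mul0r.
Qed.

Definition rpt (x : 'I_n -> R) : 'I_n -> C := fun i => cR (x i).

(* The variables are replaced by Gaussian ones one at a time. *)
Lemma gE_ge0 f : (forall x, 0 <= re (meval (rpt x) f)) -> 0 <= re (gE f).
Proof.
move=> f0.
(* [Phi k x] is the expectation in the first k variables with the others fixed at x. Real parts of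
   the coefficients suffice because all points are real. *)
pose t k (x : 'I_n -> R) m (i : 'I_n) : R :=
  if (i < k)%N then gmom R (m i) else x i ^+ m i.
pose Phi k x := \sum_(m <- msupp f) re (mcoeff m f) * \prod_i t k x m i.
have Phi0 x : 0 <= Phi 0%N x.
  have := f0 x; rewrite mevalE re_sum /Phi; congr (_ <= _).
  apply: eq_bigr => m _; rewrite (_ : \prod_i _ = cR (\prod_i x i ^+ m i)).
    by rewrite mulrC re_cRM mulrC.
  by rewrite cR_prod; apply: eq_bigr => i _; rewrite cRX.
suff : forall k, (k <= n)%N -> forall x, 0 <= Phi k x.
  move=> /(_ n (leqnn _) (fun=> 0)); congr (_ <= _).
  rewrite /Phi /gE /lform -lock re_sum; apply: eq_bigr => m _.
  rewrite [in RHS]mulrC re_cRM mulrC; congr (_ * _); apply: eq_bigr => i _.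
  by rewrite /t ltn_ord.
elim=> [//|k IH] kn x.
pose k0 := Ordinal kn.
pose pk : {poly R} := \sum_(m <- msupp f)
  (re (mcoeff m f) * \prod_(i | i != k0) t k x m i) *: 'X^(m k0).
have -> : Phi k.+1 x = gexp1 pk.
  rewrite gexp1_sum; apply: eq_bigr => m _; rewrite gexp1Z gexp1Xn.
  rewrite (bigD1 k0)//= {1}/t leqnn -mulrA; congr (_ * _); rewrite mulrC.
  congr (_ * _); apply: eq_bigr => i ik; rewrite /t ltnS leq_eqVlt.
  by have /negbTE -> : (i : nat) != k by [].
apply: gexp1_ge0 => s.
have := IH (ltnW kn) (fun i => if i == k0 then s else x i); congr (_ <= _).
rewrite horner_sum; apply: eq_bigr => m _; rewrite hornerZ hornerXn.
rewrite (bigD1 k0)//= {1}/t ltnn eqxx -mulrA; congr (_ * _); rewrite mulrC.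
by congr (_ * _); apply: eq_bigr => i ik; rewrite /t (negbTE ik).
Qed.

End GaussN.

(** * Homogeneous polynomials and the Laplacian *)

Section Homog.
Variables (R : realType) (n : nat).
Local Notation C := (Cplx R).
Local Notation mp := (mpoly n C).
Local Notation hom := (@hom R n).
Local Notation mX := (@mX R n).
Implicit Types (f g : mp) (m : multinom n).

Lemma homM d e f g : f \is hom d -> g \is hom e -> f * g \is hom (d + e).
Proof. exact: dhomogM. Qed.

Lemma homX d k f : f \is hom d -> f ^+ k \is hom (d * k).
Proof. exact: dhomogMn. Qed.

Lemma homD d f g : f \is hom d -> g \is hom d -> f + g \is hom d.
Proof. exact: rpredD. Qed.

Lemma homN d f : f \is hom d -> - f \is hom d.
Proof. by move=> hf; rewrite /hom dhomogN. Qed.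

Lemma homB d f g : f \is hom d -> g \is hom d -> f - g \is hom d.
Proof. by move=> hf hg; apply: homD => //; apply: homN. Qed.

Lemma homZ d c f : f \is hom d -> c *: f \is hom d.
Proof. exact: dhomogZ. Qed.

Lemma hom0 d : 0 \is hom d.
Proof. exact: dhomog0. Qed.

Lemma hom1 : 1 \is hom 0.
Proof. exact: dhomog1. Qed.

Lemma hom_sum d (I : eqType) (r : seq I) (P : pred I) (F : I -> mp) :
  (forall i, i \in r -> P i -> F i \is hom d) -> \sum_(i <- r | P i) F i \is hom d.
Proof.
move=> h; rewrite big_seq_cond; apply: rpred_sum => i /andP[ir Pi]; exact: h.
Qed.

Lemma hom_sumT d (I : finType) (P : pred I) (F : I -> mp) :
  (forall i, P i -> F i \is hom d) -> \sum_(i | P i) F i \is hom d.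
Proof. by move=> h; apply: hom_sum => i _; apply: h. Qed.

Lemma hom_mX j : mX j \is hom 1.
Proof. by rewrite /hom dhomogX /= mdeg1. Qed.

Lemma hom_X m : mpolyX C m \is hom (mdeg m).
Proof. by rewrite /hom dhomogX. Qed.

Lemma hom_mderiv d j f : f \is hom d -> mderiv j f \is hom d.-1.
Proof.
move: f; apply: hom_ind => [|c m md|f g IHf IHg]; first by rewrite mderiv0 hom0.
  rewrite mderivZ mderivX; apply/homZ.
  have [->|mj] := eqVneq (m j) 0%N; first by rewrite scale0r hom0.
  apply/homZ; rewrite /hom dhomogX /= -md; apply/eqP.
  have mE : m = mnm_add (mnm_sub m (mnm1 j)) (mnm1 j).
    by rewrite submK// lep1mP.
  by rewrite [in RHS]mE mdegD mdeg1 addn1.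
by rewrite mderivD; apply: homD.
Qed.

Lemma mderiv_sum j (I : Type) (r : seq I) (P : pred I) (F : I -> mp) :
  mderiv j (\sum_(i <- r | P i) F i) = \sum_(i <- r | P i) mderiv j (F i).
Proof. exact: (big_morph (mderiv j) (mderivD j) (mderiv0 _ j)). Qed.

Lemma mderiv_mX i j : mderiv i (mX j) = (i == j)%:R.
Proof.
rewrite /mX mderivX mnm1E eq_sym; case: eqVneq => [->|_]; last by rewrite scale0r.
rewrite scale1r; have -> : mnm_sub (mnm1 j) (mnm1 j) = mnm0.
  by apply/mnmP => k; rewrite mnmBE mnm0E subnn.
by rewrite mpolyX0.
Qed.

Lemma euler d f : f \is hom d -> \sum_j mX j * mderiv j f = d%:R *: f.
Proof.
move: f; apply: hom_ind => [|c m md|f g IHf IHg].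
- by rewrite scaler0 big1// => j _; rewrite mderiv0 mulr0.
- rewrite -md mdegE natr_sum scaler_suml; apply: eq_bigr => j _.
  rewrite mderivZ mderivX -!scalerAr scalerA mulrC -scalerA.
  have [->|mj] := eqVneq (m j) 0%N; first by rewrite !scale0r.
  congr (_ *: (_ *: _)); rewrite /mX -mpolyXD; congr mpolyX.
  by rewrite addmC submK// lep1mP.
- rewrite scalerDr -IHf -IHg -big_split; apply: eq_bigr => j _.
  by rewrite mderivD mulrDr.
Qed.

Definition lap f : mp := \sum_j mderiv j (mderiv j f).
Definition r2 : mp := \sum_j mX j * mX j.

Lemma hom_lap d f : f \is hom d -> lap f \is hom (d - 2).
Proof.
move=> hf; apply: hom_sumT => j _.
have -> : (d - 2 = d.-1.-1)%N by rewrite -subn2.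
by do 2!apply: hom_mderiv.
Qed.

Lemma hom_r2 : r2 \is hom 2.
Proof. by apply: hom_sumT => j _; apply: (@homM 1 1); apply: hom_mX. Qed.

Lemma hom_r2X k : r2 ^+ k \is hom (2 * k).
Proof. exact/homX/hom_r2. Qed.

Lemma lapD f g : lap (f + g) = lap f + lap g.
Proof. by rewrite -big_split; apply: eq_bigr => j _; rewrite !mderivD. Qed.

Lemma lapZ c f : lap (c *: f) = c *: lap f.
Proof. by rewrite scaler_sumr; apply: eq_bigr => j _; rewrite !mderivZ. Qed.

Lemma lapB f g : lap (f - g) = lap f - lap g.
Proof. by rewrite lapD -[- g]scaleN1r lapZ scaleN1r. Qed.

Lemma mderiv_r2 j : mderiv j r2 = 2%:R *: mX j.
Proof.
rewrite /r2 mderiv_sum (bigD1 j)//= big1 => [|i ij].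
  by rewrite mderivM mderiv_mX eqxx mul1r mulr1 addr0 scaler_nat mulr2n.
by rewrite mderivM mderiv_mX eq_sym (negbTE ij) mul0r mulr0 addr0.
Qed.

Lemma lap_r2 d f : f \is hom d ->
  lap (r2 * f) = r2 * lap f + (2 * n + 4 * d)%:R *: f.
Proof.
move=> hf.
have E j : mderiv j (mderiv j (r2 * f)) =
    r2 * mderiv j (mderiv j f) + (4%:R *: (mX j * mderiv j f) + 2%:R *: f).
  rewrite !(mderivM, mderivD) !mderiv_r2 mderivZ mderiv_mX eqxx.
  have -> : 4%:R = 2%:R + 2%:R :> C by rewrite -natrD.
  rewrite -!scalerAl mul1r [(2%:R + 2%:R) *: _]scalerDl.
  move: (2%:R *: f) (2%:R *: (mX j * mderiv j f)) (r2 * _) => u v w.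
  by rewrite (AC (2*2) (4*((2*3)*1))).
apply: etrans (eq_bigr _ (fun j _ => E j)) _.
rewrite big_split big_split /= -mulr_sumr -scaler_sumr (euler hf) sumr_const card_ord; congr (_ + _).
rewrite -[_ *+ n]scaler_nat !scalerA -scalerDl -!natrM -natrD.
by rewrite addnC [(n * 2)%N]mulnC.
Qed.

(** Iterates the commutator of [lap] with [r2]. The operator left behind [r2 ^+ s] is of the shape
    inverted in [kc_surj]. *)
Lemma lap_r2X s d f : f \is hom d ->
  lap (r2 ^+ s.+1 * f) =
  r2 ^+ s * (r2 * lap f + (2 * s.+1 * (2 * s + n + 2 * d))%:R *: f).
Proof.
move=> hf; elim: s => [|s IH].
  rewrite expr1 expr0 mul1r (lap_r2 hf); congr (_ + _ *: _); congr (_%:R); lia.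
have h1 : r2 ^+ s.+1 * f \is hom (2 * s.+1 + d) by apply: homM => //; apply: hom_r2X.
rewrite exprS -mulrA (lap_r2 h1) IH mulrA -exprS [RHS]mulrDr mulrDr -addrA.
congr (_ + _); rewrite -!scalerAr -scalerDl; congr (_ *: _).
by rewrite -natrD; congr (_%:R); lia.
Qed.
End Homog.

(** * The inner product of the sphere on forms *)

Section Sphere.
Variables (R : realType) (n : nat).
Hypothesis n0 : (0 < n)%N.
Local Notation C := (Cplx R).
Local Notation mp := (mpoly n C).
Local Notation hom := (@hom R n).
Local Notation mX := (@mX R n).
Local Notation r2 := (@r2 R n).
Local Notation lap := (@lap R n).
Local Notation rpt := (@rpt R n).
Local Notation gE := (@gE R n).
Implicit Types (f g : mp) (m : multinom n).

(** n (n+2) ... (n+2k-2), the moment of order 2k of the length of a standard Gaussian vector. *)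
Definition nn k : R := \prod_(i < k) (n + 2 * i)%:R.
Lemma nn_gt0 k : 0 < nn k.
Proof. by apply: prodr_gt0 => i _; rewrite ltr0n addn_gt0 n0. Qed.
Lemma nnS k : nn k.+1 = nn k * (n + 2 * k)%:R.
Proof. by rewrite /nn big_ord_recr. Qed.

(* On forms of degree d, the Gaussian expectation is the mean over the unit
   sphere times the radial moment nn d./2. *)
Definition gS : mp -> C := lform (fun m => cR (gwt R m / nn (mdeg m)./2)).

Lemma gS_hom d f : f \is hom d -> gE f = cR (nn d./2) * gS f.
Proof.
move: f; apply: hom_ind => [|c m md|f g IHf IHg].
- by rewrite /gE /gS !lform0 mulr0.
- rewrite /gE /gS !lformZ !lformX mulrCA md -cRM; congr (_ * cR _).
  by rewrite mulrCA divff ?mulr1// gt_eqF// nn_gt0.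
- by rewrite /gE /gS !lformD mulrDr -[lform _ f]/(gE f) IHf -IHg.
Qed.

Lemma gSE d f : f \is hom d -> gS f = cR (nn d./2)^-1 * gE f.
Proof.
move=> hf; rewrite (gS_hom hf) mulrA -cRM mulVf ?mul1r//.
by rewrite gt_eqF// nn_gt0.
Qed.

Lemma gE_sum (I : Type) (r : seq I) (P : pred I) (F : I -> mp) :
  gE (\sum_(i <- r | P i) F i) = \sum_(i <- r | P i) gE (F i).
Proof. exact: lform_sum. Qed.

Lemma gE_r2 d f : f \is hom d -> gE (r2 * f) = (n + d)%:R * gE f.
Proof.
move=> hf; rewrite mulr_suml gE_sum.
have E j : gE (mX j * mX j * f) = gE f + gE (mX j * mderiv j f).
  by rewrite -mulrA gE_stein mderivM mderiv_mX eqxx mul1r /gE lformD.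
rewrite (eq_bigr _ (fun j _ => E j)) big_split /= -[X in _ + X]gE_sum (euler hf) /gE lformZ.
by rewrite sumr_const card_ord -[_ *+ n]mulr_natl -mulrDl -natrD.
Qed.

(** [r2] is 1 on the sphere: the factor n + d of [gE_r2] is exactly the quotient of two successive
    radial moments. *)
Lemma gS_r2 d f : ~~ odd d -> f \is hom d -> gS (r2 * f) = gS f.
Proof.
move=> od hf; have h : r2 * f \is hom (2 + d) by apply: homM => //; apply: hom_r2.
rewrite (gSE h) (gE_r2 hf) (gS_hom hf) /= nnS mulrA -cRn mulrA -!cRM.
rewrite (_ : _ * nn _ = 1) ?mul1r//.
rewrite mul2n (_ : d./2.*2 = d)%N; last by rewrite -[RHS]odd_double_half (negbTE od).
have := nn_gt0 d./2; set x := nn _; set y := (n + d)%:R => x0.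
have y0 : y != 0 by rewrite pnatr_eq0 addn_eq0 negb_and -lt0n n0.
by rewrite -mulrA [y * x]mulrC mulVf// mulf_neq0// gt_eqF.
Qed.

(** Green's formula. Euler's identity replaces d f by the sum of the x_j d_j f, and each x_j is
    integrated by parts. *)
Lemma gradE d f g : f \is hom d ->
  gE (lap f * g) + \sum_j gE (mderiv j f * mderiv j g) = d%:R * gE (f * g).
Proof.
move=> hf; rewrite mulr_suml gE_sum -big_split /=.
rewrite /gE -lformZ scalerAl -(euler hf) mulr_suml lform_sum.
apply: eq_bigr => j _.
rewrite -lformD -mderivM -mulrA; exact/esym/gE_stein.
Qed.

(** Only the coefficients are conjugated: at real points this conjugates the values, and the result
    is still a polynomial. *)
Definition cj : mp -> mp := locked (map_mpoly (@Num.conj_op C)).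

Lemma cjE : cj = map_mpoly (@Num.conj_op C).
Proof. by rewrite /cj -lock. Qed.

Lemma mcoeff_cj m f : mcoeff m (cj f) = (mcoeff m f)^*.
Proof. by rewrite cjE; exact: mcoeff_map_mpoly. Qed.

Lemma cjM f g : cj (f * g) = cj f * cj g.
Proof. by rewrite cjE; exact: rmorphM. Qed.
Lemma cjD f g : cj (f + g) = cj f + cj g.
Proof. by rewrite cjE; exact: raddfD. Qed.
Lemma cj0 : cj 0 = 0. Proof. by rewrite cjE; exact: raddf0. Qed.
Lemma cjK f : cj (cj f) = f.
Proof. by apply/mpolyP => m; rewrite !mcoeff_cj conjCK. Qed.
Lemma cjZ c f : cj (c *: f) = c^* *: cj f.
Proof. by apply/mpolyP => m; rewrite mcoeff_cj 2!mcoeffZ mcoeff_cj conjM. Qed.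
Lemma cjX m : cj (mpolyX C m) = mpolyX C m.
Proof. by apply/mpolyP => k; rewrite mcoeff_cj !mcoeffX conj_n. Qed.
Lemma cj_mderiv j f : cj (mderiv j f) = mderiv j (cj f).
Proof.
by apply/mpolyP => m; rewrite mcoeff_cj !mcoeff_mderiv mcoeff_cj conjMn.
Qed.
Lemma hom_cj d f : f \is hom d -> cj f \is hom d.
Proof.
move: f; apply: hom_ind => [|c m md|f g IHf IHg].
- by rewrite cj0 hom0.
- by rewrite cjZ cjX; apply: homZ; rewrite -md hom_X.
- by rewrite cjD; apply: homD.
Qed.
Lemma meval_cj x f : meval (rpt x) (cj f) = (meval (rpt x) f)^*.
Proof.
elim/mp_ind: f => [|c m|f g IHf IHg]; first by rewrite cj0 !meval0 conj0.
  rewrite cjZ cjX !mevalZ conjM !mevalX conj_prod; congr (_ * _).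
  apply: eq_bigr => i _; by rewrite conjX conj_cR.
by rewrite cjD !mevalD conjD; congr (_ + _).
Qed.
Lemma gS_cj f : gS (cj f) = (gS f)^*.
Proof.
elim/mp_ind: f => [|c m|f g IHf IHg]; first by rewrite cj0 /gS lform0 conj0.
  by rewrite cjZ cjX /gS !lformZ conjM !lformX conj_cR.
by rewrite cjD /gS !lformD conjD; congr (_ + _).
Qed.

Lemma gS_ge0 d f : f \is hom d -> (forall x, 0 <= re (meval (rpt x) f)) ->
  0 <= re (gS f).
Proof.
move=> hf /gE_ge0; rewrite (gS_hom hf) re_cRM pmulr_rge0//.
exact: nn_gt0.
Qed.

(** The real part of the hermitian product in L^2 of the sphere; it induces the same norm and is
    bilinear over R. *)
Definition sg : mp -> mp -> R := locked (fun f g => re (gS (f * cj g))).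

Lemma sgE f g : sg f g = re (gS (f * cj g)).
Proof. by rewrite /sg -lock. Qed.

Lemma sgC f g : sg f g = sg g f.
Proof.
rewrite !sgE -[LHS]re_conj -gS_cj cjM cjK; congr (re (gS _)).
exact: mulrC.
Qed.
Lemma sgDl f1 f2 g : sg (f1 + f2) g = sg f1 g + sg f2 g.
Proof. by rewrite !sgE mulrDl /gS lformD reD. Qed.
Lemma sgDr f g1 g2 : sg f (g1 + g2) = sg f g1 + sg f g2.
Proof. by rewrite sgC sgDl !(sgC f). Qed.
Lemma sgZl a f g : sg (cR a *: f) g = a * sg f g.
Proof. by rewrite !sgE -scalerAl /gS lformZ re_cRM. Qed.
Lemma sg0l g : sg 0 g = 0.
Proof. by rewrite -(scale0r 0) -cR0 sgZl mul0r. Qed.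

Lemma sgZZ c f : sg (c *: f) (c *: f) = cabs c ^+ 2 * sg f f.
Proof.
rewrite !sgE cjZ -scalerAl -scalerAr scalerA conjM_cabs /gS lformZ.
by rewrite re_cRM.
Qed.

Lemma sg_ge0 d f : f \is hom d -> 0 <= sg f f.
Proof.
move=> hf; rewrite sgE; apply: (@gS_ge0 (d + d)).
  by apply: homM => //; apply: hom_cj.
move=> x; rewrite mevalM meval_cj conjM_cabs re_cR.
by rewrite sqr_ge0.
Qed.

Lemma sg_r2l d e f g : ~~ odd (d + e) -> f \is hom d -> g \is hom e ->
  sg (r2 * f) g = sg f g.
Proof.
move=> ode hf hg; rewrite !sgE -mulrA (@gS_r2 (d + e)%N)//.
by apply: homM => //; apply: hom_cj.
Qed.

Lemma sg_r2r d e f g : ~~ odd (d + e) -> f \is hom d -> g \is hom e ->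
  sg f (r2 * g) = sg f g.
Proof.
rewrite addnC => ode hf hg; rewrite [LHS]sgC [RHS]sgC.
exact: (sg_r2l ode hg hf).
Qed.

Lemma sg_r2Xr k d e f g : ~~ odd (d + e) -> f \is hom d -> g \is hom e ->
  sg f (r2 ^+ k * g) = sg f g.
Proof.
move=> ode hf hg; elim: k => [|k IH]; first by rewrite mul1r.
have h := homM (hom_r2X _ _ k) hg.
have o : ~~ odd (d + (2 * k + e))%N by rewrite addnCA mul2n oddD odd_double.
by rewrite exprS -mulrA (sg_r2r o hf h).
Qed.

Lemma mderiv_hom0 f j : f \is hom 0 -> mderiv j f = 0.
Proof.
move=> hf; have -> : f = mpolyC n (mcoeff mnm0 f).
  apply/mpolyP => m; rewrite mcoeffC; have [->|m0] := eqVneq m mnm0.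
    by rewrite mulr1.
  by rewrite mulr0; apply: (dhomog_nemf_coeff hf); rewrite mdeg_eq0.
by rewrite mderivC.
Qed.

Lemma lap_hom0 f : f \is hom 0 -> lap f = 0.
Proof. by move=> hf; rewrite /lap big1// => j _; rewrite (mderiv_hom0 _ hf) mderiv0. Qed.

Lemma lap_hom1 f : f \is hom 1 -> lap f = 0.
Proof.
move=> hf; rewrite /lap big1// => j _; apply: mderiv_hom0.
exact: (hom_mderiv _ hf).
Qed.

Lemma hom_lapM d f g : f \is hom d.+1 -> g \is hom d.+1 ->
  lap f * g \is hom (2 * d).
Proof.
case: d => [|d] hf hg; first by rewrite (lap_hom1 hf) mul0r hom0.
have -> : (2 * d.+1 = (d.+2 - 2) + d.+2)%N by lia.
by apply: homM => //; apply: hom_lap.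
Qed.

(** [gradE] carried to the sphere. The left side has degree 2d - 2 and the product f g has degree
    2d, so the radial moments differ by the factor n + 2(d - 1). *)
Lemma sgrad d f g : f \is hom d -> g \is hom d ->
  sg (lap f) g + \sum_j sg (mderiv j f) (mderiv j g) =
  (d * (n + 2 * d.-1))%:R * sg f g.
Proof.
case: d => [|d] hf hg.
  rewrite (lap_hom0 hf) mul0n mul0r big1 ?sg0l ?add0r// => j _.
  by rewrite (mderiv_hom0 _ hf) sg0l.
have hc := hom_cj hg.
have h1 := hom_lapM hf hc.
have h2 j : mderiv j f * mderiv j (cj g) \is hom (2 * d).
  by rewrite mul2n -addnn; apply: homM; apply: (hom_mderiv _ (d := d.+1)).
have h3 : f * cj g \is hom (2 * d.+1) by rewrite mul2n -addnn; apply: homM.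
have := congr1 (@re R) (gradE (cj g) hf).
rewrite (gS_hom h1) (gS_hom h3) (eq_bigr _ (fun j _ => gS_hom (h2 j))).
rewrite -mulr_sumr -mulrDr re_cRM -cRn re_cRM re_cRM reD re_sum.
rewrite !mul2n !doubleK nnS => /eqP.
rewrite [X in _ == X -> _]mulrA [_%:R * (nn d * _)]mulrCA -[X in _ == X -> _]mulrA.
have nz : nn d != 0 by rewrite gt_eqF// nn_gt0.
rewrite (inj_eq (mulfI nz)) => /eqP E.
rewrite /= natrM -!mul2n !sgE -E.
congr (_ + _); by apply: eq_bigr => j _; rewrite sgE cj_mderiv.
Qed.

(** All other terms of [sgrad] are symmetric in f and g. On forms of equal degree this is the
    symmetry of the spherical Laplacian. *)
Lemma sg_lapC d f g : f \is hom d -> g \is hom d ->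
  sg (lap f) g = sg f (lap g).
Proof.
move=> hf hg.
have e : \sum_j sg (mderiv j g) (mderiv j f) = \sum_j sg (mderiv j f) (mderiv j g).
  by apply: eq_bigr => j _; exact: sgC.
apply: (addIr (\sum_j sg (mderiv j f) (mderiv j g))).
apply: (etrans (sgrad hf hg)); apply: (etrans (congr1 ( *%R _) (sgC f g))).
exact: (etrans (esym (sgrad hg hf)) (congr2 +%R (sgC (lap g) f) e)).
Qed.
End Sphere.

(** Forms of degree d make a finite-dimensional space, where an injective endomorphism is onto. *)
Lemma hom_surj (R : realType) (n : nat) (n0 : (0 < n)%N) d
    (phi : mpoly n (Cplx R) -> mpoly n (Cplx R)) :
  (forall f g, phi (f + g) = phi f + phi g) ->
  (forall c f, phi (c *: f) = c *: phi f) ->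
  (forall f, f \is hom R n d -> phi f \is hom R n d) ->
  (forall f, f \is hom R n d -> phi f = 0 -> f = 0) ->
  forall g, g \is hom R n d -> exists2 f, f \is hom R n d & phi f = g.
Proof.
case: n n0 phi => // n _ phi phiD phiZ phih phii g hg.
pose V := dhomog n.+1 (Cplx R) d.
have hV (v : V) : mpoly_of_dhomog v \is hom R n.+1 d by exact: dhomog_is_dhomog.
pose F (v : V) : V := DHomog (phih _ (hV v)).
have Flin : linear F.
  by move=> c u v; apply/val_inj; rewrite /= phiD phiZ.
pose HF := GRing.isLinear.Build _ _ _ _ _ Flin.
pose FL : {linear V -> V} := HB.pack F HF.
have k0 : lker (linfun FL) == 0%VS.
  apply/lker0P => u v; rewrite !lfunE /= => e.
  have : F (u - v) = 0.
    by apply/val_inj; rewrite /= phiD -scaleN1r phiZ scaleN1r -[phi u]/(val (F u)) e subrr.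
  move=> /(congr1 val) /= /(phii _ (hV (u - v))) /= h.
  by apply/eqP; rewrite -subr_eq0; apply/eqP/val_inj.
pose v := (linfun FL)^-1%VF (DHomog hg : V).
exists (val v); first exact: hV.
by have /(congr1 val) := lker0_lfunVK k0 (DHomog hg : V); rewrite lfunE.
Qed.

(** * Positivity of the Laplacian on the sphere and the duality estimate *)

Section Key.
Variables (R : realType) (n : nat).
Hypothesis n0 : (0 < n)%N.
Local Notation C := (Cplx R).
Local Notation mp := (mpoly n C).
Local Notation hom := (@hom R n).
Local Notation mX := (@mX R n).
Local Notation r2 := (@r2 R n).
Local Notation lap := (@lap R n).
Local Notation sg := (@sg R n).
Implicit Types (f g : mp) (m : multinom n).

Lemma hom_lapS d f : f \is hom d.+2 -> lap f \is hom d.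
Proof. by move=> /hom_lap; rewrite !subSS subn0. Qed.

Lemma hom_K d f : f \is hom d -> r2 * lap f \is hom d.
Proof.
case: d => [|[|d]] hf.
- by rewrite (lap_hom0 hf) mulr0 hom0.
- by rewrite (lap_hom1 hf) mulr0 hom0.
- by apply: (@homM _ _ 2 d); [exact: hom_r2|apply: hom_lapS].
Qed.

Lemma sg_K d f g : f \is hom d -> g \is hom d -> sg (r2 * lap f) g = sg (lap f) g.
Proof.
case: d => [|[|d]] hf hg.
- by rewrite (lap_hom0 hf) mulr0.
- by rewrite (lap_hom1 hf) mulr0.
- apply: (sg_r2l n0 _ (hom_lapS hf) hg).
  by rewrite oddD /= negbK addbb.
Qed.

(** If f has norm 0, [sgrad] and the positivity of [lap] leave a gradient of norm 0; by induction on
    the degree the derivatives vanish, and Euler's identity gives f = 0. Positivity is assumed up to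
    degree d because [lap_pos] is proved by an induction that uses this lemma in lower degree. *)
Lemma sg_kpos_def d : (forall e f, (e <= d)%N -> f \is hom e -> 0 <= sg (lap f) f) ->
  forall f, f \is hom d -> sg f f = 0 -> f = 0.
Proof.
elim: d => [|d IH] kp f hf f0.
  have fE : f = (mcoeff mnm0 f) *: 1.
    apply/mpolyP => m; rewrite mcoeffZ mcoeff1; have [->|m0] := eqVneq m mnm0.
      by rewrite mulr1.
    by rewrite mulr0; apply: (dhomog_nemf_coeff hf); rewrite mdeg_eq0.
  move: f0; rewrite fE sgZZ; move/eqP; rewrite mulf_eq0 => /orP[|].
    by rewrite sqrf_eq0 cabs_eq0 => /eqP ->; rewrite scale0r.
  rewrite sgE mul1r.
  have -> : cj (1 : mp) = 1 by rewrite -mpolyX0 cjX.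
  rewrite -mpolyX0 /gS lformX mdeg0 /= /nn big_ord0 invr1 mulr1.
  by rewrite /gwt big1 ?oner_eq0// => i _; rewrite mnm0E.
have hd j : mderiv j f \is hom d := hom_mderiv j hf.
have : \sum_j sg (mderiv j f) (mderiv j f) <= 0.
  have := sgrad n0 hf hf; rewrite f0 mulr0 => e.
  have := kp _ _ (leqnn _) hf; move: e.
  by move: (sg _ f) (\sum_j _) => x y; lra.
have sp j : 0 <= sg (mderiv j f) (mderiv j f) by apply: (sg_ge0 n0 (hd j)).
move=> s0; have /eqP : \sum_j sg (mderiv j f) (mderiv j f) = 0.
  by apply/eqP; rewrite eq_le s0 sumr_ge0.
rewrite psumr_eq0// => /allP z.
have dz j : mderiv j f = 0.
  apply: IH => //; first by move=> e g ed; apply: kp; rewrite (leq_trans ed).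
  by apply/eqP/(z j); rewrite mem_index_enum.
have /eqP := euler hf; rewrite big1 => [|j _]; last by rewrite dz mulr0.
by rewrite eq_sym scaler_eq0 pnatr_eq0 /= => /eqP.
Qed.

(** A nonnegative operator plus c > 0 is injective: pairing the image of f with f leaves c |f|^2 at
    least. *)
Lemma kc_surj d c : 0 < c ->
  (forall e f, (e <= d)%N -> f \is hom e -> 0 <= sg (lap f) f) ->
  forall g, g \is hom d -> exists2 w, w \is hom d & r2 * lap w + cR c *: w = g.
Proof.
move=> c0 kp; apply: hom_surj => //.
- by move=> f g; rewrite lapD mulrDr scalerDr addrACA.
- move=> a f; rewrite lapZ scalerDr -scalerAr; congr (_ + _).
  by rewrite !scalerA [cR c * a]mulrC.
- by move=> f hf; apply: homD; [apply: hom_K|apply: homZ].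
move=> f hf e; apply: (sg_kpos_def kp) => //.
have := congr1 (fun g => sg g f) e; rewrite sgDl (sg_K hf hf) sgZl sg0l.
have := kp d f (leqnn _) hf; have := sg_ge0 n0 hf.
move: (sg f f) (sg (lap f) f) => x y x0 y0 h; nra.
Qed.

(* f = h + r2 * w with h harmonic and r2 * lap w + c w = lap f, so that
   sg (lap f) f = sg (lap w) w + c * sg w w with c > 0. *)
Lemma lap_pos d f : f \is hom d -> 0 <= sg (lap f) f.
Proof.
elim/ltn_ind: d f => -[|[|d]] IH f hf.
- by rewrite (lap_hom0 hf) sg0l.
- by rewrite (lap_hom1 hf) sg0l.
(* The constant of [lap_r2] in degree d, so that [lap (r2 * w)] is [r2 * lap w + cR c *: w]. *)
pose c : R := (2 * n + 4 * d)%:R.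
have c0 : 0 < c by rewrite ltr0n; lia.
have hl := hom_lapS hf.
have kp e g : (e <= d)%N -> g \is hom e -> 0 <= sg (lap g) g.
  by move=> ed; apply: IH; rewrite ltnS (leq_trans ed).
have [w hw wE] := kc_surj c0 kp hl.
have hrw : r2 * w \is hom d.+2 by apply: (@homM _ _ 2 d) => //; apply: hom_r2.
have lw : lap (r2 * w) = lap f by rewrite -wE (lap_r2 hw) cRn.
have -> : sg (lap f) f = sg (lap f) (f - r2 * w) + sg (lap f) (r2 * w).
  by rewrite -sgDr subrK.
rewrite (sg_lapC n0 hf); last exact: homB.
rewrite lapB lw subrr sgC sg0l add0r (sg_r2r n0 _ hl hw); last first.
  by rewrite oddD addbb.
rewrite -wE sgDl (sg_K hw hw) sgZl; apply: addr_ge0; first exact: kp hw.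
by apply: mulr_ge0; [exact: ltW|exact: sg_ge0 hw].
Qed.

Lemma sg_def d f : f \is hom d -> sg f f = 0 -> f = 0.
Proof. by apply: sg_kpos_def => e g _; apply: lap_pos. Qed.

Definition nr f : R := Num.sqrt (sg f f).

Lemma nr_ge0 f : 0 <= nr f. Proof. exact: sqrtr_ge0. Qed.
Lemma nr_sqr d f : f \is hom d -> nr f ^+ 2 = sg f f.
Proof. by move=> hf; rewrite sqr_sqrtr// (sg_ge0 n0 hf). Qed.

Lemma nr_eq0 d f : f \is hom d -> nr f = 0 -> f = 0.
Proof.
move=> hf f0; apply: (sg_def hf).
by rewrite -(nr_sqr hf) f0 expr0n.
Qed.

Lemma sg_quad s t f g :
  sg (cR s *: f + cR t *: g) (cR s *: f + cR t *: g) =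
  s ^+ 2 * sg f f + 2 * s * t * sg f g + t ^+ 2 * sg g g.
Proof.
have e h : sg (cR s *: f + cR t *: g) h = s * sg f h + t * sg g h.
  by apply: etrans (sgDl _ _ _) _; congr (_ + _); exact: sgZl.
rewrite e (sgC f) (sgC g) !e (sgC g f); ring.
Qed.

Lemma sg_CS d f g : f \is hom d -> g \is hom d -> sg f g <= nr f * nr g.
Proof.
move=> hf hg.
have H (s t : R) : 2 * s * t * sg f g <= s ^+ 2 * nr f ^+ 2 + t ^+ 2 * nr g ^+ 2.
  have h : cR s *: f + cR (- t) *: g \is hom d by apply: homD; apply: homZ.
  have := sg_ge0 n0 h; rewrite sg_quad (nr_sqr hf) (nr_sqr hg).
  by move: (sg f g) (sg f f) (sg g g) => x y z k; lra.
have := nr_ge0 f; rewrite le_eqVlt => /orP[/eqP f0|f0].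
  by rewrite (nr_eq0 hf (esym f0)) sg0l mulr_ge0 ?nr_ge0.
have := nr_ge0 g; rewrite le_eqVlt => /orP[/eqP g0|g0].
  by rewrite (nr_eq0 hg (esym g0)) sgC sg0l mulr_ge0 ?nr_ge0.
have := H (nr g) (nr f); move: (sg f g) (nr g) (nr f) f0 g0 => x a b b0 a0 h.
have ab : 0 < 2 * a * b by rewrite !mulr_gt0.
rewrite -(ler_pM2l ab); apply: le_trans h _.
by rewrite le_eqVlt; apply/orP; left; apply/eqP; ring.
Qed.

Lemma nrD d f g : f \is hom d -> g \is hom d -> nr (f + g) <= nr f + nr g.
Proof.
move=> hf hg; rewrite -ler_sqr ?nnegrE ?addr_ge0 ?nr_ge0//.
rewrite (nr_sqr (homD hf hg)).
have := sg_quad 1 1 f g; rewrite cR1 (scale1r f) (scale1r g) => ->.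
have := sg_CS hf hg; have := nr_sqr hf; have := nr_sqr hg.
move: (sg f g) (sg f f) (sg g g) (nr f) (nr g) => x y z a b; nra.
Qed.

Lemma nrZ c f : nr (c *: f) = cabs c * nr f.
Proof.
by rewrite /nr sgZZ sqrtrM ?sqr_ge0// sqrtr_sqr ger0_norm ?cabs_ge0.
Qed.

Lemma nr_le d e c f g : f \is hom d -> g \is hom e -> 0 <= c ->
  sg f f <= c ^+ 2 * sg g g -> nr f <= c * nr g.
Proof.
move=> hf hg c0 h; rewrite -ler_sqr ?nnegrE ?mulr_ge0 ?nr_ge0//.
by rewrite exprMn (nr_sqr hf) (nr_sqr hg).
Qed.

(** Pairing with w gives c |w|^2 <= <q, w>, since [lap] is nonnegative; the inverse found in
    [kc_surj] thus has norm at most 1/c. *)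
Lemma nr_kc d c w q : 0 <= c -> w \is hom d -> q \is hom d ->
  r2 * lap w + cR c *: w = q -> c * nr w <= nr q.
Proof.
move=> c0 hw hq wE.
have e : sg q w = sg (lap w) w + c * sg w w.
  by rewrite -wE (sgDl (r2 * lap w)) (sg_K hw hw) (sgZl c w).
have := sg_CS hq hw; rewrite e -(nr_sqr hw) => h.
have l0 := lap_pos hw.
have := nr_ge0 w; rewrite le_eqVlt => /orP[/eqP <-|w0].
  by rewrite mulr0 nr_ge0.
rewrite -(ler_pM2r w0) -mulrA -expr2; apply: le_trans h.
by rewrite lerDr.
Qed.

(** One step moves one [lap] off f. With w solving [r2 * lap w + cR c *: w = q], the form
    [r2 ^+ p.+1 * q] equals [r2 * lap (r2 ^+ p.+1 * w)]. Dropping powers of [r2] and using the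
    symmetry of [lap] gives [sg f q = sg (lap f) w], and w is smaller than q by the factor c >=
    d+1. *)
Lemma sg_lap_iter p d f q : f \is hom (2 * p + d) -> q \is hom d ->
  d.+1%:R ^+ p * sg f q <= nr (iter p lap f) * nr q.
Proof.
elim: p f q => [|p IH] f q hf hq; first by rewrite expr0 mul1r (sg_CS hf hq).
(* The constant of [lap_r2X] for s = p; only c >= d+1 is retained. *)
pose c : R := (2 * p.+1 * (2 * p + n + 2 * d))%:R.
have cd : d.+1%:R <= c by rewrite ler_nat; nia.
have c0 : 0 < c by rewrite (lt_le_trans _ cd)// ltr0n.
have [w hw wE] := kc_surj c0 (fun e f _ => @lap_pos e f) hq.
have hlf : lap f \is hom (2 * p + d).
  by apply: hom_lapS; move: hf; rewrite mulnS.
have hrw : r2 ^+ p.+1 * w \is hom (2 * p.+1 + d) by exact: (homM (hom_r2X _ _ _) hw).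
have o1 : ~~ odd (2 * p + d + d) by rewrite -addnA mul2n addnn -doubleD odd_double.
have o2 : ~~ odd (2 * p.+1 + d + d) by rewrite -addnA mul2n addnn -doubleD odd_double.
have hl : lap (r2 ^+ p.+1 * w) \is hom (2 * p + d).
  by apply: hom_lapS; move: hrw; rewrite mulnS.
have e1 : r2 ^+ p.+1 * q = r2 * lap (r2 ^+ p.+1 * w).
  by rewrite (lap_r2X p hw) -cRn -/c wE mulrA -exprS.
have e2 : sg f q = sg (lap f) w.
  rewrite -(sg_r2Xr n0 p.+1 o2 hf hq) e1.
  have o3 : ~~ odd (2 * p.+1 + d + (2 * p + d)).
    by rewrite addnACA addnn -mulnDr mul2n -doubleD odd_double.
  rewrite (sg_r2r n0 o3 hf hl) -(sg_lapC n0 hf hrw).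
  exact: (sg_r2Xr n0 p.+1 o1 hlf hw).
rewrite e2 exprS -mulrA iterSr.
apply: le_trans (_ : d.+1%:R * (nr (iter p lap (lap f)) * nr w) <= _).
  by rewrite ler_wpM2l// IH.
rewrite mulrCA ler_wpM2l ?nr_ge0//.
apply: le_trans (nr_kc (ltW c0) hw hq wE).
by rewrite ler_wpM2r ?nr_ge0.
Qed.
End Key.

(** * Norms of forms *)

Section Nrm.
Variables (R : realType) (n : nat).
Local Notation C := (Cplx R).
Local Notation mp := (mpoly n C).
Local Notation hom := (@hom R n).
Local Notation mX := (@mX R n).
Implicit Types (f g : mp) (m : multinom n).

(** Submultiplicative, and in degree d it bounds the values on a polydisc of radius t through
    t^d. *)
Definition nrm f : R := locked (\sum_(m <- msupp f) cabs (mcoeff m f)).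

Lemma nrmE f : nrm f = \sum_(m <- msupp f) cabs (mcoeff m f).
Proof. by rewrite /nrm -lock. Qed.

Lemma nrmwE k f : (mmeasure mdeg f <= k)%N ->
  nrm f = \sum_(m : bmultinom n k) cabs (mcoeff m f).
Proof.
move=> le_pi; pose I : subFinType _ := bmultinom n k.
rewrite nrmE (ssrcomplements.big_mksub I) ?msupp_uniq //=; first last.
  by move=> x /msize_mdeg_lt /leq_trans; apply.
by rewrite big_rmcond //= => j /memN_msupp_eq0 ->; rewrite cabs0.
Qed.

Lemma nrm_ge0 f : 0 <= nrm f.
Proof. by rewrite nrmE sumr_ge0// => m _; rewrite cabs_ge0. Qed.

Lemma nrmD f g : nrm (f + g) <= nrm f + nrm g.
Proof.
pose k := maxn (mmeasure mdeg f) (mmeasure mdeg g).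
rewrite !(@nrmwE k) ?leq_maxl ?leq_maxr ?mmeasureD_le//.
by rewrite -big_split; apply: ler_sum => m _; rewrite mcoeffD cabsD.
Qed.

Lemma nrmZ c f : nrm (c *: f) = cabs c * nrm f.
Proof.
rewrite !(@nrmwE (mmeasure mdeg f)) ?mmeasureZ_le// mulr_sumr.
by apply: eq_bigr => m _; rewrite mcoeffZ cabsM.
Qed.

Lemma nrm0 : nrm 0 = 0.
Proof. by rewrite nrmE msupp0 big_nil. Qed.

Lemma nrmX m : nrm (mpolyX C m) = 1.
Proof. by rewrite nrmE msuppX big_seq1 mcoeffX eqxx cabs1. Qed.

Lemma nrm1 : nrm 1 = 1.
Proof. by rewrite -mpolyX0 nrmX. Qed.

Lemma nrm_sum (I : Type) (r : seq I) (P : pred I) (F : I -> mp) :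
  nrm (\sum_(i <- r | P i) F i) <= \sum_(i <- r | P i) nrm (F i).
Proof.
elim/big_rec2: _ => [|i y x _ h]; first by rewrite nrm0.
by rewrite (le_trans (nrmD _ _))// lerD2l.
Qed.

Lemma nrmM f g : nrm (f * g) <= nrm f * nrm g.
Proof.
have h m : nrm (mpolyX C m * g) <= nrm g.
  rewrite [in leLHS](mpolyE g) mulr_sumr (le_trans (nrm_sum _ _ _))//.
  rewrite [leRHS]nrmE ler_sum// => k _.
  by rewrite -scalerAr -mpolyXD nrmZ nrmX mulr1.
rewrite [in leLHS](mpolyE f) mulr_suml (le_trans (nrm_sum _ _ _))//.
rewrite [X in _ <= X * _]nrmE mulr_suml ler_sum// => k _.
by rewrite -scalerAl nrmZ ler_wpM2l ?cabs_ge0.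
Qed.

Lemma nrmX_le f k : nrm (f ^+ k) <= nrm f ^+ k.
Proof.
elim: k => [|k IH]; first by rewrite !expr0 nrm1.
by rewrite !exprS (le_trans (nrmM _ _))// ler_wpM2l ?nrm_ge0.
Qed.

Lemma nrm_mX j f : nrm (mX j * f) <= nrm f.
Proof. by rewrite (le_trans (nrmM _ _))// nrmX mul1r. Qed.

Lemma nrm_mderiv d j f : f \is hom d -> nrm (mderiv j f) <= d%:R * nrm f.
Proof.
move=> /dhomogP hf; rewrite [in leLHS](mpolyE f) mderiv_sum.
rewrite (le_trans (nrm_sum _ _ _))// [nrm f]nrmE mulr_sumr.
rewrite big_seq [leRHS]big_seq ler_sum// => m /hf md.
rewrite mderivZ nrmZ mulrC ler_wpM2r ?cabs_ge0// mderivX nrmZ nrmX mulr1.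
by rewrite cabs_n ler_nat -md /= mdegE (bigD1 j)//= leq_addr.
Qed.

Lemma meval_le d f (z : 'I_n -> C) t : f \is hom d -> 0 <= t ->
  (forall i, cabs (z i) <= t) -> cabs (meval z f) <= nrm f * t ^+ d.
Proof.
move=> /dhomogP hf t0 zt; rewrite mevalE (le_trans (cabs_sum _ _ _))//.
rewrite nrmE mulr_suml big_seq [leRHS]big_seq ler_sum// => m /hf /= md.
rewrite cabsM ler_wpM2l ?cabs_ge0// cabs_prod -md mdegE -prodrXr.
apply: ler_prod => i _; rewrite cabs_ge0 cabsX /=.
by rewrite lerXn2r// nnegrE cabs_ge0.
Qed.
End Nrm.

(** * Comparison of the norm of the sphere with the norm of the coefficients *)

Section Bounds.
Variables (R : realType) (n : nat).
Hypothesis n0 : (0 < n)%N.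
Local Notation C := (Cplx R).
Local Notation mp := (mpoly n C).
Local Notation hom := (@hom R n).
Local Notation mX := (@mX R n).
Local Notation r2 := (@r2 R n).
Local Notation lap := (@lap R n).
Local Notation sg := (@sg R n).
Local Notation rpt := (@rpt R n).
Implicit Types (f g : mp) (m : multinom n).

Definition sqn (x : 'I_n -> R) : R := \sum_i x i ^+ 2.
Lemma sqn_ge0 x : 0 <= sqn x.
Proof. by apply: sumr_ge0 => i _; rewrite sqr_ge0. Qed.

Lemma meval_r2 x : meval (rpt x) r2 = cR (sqn x).
Proof.
rewrite /r2 raddf_sum /= cR_sum; apply: eq_bigr => i _.
by rewrite mevalM !mevalXU -cRM expr2.
Qed.

Lemma meval_r2X x k : meval (rpt x) (r2 ^+ k) = cR (sqn x ^+ k).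
Proof. by rewrite rmorphXn /= meval_r2 cRX. Qed.

Lemma meval_rpt_le d f x : f \is hom d ->
  cabs (meval (rpt x) f) ^+ 2 <= nrm f ^+ 2 * sqn x ^+ d.
Proof.
move=> hf; have h : cabs (meval (rpt x) f) <= nrm f * Num.sqrt (sqn x) ^+ d.
  apply: (meval_le hf); rewrite ?sqrtr_ge0// => i.
  rewrite cabs_cR -sqrtr_sqr ler_sqrt ?sqn_ge0//.
  by rewrite /sqn (bigD1 i)//= lerDl sumr_ge0// => k _; rewrite sqr_ge0.
rewrite -[sqn x in leRHS](sqr_sqrtr (sqn_ge0 x)) -exprM [(2 * d)%N]mulnC exprM.
by rewrite -exprMn lerXn2r ?nnegrE ?cabs_ge0// mulr_ge0 ?nrm_ge0 ?exprn_ge0 ?sqrtr_ge0.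
Qed.

(** On the sphere |a| <= nrm a pointwise. In algebraic terms, nrm(a)^2 r2^j |f|^2 - |a f|^2 is a
    form that is nonnegative at real points, so its mean is nonnegative, and the mean does not see
    r2^j. *)
Lemma nrM j e a f : a \is hom j -> f \is hom e -> nr (a * f) <= nrm a * nr f.
Proof.
move=> ha hf; have haf := homM ha hf.
have hr := homM (hom_r2X R n j) hf.
rewrite -ler_sqr ?nnegrE ?mulr_ge0 ?nr_ge0 ?nrm_ge0// exprMn.
rewrite (nr_sqr n0 haf) (nr_sqr n0 hf) -subr_ge0.
have o : ~~ odd (e + e) by rewrite addnn odd_double.
rewrite -(sg_r2Xr n0 j o hf hf) sgC -sgZl !sgE -reB /gS -lformB.
have h1 : r2 ^+ j * f * cj f \is hom (2 * j + e + e) by apply: (homM hr); apply: hom_cj.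
have h2 : a * f * cj (a * f) \is hom (2 * j + e + e).
  by rewrite -addnA mul2n -addnn addnACA; apply: (homM haf); apply: hom_cj.
apply: (@gS_ge0 _ _ n0 (2 * j + e + e)).
  by apply: homB; [apply: (homM (homZ _ hr)); apply: hom_cj|exact: h2].
move=> x; rewrite mevalB mevalM mevalZ !mevalM !meval_cj meval_r2X.
rewrite mevalM conjM_cabs; set F := meval _ f; set A := meval _ a.
have -> : cR (nrm a ^+ 2) * (cR (sqn x ^+ j) * F) * F^* =
    cR (nrm a ^+ 2 * sqn x ^+ j * cabs F ^+ 2).
  by rewrite 2!cRM -conjM_cabs; ring.
rewrite -cRB re_cR cabsM exprMn.
rewrite -mulrBl mulr_ge0 ?sqr_ge0// subr_ge0.
exact: meval_rpt_le.
Qed.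

Lemma nr1 : nr (1 : mp) = 1.
Proof.
rewrite /nr sgE mul1r.
have -> : cj (1 : mp) = 1 by rewrite -mpolyX0 cjX.
rewrite -mpolyX0 /gS lformX mdeg0 /= /nn big_ord0 invr1 mulr1.
by rewrite /gwt big1 ?sqrtr1// => i _; rewrite mnm0E.
Qed.

Lemma nr_le_nrm d f : f \is hom d -> nr f <= nrm f.
Proof. by move=> hf; have := nrM hf (@hom1 R n); rewrite mulr1 nr1 mulr1. Qed.

(** By [lap_pos], [sgrad] bounds the squared norm of the whole gradient by d (n + 2d - 2) |f|^2. *)
Lemma nr_mderiv d j f : f \is hom d -> nr (mderiv j f) <= (n + 2)%:R * d%:R * nr f.
Proof.
move=> hf; have hd := hom_mderiv j hf.
apply: (nr_le n0 hd hf); first by rewrite mulr_ge0.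
have := sgrad n0 hf hf; have := lap_pos n0 hf.
rewrite (bigD1 j)//=.
have : 0 <= \sum_(i < n | i != j) sg (mderiv i f) (mderiv i f).
  by apply: sumr_ge0 => i _; apply: sg_ge0 => //; apply: hom_mderiv hf.
have := sg_ge0 n0 hf.
move: (sg f f) (sg (lap f) f) (\sum_(i < n | _) _)
  (sg (mderiv j f) (mderiv j f)) => x y z t.
move=> x0 z0 y0 e; rewrite -natrM -natrX.
apply: le_trans (_ : (d * (n + 2 * d.-1))%:R * x <= _); first lra.
rewrite ler_wpM2r// ler_nat; case: (d) => [//|k] /=.
by rewrite -mulnn; apply: leq_mul; nia.
Qed.

(** Induction on the degree through Euler's identity. The factor d+1 lost in [nr_mderiv] cancels
    against the one in Euler's identity, so the constant is geometric in d. *)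
Lemma nrm_le_nr d f : f \is hom d -> nrm f <= (n * (n + 2))%:R ^+ d * nr f.
Proof.
elim: d f => [|d IH] f hf.
  have fE : f = (mcoeff mnm0 f) *: 1.
    apply/mpolyP => m; rewrite mcoeffZ mcoeff1; have [->|m0] := eqVneq m mnm0.
      by rewrite mulr1.
    by rewrite mulr0; apply: (dhomog_nemf_coeff hf); rewrite mdeg_eq0.
  by rewrite fE nrmZ nrZ nrm1 nr1 expr0 mul1r.
have d0 : 0 < d.+1%:R :> R by rewrite ltr0n.
rewrite -(ler_pM2l d0).
have -> : d.+1%:R * nrm f = nrm (\sum_j mX j * mderiv j f).
  by rewrite (euler hf) nrmZ cabs_n.
apply: le_trans (nrm_sum _ _ _) _.
apply: le_trans (_ : \sum_(j < n) ((n * (n + 2))%:R ^+ d * ((n + 2)%:R * d.+1%:R * nr f)) <= _).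
  apply: ler_sum => j _; apply: le_trans (nrm_mX _ _) _.
  apply: le_trans (IH _ (hom_mderiv j hf)) _.
  by rewrite ler_wpM2l ?exprn_ge0// nr_mderiv.
rewrite sumr_const card_ord -[_ *+ n]mulr_natl exprS natrM.
by rewrite le_eqVlt; apply/orP; left; apply/eqP; ring.
Qed.

(** [sg (P * q) q] is at least delta |q|^2, because P >= delta on the sphere, and [sg_lap_iter]
    bounds it from above. *)
Lemma elliptic_bound (delta : R) (p m : nat) (P q : mp) : 0 < delta ->
  P \is hom (2 * p) -> q \is hom m ->
  (forall x, delta * sqn x ^+ p <= re (meval (rpt x) P)) ->
  delta * m.+1%:R ^+ p * nr q <= nr (iter p lap (P * q)).
Proof.
move=> d0 hP hq Px.
have hPq := homM hP hq.
have := sg_lap_iter n0 hPq hq.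
have := nr_ge0 q; rewrite le_eqVlt => /orP[/eqP <- _|q0 h].
  by rewrite mulr0 nr_ge0.
have o : ~~ odd (m + m) by rewrite addnn odd_double.
have hr := homM (hom_r2X R n p) hq.
have low : delta * nr q ^+ 2 <= sg (P * q) q.
  rewrite (nr_sqr n0 hq) -(sg_r2Xr n0 p o hq hq) sgC -sgZl !sgE -subr_ge0 -reB.
  rewrite /gS -lformB; apply: (@gS_ge0 _ _ n0 (2 * p + m + m)).
    apply: homB; first by apply: (homM hPq); apply: hom_cj.
    by apply: (homM (homZ _ hr)); apply: hom_cj.
  move=> x; rewrite mevalB [X in _ - X]mevalM mevalZ !mevalM !meval_cj meval_r2X.
  set F := meval _ q; set A := meval _ P.
  have -> : cR delta * (cR (sqn x ^+ p) * F) * F^* =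
      cR (delta * sqn x ^+ p * cabs F ^+ 2).
    by rewrite 2!cRM -conjM_cabs; ring.
  have -> : A * F * F^* = cR (cabs F ^+ 2) * A by rewrite -conjM_cabs; ring.
  rewrite reB re_cR re_cRM [_ * re _]mulrC -mulrBl mulr_ge0 ?sqr_ge0//.
  by rewrite subr_ge0.
rewrite -(ler_pM2r q0); apply: le_trans h.
have X0 : 0 <= m.+1%:R ^+ p :> R by rewrite exprn_ge0.
apply: le_trans (ler_wpM2l X0 low).
by rewrite le_eqVlt; apply/orP; left; apply/eqP; ring.
Qed.
End Bounds.

(** * Constant coefficient operators and linear substitutions *)

Section Pdiff.
Variables (R : realType) (n : nat).
Local Notation C := (Cplx R).
Local Notation mp := (mpoly n C).
Local Notation hom := (@hom R n).
Local Notation mX := (@mX R n).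
Implicit Types (f g : mp) (m : multinom n).

Lemma mp_ring_ind (P : mp -> Prop) :
  (forall c, P (mpolyC n c)) -> (forall i, P (mX i)) ->
  (forall f g, P f -> P g -> P (f + g)) ->
  (forall f g, P f -> P g -> P (f * g)) -> forall f, P f.
Proof.
move=> hC hX hD hM; apply: mp_ind => [|c m|//]; first by rewrite -mpolyC0.
rewrite -mul_mpolyC; apply: (hM _ _ (hC c)); rewrite mpolyXE_id.
have h1 : P 1 by rewrite -mpolyC1.
apply: big_ind => [//|x y hx hy|i _]; first exact: hM.
elim: (m i) => [|k IH]; first by rewrite expr0.
by rewrite exprS; exact: (hM _ _ (hX i) IH).
Qed.

Definition pdiff (Q f : mp) : mp :=
  locked (\sum_(m <- msupp Q) mcoeff m Q *: mderivm m f).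

Lemma pdiffE Q f : pdiff Q f = \sum_(m <- msupp Q) mcoeff m Q *: mderivm m f.
Proof. by rewrite /pdiff -lock. Qed.

Lemma pdiffwE k Q f : (mmeasure mdeg Q <= k)%N ->
  pdiff Q f = \sum_(m : bmultinom n k) mcoeff m Q *: mderivm m f.
Proof.
move=> le_pi; pose I : subFinType _ := bmultinom n k.
rewrite pdiffE (ssrcomplements.big_mksub I) ?msupp_uniq //=; first last.
  by move=> x /msize_mdeg_lt /leq_trans; apply.
by rewrite big_rmcond //= => j /memN_msupp_eq0 ->; rewrite scale0r.
Qed.

Lemma pdiffDl Q1 Q2 f : pdiff (Q1 + Q2) f = pdiff Q1 f + pdiff Q2 f.
Proof.
pose k := maxn (mmeasure mdeg Q1) (mmeasure mdeg Q2).
rewrite !(@pdiffwE k) ?leq_maxl ?leq_maxr ?mmeasureD_le//.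
by rewrite -big_split; apply: eq_bigr => m _; rewrite mcoeffD scalerDl.
Qed.

Lemma pdiffZl c Q f : pdiff (c *: Q) f = c *: pdiff Q f.
Proof.
rewrite !(@pdiffwE (mmeasure mdeg Q)) ?mmeasureZ_le// scaler_sumr.
by apply: eq_bigr => m _; rewrite mcoeffZ scalerA.
Qed.

Lemma pdiff0l f : pdiff 0 f = 0.
Proof. by rewrite pdiffE msupp0 big_nil. Qed.

Lemma pdiffX m f : pdiff (mpolyX C m) f = mderivm m f.
Proof. by rewrite pdiffE msuppX big_seq1 mcoeffX eqxx scale1r. Qed.

Lemma pdiffDr Q f g : pdiff Q (f + g) = pdiff Q f + pdiff Q g.
Proof.
rewrite !pdiffE -big_split; apply: eq_bigr => m _.
by rewrite mderivmD scalerDr.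
Qed.

Lemma pdiffZr Q c f : pdiff Q (c *: f) = c *: pdiff Q f.
Proof.
rewrite !pdiffE scaler_sumr; apply: eq_bigr => m _.
by rewrite mderivmZ !scalerA mulrC.
Qed.

Lemma pdiff_suml (I : Type) (r : seq I) (P : pred I) (F : I -> mp) f :
  pdiff (\sum_(i <- r | P i) F i) f = \sum_(i <- r | P i) pdiff (F i) f.
Proof. exact: (big_morph (fun Q => pdiff Q f) (fun Q1 Q2 => pdiffDl Q1 Q2 f) (pdiff0l f)). Qed.

Lemma mderivm0r m : mderivm m 0 = 0 :> mp.
Proof. by have := mderivmB m (0 : mp) 0; rewrite !subrr. Qed.

Lemma mderivm_sum m (I : Type) (r : seq I) (P : pred I) (F : I -> mp) :
  mderivm m (\sum_(i <- r | P i) F i) = \sum_(i <- r | P i) mderivm m (F i).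
Proof. exact: (big_morph (mderivm m) (mderivmD m) (mderivm0r m)). Qed.

Lemma pdiffM Q1 Q2 f : pdiff (Q1 * Q2) f = pdiff Q1 (pdiff Q2 f).
Proof.
have hX m : pdiff (mpolyX C m * Q2) f = mderivm m (pdiff Q2 f).
  rewrite {1}(mpolyE Q2) mulr_sumr pdiff_suml pdiffE.
  rewrite mderivm_sum; apply: eq_bigr => k _.
  by rewrite -scalerAr pdiffZl -mpolyXD pdiffX mderivmZ -mderivmDm addmC.
rewrite {1}(mpolyE Q1) mulr_suml pdiff_suml [RHS]pdiffE; apply: eq_bigr => m _.
by rewrite -scalerAl pdiffZl hX.
Qed.

Lemma pdiffXn Q k f : pdiff (Q ^+ k) f = iter k (pdiff Q) f.
Proof.
elim: k => [|k IH]; last by rewrite exprS pdiffM IH.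
by rewrite expr0 -mpolyX0 pdiffX mderivm0m.
Qed.

Lemma hom_mderivm d m f : f \is hom d -> mderivm m f \is hom (d - mdeg m).
Proof.
move=> hf; have [md|md] := leqP (mdeg m) d; last first.
  suff -> : mderivm m f = 0 by apply: hom0.
  apply/mpolyP => k; rewrite mcoeff_mderivm mcoeff0 (dhomog_nemf_coeff hf) ?mul0rn//.
  by rewrite /= mdegD gtn_eqF// (leq_trans md)// leq_addr.
apply/dhomogP => k; rewrite mcoeff_msupp mcoeff_mderivm => /=.
apply: contraNeq => h; rewrite (dhomog_nemf_coeff hf) ?mul0rn//=.
by rewrite mdegD; apply: contra h => /eqP <-; rewrite addKn.
Qed.

Lemma hom_pdiff d e Q f : Q \is hom e -> f \is hom d -> pdiff Q f \is hom (d - e).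
Proof.
move=> /dhomogP hQ hf; rewrite pdiffE big_seq; apply: hom_sum => m _ mQ.
by apply: homZ; rewrite -(hQ m mQ); apply: hom_mderivm.
Qed.

Definition lsub (M : 'M[C]_n) : mp -> mp :=
  locked (comp_mpoly [tuple \sum_k M i k *: mX k | i < n]).

Lemma lsubE M : lsub M = comp_mpoly [tuple \sum_k M i k *: mX k | i < n].
Proof. by rewrite /lsub -lock. Qed.

Lemma lsubD M f g : lsub M (f + g) = lsub M f + lsub M g.
Proof. by rewrite lsubE; exact: comp_mpolyD. Qed.
Lemma lsubZ M c f : lsub M (c *: f) = c *: lsub M f.
Proof. by rewrite lsubE; exact: comp_mpolyZ. Qed.
Lemma lsubM M f g : lsub M (f * g) = lsub M f * lsub M g.
Proof. by rewrite lsubE; exact: rmorphM. Qed.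
Lemma lsubC M c : lsub M (mpolyC n c) = mpolyC n c.
Proof. by rewrite lsubE; exact: comp_mpolyC. Qed.
Lemma lsub0 M : lsub M 0 = 0.
Proof. by rewrite lsubE; exact: comp_mpoly0. Qed.
Lemma lsub_sum M (I : Type) (r : seq I) (P : pred I) (F : I -> mp) :
  lsub M (\sum_(i <- r | P i) F i) = \sum_(i <- r | P i) lsub M (F i).
Proof. exact: (big_morph (lsub M) (lsubD M) (lsub0 M)). Qed.
Lemma lsub_mX M i : lsub M (mX i) = \sum_k M i k *: mX k.
Proof. by rewrite lsubE; rewrite /mX comp_mpolyXU -tnth_nth tnth_mktuple. Qed.
Lemma lsub_X M m : lsub M (mpolyX C m) = \prod_(i < n) (\sum_k M i k *: mX k) ^+ m i.
Proof.
rewrite lsubE comp_mpolyX; apply: eq_bigr => i _; by rewrite tnth_mktuple.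
Qed.
Lemma meval_lsub M x f :
  meval x (lsub M f) = meval (fun i => \sum_k M i k * x k) f.
Proof.
rewrite lsubE comp_mpoly_meval; apply: meval_eq => i; rewrite tnth_mktuple.
rewrite raddf_sum /=; apply: eq_bigr => k _; by rewrite mevalZ mevalXU.
Qed.

Lemma lsub_comp M N f : lsub M (lsub N f) = lsub (N *m M) f.
Proof.
elim/mp_ring_ind: f => [c|i|f g IHf IHg|f g IHf IHg].
- by rewrite !lsubC.
- rewrite !lsub_mX lsub_sum.
  transitivity (\sum_k \sum_j (N i k * M k j) *: mX j).
    apply: eq_bigr => k _; rewrite lsubZ lsub_mX scaler_sumr.
    by apply: eq_bigr => j _; rewrite scalerA.
  rewrite exchange_big; apply: eq_bigr => j _.
  by rewrite mxE scaler_suml.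
- by rewrite !lsubD IHf IHg.
- by rewrite !lsubM IHf IHg.
Qed.

Lemma lsub1 f : lsub 1%:M f = f.
Proof.
elim/mp_ring_ind: f => [c|i|f g IHf IHg|f g IHf IHg].
- by rewrite lsubC.
- rewrite lsub_mX (bigD1 i)//= mxE eqxx scale1r big1 ?addr0// => k ki.
  by rewrite mxE eq_sym (negbTE ki) scale0r.
- by rewrite lsubD IHf IHg.
- by rewrite lsubM IHf IHg.
Qed.

Lemma hom_lsub M d f : f \is hom d -> lsub M f \is hom d.
Proof.
move: f; apply: hom_ind => [|c m md|f g IHf IHg]; first by rewrite lsub0 hom0.
  rewrite lsubZ lsub_X; apply: homZ; rewrite -md mdegE.
  elim/big_rec2: _ => [|i k y _ h]; first exact: hom1.
  apply: homM h.
  have hl : \sum_k0 M i k0 *: mX k0 \is hom 1 by apply: hom_sumT => j _; apply/homZ/hom_mX.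
  by have := homX (m i) hl; rewrite mul1n.
by rewrite lsubD; apply: homD.
Qed.

Lemma mderiv_lsub M k f :
  mderiv k (lsub M f) = \sum_i M i k *: lsub M (mderiv i f).
Proof.
elim/mp_ring_ind: f => [c|i|f g IHf IHg|f g IHf IHg].
- rewrite lsubC mderivC big1// => i _; by rewrite mderivC lsub0 scaler0.
- rewrite lsub_mX mderiv_sum (bigD1 k)//= big1 => [|j jk].
    rewrite addr0 (bigD1 i)//= big1 => [|j ji].
      by rewrite addr0 mderivZ !mderiv_mX !eqxx -mpolyC1 lsubC.
    by rewrite mderiv_mX (negbTE ji) lsub0 scaler0.
  by rewrite mderivZ mderiv_mX eq_sym (negbTE jk) scaler0.
- rewrite lsubD mderivD IHf IHg -big_split; apply: eq_bigr => i _.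
  by rewrite mderivD lsubD scalerDr.
- rewrite lsubM mderivM IHf IHg mulr_suml mulr_sumr -big_split.
  apply: eq_bigr => i _ /=.
  by rewrite mderivM lsubD !lsubM scalerDr scalerAl scalerAr.
Qed.

Lemma nrm_lsub M d f : f \is hom d ->
  nrm (lsub M f) <= (\sum_i \sum_k cabs (M i k)) ^+ d * nrm f.
Proof.
move=> /dhomogP hf; rewrite [f in lsub _ f](mpolyE f) lsub_sum.
apply: le_trans (nrm_sum _ _ _) _.
rewrite [nrm f]nrmE mulr_sumr big_seq [leRHS]big_seq.
apply: ler_sum => m /hf /= md.
rewrite lsubZ nrmZ mulrC ler_wpM2r ?cabs_ge0// lsub_X -md mdegE -prodrXr.
elim/big_rec2: _ => [|i y x _ h]; first by rewrite nrm1.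
apply: le_trans (nrmM _ _) _; apply: ler_pM => //; rewrite ?nrm_ge0//.
apply: le_trans (nrmX_le _ _) _; rewrite lerXn2r ?nnegrE ?nrm_ge0//.
  by apply: sumr_ge0 => j _; apply: sumr_ge0 => k _; apply: cabs_ge0.
apply: le_trans (nrm_sum _ _ _) _.
have -> : \sum_k nrm (M i k *: mX k) = \sum_k cabs (M i k).
  by apply: eq_bigr => k _; rewrite nrmZ nrmX mulr1.
rewrite [leRHS](bigD1 i)//= lerDl.
by apply: sumr_ge0 => j _; apply: sumr_ge0 => k _; apply: cabs_ge0.
Qed.
End Pdiff.

(** * The linear change of variables and the Fischer estimate for Q and P *)

Section Package.
Variables (R : realType) (n : nat).
Local Notation C := (Cplx R).
Local Notation mp := (mpoly n C).
Local Notation hom := (@hom R n).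
Local Notation mX := (@mX R n).
Local Notation lap := (@lap R n).
Implicit Types (f g : mp) (m : multinom n).

Lemma pdiff_qform (B : 'M[C]_n) f :
  pdiff (qform B) f = \sum_i \sum_j B i j *: mderiv i (mderiv j f).
Proof.
rewrite /qform mxE pdiff_suml exchange_big; apply: eq_bigr => j _.
rewrite !mxE mulr_suml pdiff_suml; apply: eq_bigr => i _.
rewrite !mxE [_ * mpolyC n _]mulrC -mulrA mul_mpolyC pdiffZl; congr (_ *: _).
by rewrite -mpolyXD pdiffX mderivmDm !mderivmU1m mderiv_comm.
Qed.

Lemma hom_qform (B : 'M[C]_n) : qform B \is hom 2.
Proof.
rewrite /qform mxE; apply: hom_sumT => j _.
rewrite !mxE; apply: (@homM _ _ 1 1); last exact: hom_mX.
apply: hom_sumT => i _; rewrite !mxE [_ * mpolyC n _]mulrC mul_mpolyC.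
by apply/homZ/hom_mX.
Qed.

(** Polarization: the values at e_i, e_j and e_i + e_j determine the entry (i, j). *)
Lemma sym_mx_sum_sqr (G : 'M[C]_n) : G^T = G ->
  (forall tau : 'cV[C]_n, (tau^T *m G *m tau) 0 0 = \sum_(j < n) tau j 0 ^+ 2) ->
  G = 1%:M.
Proof.
move=> Gs hG; pose e i : 'cV[C]_n := delta_mx i 0.
pose bf (x y : 'cV[C]_n) := (x^T *m G *m y) 0 0.
have bfe i j : bf (e i) (e j) = G i j.
  by rewrite /bf -colE trmx_delta -rowE !mxE.
have bfD (x y : 'cV[C]_n) : bf (x + y) (x + y) = bf x x + bf x y + (bf y x + bf y y).
  have E : (x + y)^T = x^T + y^T by apply/matrixP => k l; rewrite !mxE.
  have add (M N : 'M[C]_1) : (M + N) 0 0 = M 0 0 + N 0 0 by rewrite mxE.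
  rewrite /bf E (mulmxDl x^T) (mulmxDl (x^T *m G)) (mulmxDr (x^T *m G)).
  rewrite (mulmxDr (y^T *m G)).
  exact: (etrans (add _ _) (congr2 +%R (add _ _) (add _ _))).
have ee i k : e i k 0 = (k == i)%:R by rewrite mxE eqxx andbT.
have Gii i : G i i = 1.
  rewrite -bfe /bf hG (bigD1 i)// big1 => [|j ji].
    by rewrite ee eqxx expr1n; exact: addr0.
  by rewrite ee (negbTE ji) expr0n.
apply/matrixP => i j; rewrite [RHS]mxE; have [->|ij] := eqVneq i j; first exact: Gii.
have := bfD (e i) (e j); rewrite [in LHS]/bf hG !bfe !Gii.
have -> : G j i = G i j by rewrite -[in LHS]Gs mxE.
have -> : \sum_k (e i + e j) k 0 ^+ 2 = \sum_k ((k == i)%:R + (k == j)%:R).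
  apply: eq_bigr => k _; rewrite mxE !ee.
  have [->|ki] := eqVneq k i; first by rewrite (negbTE ij) addr0 expr1n.
  by rewrite add0r; case: (k == j); rewrite ?expr1n ?expr0n.
have one l : \sum_(k < n) (k == l)%:R = 1 :> C.
  by rewrite (bigD1 l)//= eqxx big1 ?addr0// => k /negbTE ->.
rewrite big_split /= !one; move: (G i j) => g E.
have /eqP : 2%:R * g = 0 by rewrite -[RHS](subrr (1 + 1)) {1}E; ring.
by rewrite mulf_eq0 pnatr_eq0 /= => /eqP.
Qed.

Lemma qform_sum_sqr (B A : 'M[C]_n) : B^T = B ->
  (forall tau : 'cV[C]_n, peval (qform B) (A *m tau) = \sum_(j < n) tau j 0 ^+ 2) ->
  A^T *m B *m A = 1%:M.
Proof.
move=> Bs h; apply: sym_mx_sum_sqr => [|tau].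
  by rewrite !trmx_mul trmxK Bs mulmxA.
by rewrite -h peval_qform trmx_mul !mulmxA.
Qed.

(** By the chain rule, the coefficient of d_i d_j in the Laplacian of f(M x) is the entry (i, j) of
    M M^T. *)
Lemma lap_lsub (B M : 'M[C]_n) f : M *m M^T = B ->
  lap (lsub M f) = lsub M (pdiff (qform B) f).
Proof.
move=> MB; rewrite pdiff_qform lsub_sum.
have E k : mderiv k (mderiv k (lsub M f)) =
    \sum_i \sum_j (M i k * M j k) *: lsub M (mderiv i (mderiv j f)).
  rewrite mderiv_lsub mderiv_sum exchange_big; apply: eq_bigr => j _.
  rewrite mderivZ mderiv_lsub scaler_sumr; apply: eq_bigr => i _.
  by rewrite scalerA mulrC.
rewrite /lap (eq_bigr _ (fun k _ => E k)) exchange_big; apply: eq_bigr => i _.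
rewrite lsub_sum exchange_big; apply: eq_bigr => j _.
rewrite lsubZ -scaler_suml -MB mxE; congr (_ *: _); apply: eq_bigr => k _.
by rewrite mxE.
Qed.

Lemma lap_iter_lsub (B M : 'M[C]_n) p f : M *m M^T = B ->
  iter p lap (lsub M f) = lsub M (pdiff (qform B ^+ p) f).
Proof.
move=> MB; rewrite pdiffXn; elim: p => [//|p IH].
by rewrite !iterS IH (lap_lsub _ MB).
Qed.

(* N is the L^2 norm of the sphere after the change of variables A. *)
Record fischer_norm (Q P : mp) (p : nat) (N : mp -> R) (K : R) : Prop := FischerNorm {
  fn_K1 : 1 <= K;
  fn_ge0 : forall f, 0 <= N f;
  fnD : forall d f g, f \is hom d -> g \is hom d -> N (f + g) <= N f + N g;
  fnZ : forall c f, N (c *: f) = cabs c * N f;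
  fn_le_nrm : forall d f, f \is hom d -> N f <= K ^+ d * nrm f;
  nrm_le_fn : forall d f, f \is hom d -> nrm f <= K ^+ d * N f;
  fnM : forall j d a f, a \is hom j -> f \is hom d ->
    N (a * f) <= K ^+ j * nrm a * N f;
  fn_mderiv : forall d i f, f \is hom d -> N (mderiv i f) <= K * d%:R * N f;
  fn_fischer : forall (m : nat) (q : mp), q \is hom m ->
    m.+1%:R ^+ p * N q <= K * N (pdiff Q (P * q));
  fn_solve : forall (m : nat) (g : mp), g \is hom m ->
    exists2 q, q \is hom m & pdiff Q (P * q) = g }.

(** From A^T B A = 1 follows B = M M^T for M = A^(-T). The substitution x -> M x therefore carries
    Q(D) to [iter p lap], and P to a polynomial that ellipticity bounds below at real points. *)
Lemma fischer_norm_exists (n0 : (0 < n)%N) (B : 'M[C]_n) (p : nat) (P : mp) :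
  B^T = B -> P \is hom (2 * p) -> B_elliptic B p P ->
  exists N K, fischer_norm (qform B ^+ p) P p N K.
Proof.
move=> Bs hP [A [Au Atau _ [delta [d0 Pge]]]].
pose M : 'M[C]_n := (invmx A)^T.
have MB : M *m M^T = B.
  have h := qform_sum_sqr Bs Atau.
  have Atu : A^T \in unitmx by rewrite unitmx_tr.
  rewrite /M trmxK trmx_inv -[RHS](mulKmx Atu) -[A^T *m B](mulmxK Au) h mul1mx.
  by [].
have hM : A^T *m M = 1%:M by rewrite /M -trmx_mul mulVmx// trmx1.
have hM' : M *m A^T = 1%:M by rewrite /M -trmx_mul mulmxV// trmx1.
pose a := \sum_i \sum_k cabs (M i k); pose b := \sum_i \sum_k cabs (A^T i k).
have a0 : 0 <= a by apply: sumr_ge0 => j _; apply: sumr_ge0 => k _; apply: cabs_ge0.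
have b0 : 0 <= b by apply: sumr_ge0 => j _; apply: sumr_ge0 => k _; apply: cabs_ge0.
pose N f := nr (lsub M f).
(* A common bound for the constants of all fields: a and b for substituting M and A^T, n (n+2) from
   [nrm_le_nr], n+2 from [nr_mderiv], and 1/delta from ellipticity. *)
pose K := 1 + a + b * (n * (n + 2))%:R + b * (n + 2)%:R + delta^-1.
have n20 : 0 <= (n + 2)%:R :> R by rewrite ler0n.
have bn0 : 0 <= b * (n * (n + 2))%:R by rewrite mulr_ge0.
have bn1 : 0 <= b * (n + 2)%:R by rewrite mulr_ge0.
have di0 : 0 <= delta^-1 by rewrite invr_ge0 ltW.
have K1 : 1 <= K by rewrite /K -!addrA lerDl !addr_ge0.
have aK : a <= K by rewrite /K; lra.
have bK : b * (n * (n + 2))%:R <= K by rewrite /K; lra.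
have bK1 : b * (n + 2)%:R <= K by rewrite /K; lra.
have dK : delta^-1 <= K by rewrite /K; lra.
have K0 : 0 <= K by apply: le_trans K1.
have inv f : lsub A^T (lsub M f) = f by rewrite lsub_comp hM' lsub1.
have inv' f : lsub M (lsub A^T f) = f by rewrite lsub_comp hM lsub1.
have expK x d : 0 <= x -> x <= K -> x ^+ d <= K ^+ d.
  by move=> x0 xK; rewrite lerXn2r.
have fischer (m : nat) (q : mp) : q \is hom m ->
    m.+1%:R ^+ p * N q <= delta^-1 * N (pdiff (qform B ^+ p) (P * q)).
  move=> hq; rewrite ler_pdivlMl// mulrA.
  rewrite /N -(lap_iter_lsub _ _ MB) lsubM.
  apply: (elliptic_bound n0 d0); [exact: hom_lsub|exact: hom_lsub|].
  move=> x; rewrite meval_lsub.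
  have := Pge (\col_i x i); rewrite Atau lecE => /andP[_].
  rewrite -[complex.Re _]/(re _) -[complex.Re (peval _ _)]/(re _) => h.
  apply: le_trans (le_trans _ h) _.
    rewrite -[(delta%:C)%C]/(cR delta) re_cRM.
    rewrite (_ : \sum_(j < n) _ = cR (sqn x)) -?cRX ?re_cR//.
    by rewrite cR_sum; apply: eq_bigr => j _; rewrite !mxE cRX.
  rewrite /peval le_eqVlt; apply/orP; left; apply/eqP; congr re.
  apply: meval_eq => i; rewrite !mxE; apply: eq_bigr => k _; by rewrite !mxE.
exists N, K; split => //.
- by move=> f; apply: nr_ge0.
- move=> d f g hf hg; rewrite /N lsubD.
  exact: (nrD n0 (hom_lsub _ hf) (hom_lsub _ hg)).
- by move=> c f; rewrite /N lsubZ nrZ.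
- move=> d f hf; apply: le_trans (nr_le_nrm n0 (hom_lsub M hf)) _.
  apply: le_trans (nrm_lsub M hf) _.
  by rewrite ler_wpM2r ?nrm_ge0// expK.
- move=> d f hf; rewrite -[in leLHS](inv f).
  apply: le_trans (nrm_lsub _ (hom_lsub M hf)) _.
  apply: le_trans (_ : b ^+ d * ((n * (n + 2))%:R ^+ d * N f) <= _).
    by rewrite ler_wpM2l ?exprn_ge0// (nrm_le_nr n0) ?hom_lsub.
  by rewrite mulrA -exprMn ler_wpM2r ?nr_ge0// expK.
- move=> j d g f hg hf; rewrite /N lsubM.
  apply: le_trans (nrM n0 (hom_lsub M hg) (hom_lsub M hf)) _.
  rewrite ler_wpM2r ?nr_ge0//; apply: le_trans (nrm_lsub M hg) _.
  by rewrite ler_wpM2r ?nrm_ge0// expK.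
- move=> d i f hf; rewrite /N.
  have hLf := hom_lsub M hf.
  (* The chain rule solved for the derivative of f, by means of M A^T = 1. *)
  have E : lsub M (mderiv i f) = \sum_k A i k *: mderiv k (lsub M f).
    transitivity (\sum_j (i == j)%:R *: lsub M (mderiv j f)).
      rewrite (bigD1 i)//= eqxx scale1r big1 ?addr0// => j ji.
      by rewrite eq_sym (negbTE ji) scale0r.
    transitivity (\sum_k \sum_j (A i k * M j k) *: lsub M (mderiv j f)).
      rewrite exchange_big; apply: eq_bigr => j _.
      rewrite -scaler_suml; congr (_ *: _).
      have /matrixP/(_ j i) := hM'; rewrite !mxE eq_sym => <-.
      by apply: eq_bigr => k _; rewrite [A^T k i]mxE mulrC.
    apply: eq_bigr => k _; rewrite mderiv_lsub scaler_sumr.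
    by apply: eq_bigr => j _; rewrite scalerA.
  rewrite E.
  apply: le_trans (_ : \sum_k cabs (A i k) * nr (mderiv k (lsub M f)) <= _).
    have [_ //] : (\sum_k A i k *: mderiv k (lsub M f) \is hom d.-1) /\
      nr (\sum_k A i k *: mderiv k (lsub M f)) <=
      \sum_k cabs (A i k) * nr (mderiv k (lsub M f)).
    elim/big_ind2: _ => [|x y u v [hx xy] [hu uv]|k _].
    - by rewrite hom0 /nr sg0l sqrtr0.
    - split; first exact: homD.
      by apply: le_trans (nrD n0 hx hu) _; apply: lerD.
    - by rewrite nrZ; split => //; apply/homZ/hom_mderiv.
  apply: le_trans (_ : \sum_k cabs (A i k) * ((n + 2)%:R * d%:R * nr (lsub M f)) <= _).
    apply: ler_sum => k _; rewrite ler_wpM2l ?cabs_ge0//.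
    exact: nr_mderiv.
  rewrite -mulr_suml !mulrA ler_wpM2r ?nr_ge0// ler_wpM2r//.
  apply: le_trans bK1; rewrite ler_wpM2r//.
  have -> : \sum_k cabs (A i k) = \sum_k cabs (A^T k i).
    by apply: eq_bigr => k _; rewrite mxE.
  rewrite /b exchange_big /= [leRHS](bigD1 i)//= lerDl.
  by apply: sumr_ge0 => j _; apply: sumr_ge0 => k _; apply: cabs_ge0.
- move=> m q hq; apply: le_trans (fischer m q hq) _.
  by rewrite ler_wpM2r ?nr_ge0.
- move=> m; apply: (hom_surj n0).
  + by move=> f g; rewrite mulrDr pdiffDr.
  + by move=> c f; rewrite -scalerAr pdiffZr.
  + move=> f hf; have hQ : qform B ^+ p \is hom (2 * p) by apply/homX/hom_qform.
    by have := hom_pdiff hQ (homM hP hf); rewrite addKn.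
  + move=> f hf e; have := fischer m f hf; rewrite e.
    have -> : N 0 = 0 by rewrite /N lsub0 /nr sg0l sqrtr0.
    rewrite mulr0 pmulr_rle0 ?exprn_gt0// => h.
    rewrite -(inv f) (_ : lsub M f = 0) ?lsub0//.
    apply: (nr_eq0 n0 (hom_lsub M hf)); apply/eqP.
    by rewrite eq_le h nr_ge0.
Qed.
End Package.

(** * Contour integrals *)

Section Cint.
Variable R : realType.
Local Notation C := (Cplx R).
Local Notation mu := (@lebesgue_measure R).
Implicit Types (a b m t s x y M : R) (f g : R -> C).

(** Continuity stated with the real-valued modulus, so that all estimates are inequalities in R. *)
Definition gcont g t := forall e, 0 < e -> exists2 d, 0 < d &
  forall s, `|s - t| < d -> cabs (g s - g t) < e.

Definition cgood a b g := forall t, a <= t <= b -> gcont g t.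

Lemma gcont_cst c t : gcont (fun _ => c) t.
Proof. by move=> e e0; exists 1 => // s _; rewrite subrr cabs0. Qed.

Lemma gcont_cR t : gcont (@cR R) t.
Proof. by move=> e e0; exists e => // s; rewrite -cRB cabs_cR. Qed.

Lemma gcontD f g t : gcont f t -> gcont g t -> gcont (fun s => f s + g s) t.
Proof.
move=> hf hg e e0; have e2 : 0 < e / 2 by rewrite divr_gt0.
have [d1 d10 h1] := hf _ e2; have [d2 d20 h2] := hg _ e2.
exists (Num.min d1 d2); first by rewrite lt_min d10.
move=> s; rewrite lt_min => /andP[s1 s2].
rewrite opprD addrACA (le_lt_trans (cabsD _ _))//.
by rewrite [ltRHS](splitr e) ltrD ?h1 ?h2.
Qed.

Lemma gcontM f g t : gcont f t -> gcont g t -> gcont (fun s => f s * g s) t.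
Proof.
move=> hf hg e e0.
pose A := cabs (f t); pose B := cabs (g t).
have A0 : 0 <= A by exact: cabs_ge0.
have B0 : 0 <= B by exact: cabs_ge0.
pose k := Num.min 1 (e / (2 * (A + B + 1))).
have k0 : 0 < k by rewrite lt_min ltr01 divr_gt0//; lra.
have k1 : k <= 1 by rewrite ge_min lexx.
have k2 : k * (2 * (A + B + 1)) <= e.
  by rewrite -ler_pdivlMr ?ge_min ?lexx ?orbT//; lra.
have [d1 d10 h1] := hf _ k0; have [d2 d20 h2] := hg _ k0.
exists (Num.min d1 d2); first by rewrite lt_min d10.
move=> s; rewrite lt_min => /andP[/h1 s1 /h2 s2].
have -> : f s * g s - f t * g t =
   (f s - f t) * (g s - g t) + (f s - f t) * g t + f t * (g s - g t) by ring.
rewrite (le_lt_trans (cabsD _ _))// (@le_lt_trans _ _ (k * k + k * B + A * k))//.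
  apply: lerD; last by rewrite cabsM ler_wpM2l// ltW.
  rewrite (le_trans (cabsD _ _))// !cabsM lerD//.
    by apply: ler_pM; rewrite ?cabs_ge0// ltW.
  by rewrite ler_wpM2r// ltW.
nra.
Qed.

Lemma gcontN g t : gcont g t -> gcont (fun s => - g s) t.
Proof.
move=> hg e e0; have [d d0 h] := hg _ e0; exists d => // s /h.
by rewrite -opprD cabsN.
Qed.

Lemma gcont_re g t : gcont g t -> {for t, continuous (@re R \o g)}.
Proof.
move=> h; apply/cvgrPdist_lt => e /h [d d0 hd].
near=> s; rewrite /= -reB (le_lt_trans (re_le_cabs _))// cabs_distC hd//.
Unshelve. all: by end_near. Qed.

Lemma gcont_im g t : gcont g t -> {for t, continuous (@im R \o g)}.
Proof.
move=> h; apply/cvgrPdist_lt => e /h [d d0 hd].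
near=> s; rewrite /= -imB (le_lt_trans (im_le_cabs _))// cabs_distC hd//.
Unshelve. all: by end_near. Qed.

Definition rI a b (g : R -> R) : R := \int[mu]_(x in `[a, b]) g x.
Definition rgood a b (g : R -> R) := forall t, a <= t <= b -> {for t, continuous g}.

Lemma rgood_within a b (g : R -> R) : rgood a b g -> {within `[a, b], continuous g}.
Proof.
move=> h; apply: continuous_in_subspaceT => x; rewrite inE/= in_itv/=.
exact: h.
Qed.

Lemma rgood_int a b (g : R -> R) : rgood a b g ->
  mu.-integrable `[a, b] (EFin \o g).
Proof.
move=> h; apply: continuous_compact_integrable; first exact: segment_compact.
exact: rgood_within.
Qed.

Lemma rI_D a b (f g : R -> R) : rgood a b f -> rgood a b g ->
  rI a b (fun t => f t + g t) = rI a b f + rI a b g.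
Proof. by move=> hf hg; rewrite /rI RintegralD//; exact: rgood_int. Qed.

Lemma rI_Z a b k (g : R -> R) : rgood a b g ->
  rI a b (fun t => k * g t) = k * rI a b g.
Proof. by move=> hg; rewrite /rI RintegralZl//; exact: rgood_int. Qed.

Lemma rI_ext a b (f g : R -> R) : (forall t, a <= t <= b -> f t = g t) ->
  rI a b f = rI a b g.
Proof.
move=> h; apply: eq_Rintegral => x; rewrite inE/= in_itv/=; exact: h.
Qed.

Lemma rI_cst a b k : a <= b -> rI a b (fun=> k) = k * (b - a).
Proof.
move=> ab; rewrite /rI Rintegral_cst//= lebesgue_measure_itv/= lte_fin.
case: ltgtP ab => //= ab _; by rewrite ?ab ?subrr// -EFinB.
Qed.

Lemma rI_le a b (f g : R -> R) : rgood a b f -> rgood a b g ->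
  (forall t, a <= t <= b -> f t <= g t) -> rI a b f <= rI a b g.
Proof.
move=> hf hg h; apply: le_Rintegral => //; try exact: rgood_int.
Qed.

Lemma rgood_cst a b k : rgood a b (fun=> k).
Proof. by move=> t _; exact: cst_continuous. Qed.

Lemma rI_abs a b M (g : R -> R) : a <= b -> rgood a b g ->
  (forall t, a <= t <= b -> `|g t| <= M) -> `|rI a b g| <= M * (b - a).
Proof.
move=> ab hg h; rewrite ler_norml; apply/andP; split.
  rewrite -mulNr -(rI_cst _ ab); apply: rI_le => //; first exact: rgood_cst.
  by move=> t /h; rewrite ler_norml => /andP[].
rewrite -(rI_cst _ ab); apply: rI_le => //; first exact: rgood_cst.
by move=> t /h; rewrite ler_norml => /andP[].
Qed.

Lemma rI_split a m b (g : R -> R) : a <= m <= b -> rgood a b g ->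
  rI a b g = rI a m g + rI m b g.
Proof.
move=> /andP[am mb] /rgood_int hg.
have := @Rintegral_itvB R g (BLeft a) (BRight b) m hg.
rewrite !bnd_simp => /(_ am mb) /eqP; rewrite subr_eq addrC => /eqP.
rewrite /rI => ->; congr (_ + _); apply: Rintegral_itv_obnd_cbnd.
apply: integrableS hg => //; apply: subset_itvr; by rewrite bnd_simp.
Qed.

Lemma rI_FTC a b (f F : R -> R) : a < b -> rgood a b f ->
  (forall t : R, is_derive t 1 F (f t)) -> rI a b f = F b - F a.
Proof.
move=> ab hf hF; rewrite /rI /Rintegral (@continuous_FTC2 _ f F)//.
- exact: rgood_within.
- have cF t : {for t, continuous F}.
    by apply: differentiable_continuous; apply/derivable1_diffP; case: (hF t).
  split; first by move=> x _; case: (hF x).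
    exact: cvg_at_right_filter (cF a).
  exact: cvg_at_left_filter (cF b).
- by move=> x _; rewrite derive1E; case: (hF x).
Qed.

Definition cint a b g : C := cR (rI a b (fun t => re (g t))) + ci R * cR (rI a b (fun t => im (g t))).

Lemma cgood_re a b g : cgood a b g -> rgood a b (fun t => re (g t)).
Proof. by move=> h t /h; exact: gcont_re. Qed.
Lemma cgood_im a b g : cgood a b g -> rgood a b (fun t => im (g t)).
Proof. by move=> h t /h; exact: gcont_im. Qed.
Hint Resolve cgood_re cgood_im : core.

Lemma cint_ext a b f g : (forall t, a <= t <= b -> f t = g t) ->
  cint a b f = cint a b g.
Proof.
by move=> h; congr (cR _ + _ * cR _); apply: rI_ext => t /h ->.
Qed.

Lemma cintD a b f g : cgood a b f -> cgood a b g ->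
  cint a b (fun t => f t + g t) = cint a b f + cint a b g.
Proof.
move=> hf hg; rewrite /cint.
rewrite (@rI_ext _ _ _ (fun t => re (f t) + re (g t))); last by move=> t _; exact: reD.
rewrite (@rI_ext _ _ (fun t => im _) (fun t => im (f t) + im (g t))); last by move=> t _; exact: imD.
by rewrite !rI_D; auto; rewrite !cRD; ring.
Qed.

Lemma cgoodZ a b k g : cgood a b g -> cgood a b (fun t => k * g t).
Proof. by move=> h t /h; apply: gcontM; exact: gcont_cst. Qed.

Lemma cintZ a b k g : cgood a b g -> cint a b (fun t => k * g t) = k * cint a b g.
Proof.
move=> hg; rewrite /cint.
have gr c := @rgood_cst a b c.
have Z c (u : R -> R) : rgood a b u -> rgood a b (fun t => c * u t).
  by move=> h t /h ut; apply: continuousM => //; exact: cst_continuous.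
rewrite (@rI_ext _ _ _ (fun t => re k * re (g t) + - im k * im (g t))); last first.
  by move=> t _; rewrite reM; ring.
rewrite (@rI_ext _ _ (fun t => im _) (fun t => re k * im (g t) + im k * re (g t))); last first.
  by move=> t _; rewrite imM; ring.
rewrite !rI_D; [|by apply: Z; auto..]; rewrite !rI_Z; auto.
apply: re_im_eq; rewrite !(reD, imD, reM, imM, re_cR, im_cR, re_ci, im_ci); ring.
Qed.

Lemma cintB a b f g : cgood a b f -> cgood a b g ->
  cint a b (fun t => f t - g t) = cint a b f - cint a b g.
Proof.
move=> hf hg.
rewrite (@cint_ext _ _ _ (fun t => f t + -1 * g t)); last by move=> t _; rewrite mulN1r.
by rewrite cintD ?cintZ ?mulN1r//; apply: cgoodZ.
Qed.

Lemma cint_split a m b g : a <= m <= b -> cgood a b g ->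
  cint a b g = cint a m g + cint m b g.
Proof.
move=> amb hg; rewrite /cint (rI_split amb (cgood_re hg)) (rI_split amb (cgood_im hg)).
by rewrite !cRD; ring.
Qed.

(** Real and imaginary parts are bounded separately, hence the factor 2. *)
Lemma cint_bound a b M g : a <= b -> cgood a b g ->
  (forall t, a <= t <= b -> cabs (g t) <= M) ->
  cabs (cint a b g) <= 2 * M * (b - a).
Proof.
move=> ab hg h; rewrite /cint (le_trans (cabsD _ _))// cabsM cabs_ci mul1r !cabs_cR.
rewrite -mulrA mulrDl mul1r lerD// rI_abs//; auto; move=> t /h; apply: le_trans.
  exact: re_le_cabs.
exact: im_le_cabs.
Qed.

Lemma cint_cst a b k : a <= b -> cint a b (fun=> k) = k * cR (b - a).
Proof.
move=> ab; rewrite /cint !rI_cst// !cRM mulrA -mulrDl; congr (_ * _).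
exact: esym (cplxE k).
Qed.

Lemma is_derive_halfsqr t : is_derive t (1 : R) (fun u : R => u ^+ 2 / 2) t.
Proof.
apply: is_derive_eq; rewrite /= -?[_ *: _]/(_ * _) ?scaler0 ?add0r ?addr0.
by field.
Qed.

Lemma cint_id a b : a < b -> cint a b (fun t => cR t) = cR ((b ^+ 2 - a ^+ 2) / 2).
Proof.
move=> ab; rewrite /cint.
rewrite (@rI_ext _ _ (fun t => im _) (fun=> 0)); last by move=> t _; rewrite im_cR.
rewrite rI_cst ?ltW// mul0r cR0 mulr0 addr0; congr cR.
rewrite (rI_FTC ab _ is_derive_halfsqr) -?mulrBl//.
by move=> t _ /=; exact: (gcont_re (@gcont_cR t)).
Qed.
End Cint.

(** * Integrals along the boundary of a rectangle *)

Section Contour.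
Variable R : realType.
Local Notation C := (Cplx R).
Implicit Types (a b c d t s x y M : R) (f g : C -> C) (z w D : C).

Definition zp x y : C := cR x + ci R * cR y.

Lemma re_zp x y : re (zp x y) = x.
Proof. by rewrite /zp !(reD, reM, re_cR, re_ci, im_ci, im_cR); ring. Qed.
Lemma im_zp x y : im (zp x y) = y.
Proof. by rewrite /zp !(imD, imM, re_cR, re_ci, im_ci, im_cR); ring. Qed.
Lemma zpE z : z = zp (re z) (im z).
Proof. exact: cplxE. Qed.

Definition ccts f z := forall e, 0 < e -> exists2 d, 0 < d &
  forall h, cabs h < d -> cabs (f (z + h) - f z) < e.

Definition cdiff f z D := forall e, 0 < e -> exists2 d, 0 < d &
  forall h, cabs h < d -> cabs (f (z + h) - f z - D * h) <= e * cabs h.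

Definition hol1 f z := exists D, cdiff f z D.

Lemma cdiff_ccts f z D : cdiff f z D -> ccts f z.
Proof.
move=> hf e e0; have [d d0 hd] := hf 1 ltr01.
pose A := cabs D + 1.
have A0 : 0 < A by rewrite ltr_wpDl ?cabs_ge0.
exists (Num.min d (e / A)); first by rewrite lt_min d0 divr_gt0.
move=> h; rewrite lt_min => /andP[/hd h1 h2].
rewrite ltr_pdivlMr// in h2.
have -> : f (z + h) - f z = (f (z + h) - f z - D * h) + D * h by rewrite subrK.
apply: le_lt_trans h2; apply: le_trans (cabsD _ _) _.
rewrite cabsM /A; have := cabs_ge0 h; nra.
Qed.

Lemma hol1_ccts f z : hol1 f z -> ccts f z.
Proof. by move=> [D /cdiff_ccts]. Qed.

Lemma ccts_gcont_h f x y : ccts f (zp x y) -> gcont (fun t => f (zp t y)) x.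
Proof.
move=> h e /h [d d0 hd]; exists d => // s sx.
have -> : zp s y = zp x y + cR (s - x) by rewrite /zp cRB; ring.
by apply: hd; rewrite cabs_cR.
Qed.

Lemma ccts_gcont_v f x y : ccts f (zp x y) -> gcont (fun t => f (zp x t)) y.
Proof.
move=> h e /h [d d0 hd]; exists d => // s sx.
have -> : zp x s = zp x y + ci R * cR (s - y) by rewrite /zp cRB; ring.
by apply: hd; rewrite cabsM cabs_ci mul1r cabs_cR.
Qed.

(* The integral along the boundary of [a, b] x [c, d]. *)
Definition rint f a b c d : C :=
  cint a b (fun t => f (zp t c)) + ci R * cint c d (fun t => f (zp b t))
  - cint a b (fun t => f (zp t d)) - ci R * cint c d (fun t => f (zp a t)).

Definition onb (P : C -> Prop) a b c d :=
  (forall t, a <= t <= b -> P (zp t c) /\ P (zp t d)) /\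
  (forall t, c <= t <= d -> P (zp a t) /\ P (zp b t)).

Lemma bgoodP f a b c d : onb (ccts f) a b c d ->
  [/\ cgood a b (fun t => f (zp t c)), cgood a b (fun t => f (zp t d)),
      cgood c d (fun t => f (zp a t)) & cgood c d (fun t => f (zp b t))].
Proof.
move=> [h v]; split=> t tt.
- by apply: ccts_gcont_h; case: (h t tt).
- by apply: ccts_gcont_h; case: (h t tt).
- by apply: ccts_gcont_v; case: (v t tt).
- by apply: ccts_gcont_v; case: (v t tt).
Qed.

Lemma rintD f g a b c d : onb (ccts f) a b c d -> onb (ccts g) a b c d ->
  rint (fun z => f z + g z) a b c d = rint f a b c d + rint g a b c d.
Proof.
move=> /bgoodP[f1 f2 f3 f4] /bgoodP[g1 g2 g3 g4].
rewrite /rint !cintD//.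
by move: (cint _ _ _) (cint _ _ _) (cint _ _ _) (cint _ _ _)
  (cint _ _ _) (cint _ _ _) (cint _ _ _) (cint _ _ _) (ci R) => *; ring.
Qed.

Lemma rintZ k f a b c d : onb (ccts f) a b c d ->
  rint (fun z => k * f z) a b c d = k * rint f a b c d.
Proof.
by move=> /bgoodP[f1 f2 f3 f4]; rewrite /rint !cintZ//;
move: (cint _ _ _) (cint _ _ _) (cint _ _ _) (cint _ _ _) (ci R) => *; ring.
Qed.

Lemma rint_ext f g a b c d : onb (fun z => f z = g z) a b c d ->
  rint f a b c d = rint g a b c d.
Proof.
move=> [h v]; rewrite /rint.
by congr (_ + _ * _ - _ - _ * _); apply: cint_ext => t tt;
  [case: (h t tt)|case: (v t tt)|case: (h t tt)|case: (v t tt)].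
Qed.

Lemma rint_bound M f a b c d : a <= b -> c <= d -> onb (ccts f) a b c d ->
  onb (fun z => cabs (f z) <= M) a b c d ->
  cabs (rint f a b c d) <= 4 * M * ((b - a) + (d - c)).
Proof.
move=> ab cd /bgoodP[f1 f2 f3 f4] [h v].
have b1 : cabs (cint a b (fun t => f (zp t c))) <= 2 * M * (b - a).
  by apply: cint_bound => // t tt; case: (h t tt).
have b2 : cabs (cint a b (fun t => f (zp t d))) <= 2 * M * (b - a).
  by apply: cint_bound => // t tt; case: (h t tt).
have b3 : cabs (cint c d (fun t => f (zp a t))) <= 2 * M * (d - c).
  by apply: cint_bound => // t tt; case: (v t tt).
have b4 : cabs (cint c d (fun t => f (zp b t))) <= 2 * M * (d - c).
  by apply: cint_bound => // t tt; case: (v t tt).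
rewrite /rint; apply: le_trans (cabsB _ _) _.
rewrite cabsM cabs_ci mul1r; apply: le_trans (lerD (cabsB _ _) b3) _.
apply: le_trans (lerD (lerD (cabsD _ _) b2) (lexx _)) _.
rewrite cabsM cabs_ci mul1r; lra.
Qed.

(** Evaluated side by side with explicit primitives; the four contributions cancel because 1 + i^2 =
    0. This is the only case of Cauchy's theorem that bisection presupposes. *)
Lemma rint_affine k D z0 a b c d : a < b -> c < d ->
  rint (fun z => k + D * (z - z0)) a b c d = 0.
Proof.
move=> ab cd.
have lin e u v (k0 d0 : C) : u < v -> cint u v (fun t => k0 + d0 * (e + cR t)) =
    (k0 + d0 * e) * cR (v - u) + d0 * cR ((v ^+ 2 - u ^+ 2) / 2).
  move=> uv; rewrite (@cint_ext _ _ _ _ (fun t => (k0 + d0 * e) + d0 * cR t)); last first.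
    by move=> t _; ring.
  rewrite cintD; last 2 first.
  - by move=> t _; exact: gcont_cst.
  - by apply: cgoodZ => t _; exact: gcont_cR.
  rewrite cintZ; last by move=> t _; exact: gcont_cR.
  by rewrite cint_cst ?ltW// cint_id.
have hE y : cint a b (fun t => k + D * (zp t y - z0)) =
    (k + D * (ci R * cR y - z0)) * cR (b - a) + D * cR ((b ^+ 2 - a ^+ 2) / 2).
  rewrite -lin//; apply: cint_ext => t _; rewrite /zp; ring.
(* On a vertical side z - z0 = i (t - i (x - z0)), which is of the shape treated by [lin]. *)
have vE x : cint c d (fun t => k + D * (zp x t - z0)) =
    (k + (D * ci R) * (- ci R * (cR x - z0))) * cR (d - c) + (D * ci R) * cR ((d ^+ 2 - c ^+ 2) / 2).
  rewrite -lin//; apply: cint_ext => t _; rewrite /zp.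
  have i2 : ci R * ci R = -1.
    by apply: re_im_eq; rewrite !(reM, imM, reN, imN, re_ci, im_ci, re1, im1); ring.
  apply/eqP; rewrite -subr_eq0; apply/eqP.
  transitivity ((1 + ci R * ci R) * (D * (cR x - z0))); first by ring.
  by rewrite i2 subrr mul0r.
have i2 : 1 + ci R * ci R = 0.
  by apply: re_im_eq; rewrite !(reD, imD, reM, imM, re_ci, im_ci, re1, im1) ?re0 ?im0; ring.
rewrite /rint !hE !vE !cRB.
move: (cR (_ / 2)) (cR (_ / 2)) (cR a) (cR b) (cR c) (cR d) (ci R) i2.
move=> S T a' b' c' d' i i2.
transitivity ((1 + i * i) * (- (D * i * (b' - a') * (d' - c')))); first by ring.
by rewrite i2 mul0r.
Qed.

Lemma rint_cutv f a m b c d : a <= m <= b ->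
  (forall t, a <= t <= b -> ccts f (zp t c) /\ ccts f (zp t d)) ->
  rint f a b c d = rint f a m c d + rint f m b c d.
Proof.
move=> amb h; rewrite /rint (cint_split amb); last first.
  by move=> t tt; apply: ccts_gcont_h; case: (h t tt).
rewrite [cint a b (fun t => f (zp t d))](cint_split amb); last first.
  by move=> t tt; apply: ccts_gcont_h; case: (h t tt).
by do ![move: (cint _ _ _) => ?]; ring.
Qed.

Lemma rint_cuth f a b c m d : c <= m <= d ->
  (forall t, c <= t <= d -> ccts f (zp a t) /\ ccts f (zp b t)) ->
  rint f a b c d = rint f a b c m + rint f a b m d.
Proof.
move=> amb h; rewrite /rint (cint_split amb); last first.
  by move=> t tt; apply: ccts_gcont_v; case: (h t tt).
rewrite [cint c d (fun t => f (zp a t))](cint_split amb); last first.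
  by move=> t tt; apply: ccts_gcont_v; case: (h t tt).
by do ![move: (cint _ _ _) => ?]; ring.
Qed.
End Contour.

(** * The theorem of Goursat and the formula of Cauchy *)

(** Dependent choice along an invariant Q; it produces the nested rectangles of the bisection. *)
Lemma iter_choice (T : Type) (Q : nat -> T -> Prop) (S : nat -> T -> T -> Prop) (x0 : T) :
  Q 0%N x0 -> (forall k x, Q k x -> exists2 y, Q k.+1 y & S k x y) ->
  exists s : nat -> T, [/\ s 0%N = x0, forall k, Q k (s k) & forall k, S k (s k) (s k.+1)].
Proof.
move=> q0 step.
have step' (kx : nat * T) : exists y, Q kx.1 kx.2 -> Q kx.1.+1 y /\ S kx.1 kx.2 y.
  case: (pselect (Q kx.1 kx.2)) => [/step[y h1 h2]|h]; first by exists y.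
  by exists x0.
have [g hg] := choice step'.
pose s := fix s k := if k is k'.+1 then g (k', s k') else x0.
have hs k : Q k (s k).
  by elim: k => [//|k IH]; have [] := hg (k, s k) IH.
exists s; split => // k.
by have [] := hg (k, s k) (hs k).
Qed.

Section Goursat.
Variable R : realType.
Local Notation C := (Cplx R).
Implicit Types (a b c d t s x y M : R) (f g : C -> C) (z w D : C).

Lemma nested_point (s : nat -> R) (W : R) : 0 <= W ->
  (forall k, s k <= s k.+1 /\ s k.+1 + W / 2 ^+ k.+1 <= s k + W / 2 ^+ k) ->
  exists x, forall k, s k <= x <= s k + W / 2 ^+ k.
Proof.
move=> W0 h.
have mono k j : s k <= s (k + j)%N /\ s (k + j)%N + W / 2 ^+ (k + j) <= s k + W / 2 ^+ k.
  elim: j => [|j [h1 h2]]; first by rewrite addn0.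
  rewrite addnS; have [h3 h4] := h (k + j)%N.
  by split; [exact: le_trans h3|exact: le_trans h2].
have W2 k : 0 <= W / 2 ^+ k by rewrite divr_ge0 ?exprn_ge0.
have cross k j : s k <= s j + W / 2 ^+ j.
  case: (leqP k j) => [/subnKC <-|/ltnW/subnKC <-].
    have [h1 _] := mono k (j - k)%N; apply: (le_trans h1).
    by rewrite lerDl W2.
  have [_ h2] := mono j (k - j)%N; apply: le_trans h2.
  by rewrite lerDl W2.
pose E : set R := range s.
have hs : has_sup E.
  split; first by exists (s 0%N); exists 0%N.
  by exists (s 0%N + W / 2 ^+ 0) => _ [k _ <-]; exact: cross.
exists (sup E) => k; apply/andP; split.
  by apply: sup_upper_bound => //; exists k.
by apply: sup_le_ub; [exact: (proj1 hs)|move=> _ [j _ <-]; exact: cross].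
Qed.

Lemma zp_bound (x0 y0 x y u v : R) : `|x - x0| <= u -> `|y - y0| <= v ->
  cabs (zp x y - zp x0 y0) <= u + v.
Proof.
move=> hx hy; apply: le_trans (cabs_le_reim _) _.
by rewrite reB imB !re_zp !im_zp lerD.
Qed.

Lemma ccts_affine k D z0 z : ccts (fun z => k + D * (z - z0)) z.
Proof.
apply: (@cdiff_ccts _ _ _ D) => e e0; exists 1 => // h _.
have -> : k + D * (z + h - z0) - (k + D * (z - z0)) - D * h = 0 by ring.
by rewrite cabs0 mulr_ge0 ?cabs_ge0// ltW.
Qed.

Lemma cctsD f g z : ccts f z -> ccts g z -> ccts (fun z => f z + g z) z.
Proof.
move=> hf hg e e0; have e2 : 0 < e / 2 by rewrite divr_gt0.
have [d1 d10 h1] := hf _ e2; have [d2 d20 h2] := hg _ e2.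
exists (Num.min d1 d2); first by rewrite lt_min d10.
move=> s; rewrite lt_min => /andP[s1 s2].
rewrite opprD addrACA (le_lt_trans (cabsD _ _))//.
by rewrite [ltRHS](splitr e) ltrD ?h1 ?h2.
Qed.

Lemma cctsN f z : ccts f z -> ccts (fun z => - f z) z.
Proof.
move=> hg e e0; have [d d0 h] := hg _ e0; exists d => // s /h.
by rewrite -opprD cabsN.
Qed.

Lemma hol1M f g z : hol1 f z -> hol1 g z -> hol1 (fun z => f z * g z) z.
Proof.
move=> [Df hf] [Dg hg]; exists (Df * g z + f z * Dg) => e e0.
pose A := cabs (f z) + cabs (g z) + cabs Df + 1.
have [f0 g0 D0] : [/\ 0 <= cabs (f z), 0 <= cabs (g z) & 0 <= cabs Df].
  by split; exact: cabs_ge0.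
have A0 : 0 < A by rewrite /A; lra.
pose k := Num.min 1 (e / A).
have k0 : 0 < k by rewrite lt_min ltr01 divr_gt0.
have k1 : k <= 1 by rewrite ge_min lexx.
have k2 : k * A <= e by rewrite -ler_pdivlMr// ge_min lexx orbT.
clearbody k.
have [d1 d10 h1] := hf _ k0; have [d2 d20 h2] := hg _ k0.
have [d3 d30 h3] := cdiff_ccts hg k0.
exists (Num.min d1 (Num.min d2 d3)); first by rewrite !lt_min d10 d20.
move=> h; rewrite !lt_min => /and3P[/h1 {}h1 /h2 {}h2 /h3 /ltW {}h3].
have -> : f (z + h) * g (z + h) - f z * g z - (Df * g z + f z * Dg) * h =
    (f (z + h) - f z - Df * h) * ((g (z + h) - g z) + g z) +
    f z * (g (z + h) - g z - Dg * h) + Df * h * (g (z + h) - g z) by ring.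
apply: le_trans (_ : k * cabs h * (k + cabs (g z)) + cabs (f z) * (k * cabs h)
  + cabs Df * cabs h * k <= _).
  apply: le_trans (cabsD _ _) _; apply: lerD.
    apply: le_trans (cabsD _ _) _; rewrite !cabsM; apply: lerD.
      apply: ler_pM; rewrite ?cabs_ge0//; apply: le_trans (cabsD _ _) _.
      by rewrite lerD2r.
    by rewrite ler_wpM2l.
  by rewrite !cabsM ler_wpM2l// mulr_ge0 ?cabs_ge0.
have hh := cabs_ge0 h.
apply: le_trans (_ : k * A * cabs h <= _); last by rewrite ler_wpM2r.
have -> : k * cabs h * (k + cabs (g z)) + cabs (f z) * (k * cabs h) +
    cabs Df * cabs h * k = k * (k + cabs (g z) + cabs (f z) + cabs Df) * cabs h by ring.
rewrite ler_wpM2r// ler_wpM2l ?(ltW k0)// /A.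
by move: (cabs (f z)) (cabs (g z)) (cabs Df) k1 => u v t; lra.
Qed.

Lemma hol1_inv w z : z != w -> hol1 (fun z => (z - w)^-1) z.
Proof.
move=> zw; exists (- (z - w) ^- 2) => e e0.
have zw0 : z - w != 0 by rewrite subr_eq0.
pose r := cabs (z - w).
have r0 : 0 < r by rewrite cabs_gt0.
have r3 : 0 < r ^+ 3 by exact: exprn_gt0.
(* For |h| <= r/2 the point z + h stays at distance r/2 from w, so the remainder h^2 / ((z - w)^2 (z
   + h - w)) is at most 2 |h|^2 / r^3. *)
exists (Num.min (r / 2) (e * r ^+ 3 / 2)).
  by rewrite lt_min !divr_gt0 ?mulr_gt0.
move=> h; rewrite lt_min => /andP[h1 h2].
have zh : r / 2 <= cabs (z + h - w).
  have := cabsB (z + h - w) h; rewrite (_ : z + h - w - h = z - w); last by ring.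
  by rewrite -/r; lra.
have zh0 : z + h - w != 0 by rewrite -cabs_gt0 (lt_le_trans _ zh)// divr_gt0.
have -> : (z + h - w)^-1 - (z - w)^-1 - - (z - w) ^- 2 * h =
    h * h / ((z - w) ^+ 2 * (z + h - w)) by field; rewrite zh0.
rewrite cabsM cabsV !cabsM -/r -(expr2 r) mulrAC ler_wpM2r ?cabs_ge0//.
rewrite ler_pdivrMr ?mulr_gt0 ?exprn_gt0 ?cabs_gt0//.
apply: le_trans (_ : e * (r ^+ 2 * (r / 2)) <= _); last first.
  by rewrite ler_wpM2l ?(ltW e0)// ler_wpM2l// exprn_ge0// ltW.
have -> : e * (r ^+ 2 * (r / 2)) = e * r ^+ 3 / 2 by field.
exact: ltW.
Qed.

Lemma hol1_cst k z : hol1 (fun=> k) z.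
Proof.
exists 0 => e e0; exists 1 => // h _.
by rewrite subrr mul0r subr0 cabs0 mulr_ge0 ?cabs_ge0// ltW.
Qed.

Lemma rint_quarter f (x y w h : R) : 0 < w -> 0 < h ->
  (forall u v, x <= u <= x + w -> y <= v <= y + h -> ccts f (zp u v)) ->
  rint f x (x + w) y (y + h) = rint f x (x + w / 2) y (y + h / 2) +
      rint f x (x + w / 2) (y + h / 2) (y + h / 2 + h / 2) +
      (rint f (x + w / 2) (x + w / 2 + w / 2) y (y + h / 2) +
       rint f (x + w / 2) (x + w / 2 + w / 2) (y + h / 2) (y + h / 2 + h / 2)).
Proof.
move=> w0 h0 cc.
have -> : x + w / 2 + w / 2 = x + w by field.
have -> : y + h / 2 + h / 2 = y + h by field.
have x1 : x <= x + w / 2 by lra.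
have x2 : x + w / 2 <= x + w by lra.
have y1 : y <= y + h / 2 by lra.
have y2 : y + h / 2 <= y + h by lra.
have xx : x <= x + w / 2 <= x + w by rewrite x1.
have yy : y <= y + h / 2 <= y + h by rewrite y1.
have xl : x <= x <= x + w by rewrite lexx (le_trans x1).
have xr : x <= x + w <= x + w by rewrite lexx (le_trans x1).
have yl : y <= y <= y + h by rewrite lexx (le_trans y1).
have yr : y <= y + h <= y + h by rewrite lexx (le_trans y1).
rewrite (rint_cutv xx) => [|t tt]; last by split; exact: cc.
by congr (_ + _); apply: (rint_cuth yy) => t tt; split; exact: cc.
Qed.

Lemma quarter_max (eta F : R) (i1 i2 i3 i4 : C) : 0 <= F ->
  eta <= F * cabs (i1 + i2 + (i3 + i4)) ->
  eta <= 4 * F * cabs i1 \/ eta <= 4 * F * cabs i2 \/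
  eta <= 4 * F * cabs i3 \/ eta <= 4 * F * cabs i4.
Proof.
move=> F0 he.
have hs : cabs (i1 + i2 + (i3 + i4)) <= cabs i1 + cabs i2 + (cabs i3 + cabs i4).
  apply: le_trans (cabsD _ _) _; apply: lerD; exact: cabsD.
have := le_trans he (ler_wpM2l F0 hs); move: (cabs i1) (cabs i2) (cabs i3) (cabs i4).
move=> j1 j2 j3 j4 {he hs} he.
case: (leP eta (4 * F * j1)) => [|k1]; first by left.
case: (leP eta (4 * F * j2)) => [|k2]; first by right; left.
case: (leP eta (4 * F * j3)) => [|k3]; first by right; right; left.
case: (leP eta (4 * F * j4)) => [|k4]; first by right; right; right.
by exfalso; lra.
Qed.

(** Bisection: some quarter keeps at least a quarter of the modulus of the integral. Near the limit
    point f differs from its affine approximation, whose integral is 0, by o(2^-k); times a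
    perimeter of order 2^-k this is o(4^-k), which beats the factor 4^k. *)
Lemma goursat f a b c d : a < b -> c < d ->
  (forall x y, a <= x <= b -> c <= y <= d -> hol1 f (zp x y)) ->
  rint f a b c d = 0.
Proof.
move=> ab cd hf.
pose W := b - a; pose H := d - c.
have W0 : 0 < W by rewrite subr_gt0.
have H0 : 0 < H by rewrite subr_gt0.
(* The integral along the rectangle with lower left corner p, after k bisections. *)
pose I k (p : R * R) := rint f p.1 (p.1 + W / 2 ^+ k) p.2 (p.2 + H / 2 ^+ k).
pose eta := cabs (rint f a b c d).
pose Q k (p : R * R) := [/\ a <= p.1, p.1 + W / 2 ^+ k <= b, c <= p.2,
   p.2 + H / 2 ^+ k <= d & eta <= 4 ^+ k * cabs (I k p)].
pose S k (p q : R * R) :=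
  (p.1 <= q.1 /\ q.1 + W / 2 ^+ k.+1 <= p.1 + W / 2 ^+ k) /\
  (p.2 <= q.2 /\ q.2 + H / 2 ^+ k.+1 <= p.2 + H / 2 ^+ k).
have wpos k : 0 < W / 2 ^+ k by rewrite divr_gt0 ?exprn_gt0.
have hpos k : 0 < H / 2 ^+ k by rewrite divr_gt0 ?exprn_gt0.
have half (V : R) k : V / 2 ^+ k.+1 = V / 2 ^+ k / 2 by rewrite exprS invfM; ring.
have Q0 : Q 0%N (a, c).
  have e1 : a + W = b by rewrite /W addrC subrK.
  have e2 : c + H = d by rewrite /H addrC subrK.
  by rewrite /Q /I /= !expr0 !divr1 mul1r e1 e2; split.
have step k p : Q k p -> exists2 q, Q k.+1 q & S k p q.
  case: p => x y [/= ax xb cy yd he].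
  set w := W / 2 ^+ k in xb he *; set h := H / 2 ^+ k in yd he *.
  have w0 : 0 < w by exact: wpos.
  have h0 : 0 < h by exact: hpos.
  have cc u v : a <= u <= b -> c <= v <= d -> ccts f (zp u v).
    by move=> hu hv; apply: hol1_ccts; exact: hf.
  have cc' u v : x <= u <= x + w -> y <= v <= y + h -> ccts f (zp u v).
    move=> /andP[u1 u2] /andP[v1 v2]; apply: cc.
      by rewrite (le_trans ax u1) (le_trans u2 xb).
    by rewrite (le_trans cy v1) (le_trans v2 yd).
  have {he} : eta <= 4 ^+ k * cabs (rint f x (x + w) y (y + h)) := he.
  rewrite (rint_quarter w0 h0 cc') => /quarter_max.
  rewrite exprn_ge0// -exprS => /(_ isT).
  have w2 : 0 <= w / 2 by rewrite divr_ge0// ltW.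
  have h2 : 0 <= h / 2 by rewrite divr_ge0// ltW.
  have wE : w = w / 2 + w / 2 by field.
  have hE : h = h / 2 + h / 2 by field.
  have [w1 h1] : w / 2 <= w /\ h / 2 <= h by rewrite {2}wE {2}hE !lerDl.
  rewrite /Q /S /I.
  clear - ax xb cy yd w2 h2 wE hE w1 h1 half.
  move=> [|[|[]]] hq.
  - exists (x, y); rewrite /= !half -/w -/h; split => //; lra.
  - exists (x, y + h / 2); rewrite /= !half -/w -/h; split => //; lra.
  - exists (x + w / 2, y); rewrite /= !half -/w -/h; split => //; lra.
  - exists (x + w / 2, y + h / 2); rewrite /= !half -/w -/h; split => //; lra.
have [s [_ hQ hS]] := iter_choice Q0 step.
have [X hX] := nested_point (ltW W0) (fun k => proj1 (hS k)).
have [Y hY] := nested_point (ltW H0) (fun k => proj2 (hS k)).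
have aX : a <= X <= b.
  have [h1 h2 _ _ _] := hQ 0%N; have /andP[h3 h4] := hX 0%N; apply/andP; split; lra.
have cY : c <= Y <= d.
  have [_ _ h1 h2 _] := hQ 0%N; have /andP[h3 h4] := hY 0%N; apply/andP; split; lra.
have [D hD] := hf _ _ aX cY.
apply/eqP; rewrite -cabs_eq0 eq_le cabs_ge0 andbT -/eta.
apply/ler_addgt0Pr => e e0; rewrite add0r.
pose V := W + H.
have V0 : 0 < V by exact: addr_gt0.
have V2 : 0 < 4 * V ^+ 2 by rewrite mulr_gt0 ?exprn_gt0.
(* [rint_bound] will give 4 (e' V / 2^k) (V / 2^k); multiplied by 4^k this is exactly e. *)
have e1 : 0 < e / (4 * V ^+ 2) by rewrite divr_gt0.
have [dl dl0 hdl] := hD _ e1.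
set e' := e / _ in e1 hdl.
have [k hk] : exists k, V / 2 ^+ k < dl.
  have h := @cvg_geometric R V (2^-1).
  have : `|2^-1 : R| < 1 by rewrite ger0_norm ?invf_lt1 ?ltr1n.
  move=> /h /cvgrPdist_lt /(_ _ dl0) [k _ /(_ k (leqnn k))] /=.
  rewrite sub0r normrN ger0_norm; last by rewrite mulr_ge0 ?exprn_ge0 ?ltW.
  by rewrite exprVn; exists k.
have [h1 h2 h3 h4 h5] := hQ k.
apply: (le_trans h5); rewrite /I.
have /andP[X1 X2] := hX k; have /andP[Y1 Y2] := hY k.
move: (wpos k) (hpos k) h1 h2 h3 h4 X1 X2 Y1 Y2.
case: (s k) => x y /=.
have wh : W / 2 ^+ k + H / 2 ^+ k = V / 2 ^+ k by rewrite /V [RHS]mulrDl.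
move: wh; set w := W / 2 ^+ k; set h := H / 2 ^+ k => wh w0 h0 h1 h2 h3 h4 X1 X2 Y1 Y2.
pose af z := f (zp X Y) + D * (z - zp X Y).
pose g z := f z + - af z.
have near u v : x <= u <= x + w -> y <= v <= y + h ->
    ccts f (zp u v) /\ cabs (g (zp u v)) <= e' * (V / 2 ^+ k).
  move=> /andP[u1 u2] /andP[v1 v2]; split.
    by apply/hol1_ccts/hf; [rewrite (le_trans h1 u1) (le_trans u2 h2)|rewrite (le_trans h3 v1) (le_trans v2 h4)].
  have dz : cabs (zp u v - zp X Y) <= V / 2 ^+ k.
    rewrite -wh; apply: zp_bound.
      by clear - u1 u2 X1 X2; rewrite ler_norml; apply/andP; split; lra.
    by clear - v1 v2 Y1 Y2; rewrite ler_norml; apply/andP; split; lra.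
  have := hdl _ (le_lt_trans dz hk).
  have zz : zp X Y + (zp u v - zp X Y) = zp u v by rewrite addrC subrK.
  rewrite zz => h6; apply: le_trans (le_trans _ h6) _.
    by rewrite /g /af opprD addrA.
  by rewrite ler_wpM2l// ltW.
have bnd (P : C -> Prop) : (forall u v, x <= u <= x + w -> y <= v <= y + h -> P (zp u v)) ->
    onb P x (x + w) y (y + h).
  move=> hP; split=> t tt; split; apply: hP => //.
  - by rewrite lexx lerDl ltW.
  - by rewrite lexx lerDl ltW.
  - by rewrite lexx lerDl ltW.
  - by rewrite lexx lerDl ltW.
have cg : onb (ccts g) x (x + w) y (y + h).
  apply: bnd => u v hu hv; apply: cctsD; first by case: (near u v hu hv).
  exact/cctsN/ccts_affine.
have xw : x < x + w by rewrite ltrDl.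
have yh : y < y + h by rewrite ltrDl.
have -> : rint f x (x + w) y (y + h) = rint g x (x + w) y (y + h).
  transitivity (rint (fun z => g z + af z) x (x + w) y (y + h)).
    by apply: rint_ext; apply: bnd => u v _ _; rewrite /g subrK.
  rewrite rintD// ?rint_affine ?addr0//.
  by apply: bnd => u v _ _; exact: ccts_affine.
have := rint_bound (ltW xw) (ltW yh) cg (bnd _ (fun u v hu hv => proj2 (near u v hu hv))).
rewrite ![_ + _ - _]addrAC !subrr !add0r wh => h7.
apply: le_trans (ler_wpM2l (exprn_ge0 k (ler0n R 4)) h7) _.
rewrite le_eqVlt; apply/orP; left; apply/eqP.
have -> : 4 ^+ k = 2 ^+ k * 2 ^+ k :> R by rewrite -exprMn; congr (_ ^+ _); ring.
have p0 : 2 ^+ k != 0 :> R by rewrite expf_neq0.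
by rewrite /e'; field; rewrite p0 gt_eqF.
Qed.
End Goursat.

Section Cauchy.
Variable R : realType.
Local Notation C := (Cplx R).
Implicit Types (a b c d t s x y M u v eta : R) (f g : C -> C) (z w D : C).

Lemma zp_neq w x y : x != re w \/ y != im w -> zp x y != w.
Proof.
by move=> h; apply/eqP => e; move: h; rewrite -e re_zp im_zp !eqxx => -[].
Qed.

(** Two vertical and two horizontal cuts isolate the small square around w; g is holomorphic on the
    four rectangles cut off, and [goursat] removes them. *)
Lemma rint_puncture g a b c d w eta : 0 < eta ->
  a < re w - eta -> re w + eta < b -> c < im w - eta -> im w + eta < d ->
  (forall z, a <= re z <= b -> c <= im z <= d -> z != w -> hol1 g z) ->
  rint g a b c d =
  rint g (re w - eta) (re w + eta) (im w - eta) (im w + eta).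
Proof.
move=> e0; set u := re w; set v := im w => au ub cv vd hg.
have hg' x y : a <= x <= b -> c <= y <= d -> x != u \/ y != v -> hol1 g (zp x y).
  by move=> hx hy h; apply: hg; rewrite ?re_zp ?im_zp//; exact: zp_neq.
have cg x y : a <= x <= b -> c <= y <= d -> x != u \/ y != v -> ccts g (zp x y).
  by move=> hx hy h; apply/hol1_ccts/hg'.
have [a1 a2 a3 a4] : [/\ u - eta < u, u < u + eta, v - eta < v & v < v + eta].
  by split; lra.
have cc : c <= c <= d by rewrite lexx; lra.
have dd : c <= d <= d by rewrite lexx; lra.
have nc t : a <= t <= b -> ccts g (zp t c) /\ ccts g (zp t d).
  move=> tt; split; apply: cg => //; right; rewrite neq_lt.
    by rewrite (lt_trans cv).
  by rewrite (lt_trans a4) ?orbT.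
have am : a <= u - eta <= b by apply/andP; split; lra.
have am2 : u - eta <= u + eta <= b by apply/andP; split; lra.
rewrite (rint_cutv am nc).
rewrite (rint_cutv am2); last first.
  by move=> t /andP[t1 t2]; apply: nc; rewrite t2 andbT; lra.
have -> : rint g a (u - eta) c d = 0.
  apply: goursat; [lra|lra|] => x y /andP[x1 x2] hy; apply: hg' => //.
    by rewrite x1 /=; lra.
  by left; rewrite lt_eqF//; lra.
have -> : rint g (u + eta) b c d = 0.
  apply: goursat; [lra|lra|] => x y /andP[x1 x2] hy; apply: hg' => //.
    by rewrite x2 andbT; lra.
  by left; rewrite gt_eqF//; lra.
rewrite add0r addr0.
have nv t : c <= t <= d -> ccts g (zp (u - eta) t) /\ ccts g (zp (u + eta) t).
  move=> tt; split; apply: cg => //; try (apply/andP; split; lra); left.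
    by rewrite lt_eqF.
  by rewrite gt_eqF.
have cm : c <= v - eta <= d by apply/andP; split; lra.
have cm2 : v - eta <= v + eta <= d by apply/andP; split; lra.
rewrite (rint_cuth cm nv) (rint_cuth cm2); last first.
  by move=> t /andP[t1 t2]; apply: nv; rewrite t2 andbT; lra.
have xx x : u - eta <= x <= u + eta -> a <= x <= b.
  by move=> /andP[x1 x2]; apply/andP; split; lra.
have -> : rint g (u - eta) (u + eta) c (v - eta) = 0.
  apply: goursat; [lra|lra|] => x y /xx hx /andP[y1 y2]; apply: hg' => //.
    by rewrite y1 /=; lra.
  by right; rewrite lt_eqF//; lra.
have -> : rint g (u - eta) (u + eta) (v + eta) d = 0.
  apply: goursat; [lra|lra|] => x y /xx hx /andP[y1 y2]; apply: hg' => //.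
    by rewrite y2 andbT; lra.
  by right; rewrite gt_eqF//; lra.
by rewrite add0r addr0.
Qed.

End Cauchy.

(** * The integral of 1 / (z - w) and the Cauchy formula on a square *)

Section Cauchy.
Variable R : realType.
Local Notation C := (Cplx R).
Implicit Types (a b c d t s x y M u v eta : R) (f g : C -> C) (z w D : C).

Lemma is_derive_kap u eta t : 0 < eta ->
  is_derive t (1 : R) (fun t : R => 2 * atan ((t - u) / eta)) (2 * eta / ((t - u) ^+ 2 + eta ^+ 2)).
Proof.
move=> e0; apply: is_derive_eq; rewrite /= -?[_ *: _]/(_ * _).
rewrite mulr0 add0r subr0 mulr1.
have e1 : eta != 0 by rewrite gt_eqF.
have e2 : (t - u) ^+ 2 + eta ^+ 2 != 0.
  by rewrite gt_eqF// ltr_wpDl ?sqr_ge0// exprn_gt0.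
have -> : 1 + ((t - u) / eta) ^+ 2 = ((t - u) ^+ 2 + eta ^+ 2) / eta ^+ 2.
  by rewrite expr_div_n; field.
by field; rewrite e1 e2.
Qed.

Lemma inv_zp x y : x != 0 \/ y != 0 -> (zp x y)^-1 =
  zp (x / (x ^+ 2 + y ^+ 2)) (- y / (x ^+ 2 + y ^+ 2)).
Proof.
move=> xy.
have n0 : x ^+ 2 + y ^+ 2 != 0.
  by apply: contraPneq xy => /eqP; rewrite paddr_eq0 ?sqr_ge0// !sqrf_eq0 => /andP[/eqP -> /eqP ->] []; rewrite eqxx.
apply: (@mulfI _ (zp x y)).
  apply/eqP => /[dup] /(congr1 (@re R)); rewrite re_zp re0 => ex /(congr1 (@im R)).
  by rewrite im_zp im0 => ey; move: xy; rewrite ex ey eqxx => -[].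
rewrite divff; last first.
  apply/eqP => /[dup] /(congr1 (@re R)); rewrite re_zp re0 => ex /(congr1 (@im R)).
  by rewrite im_zp im0 => ey; move: xy; rewrite ex ey eqxx => -[].
by apply: re_im_eq; rewrite !(reM, imM, re_zp, im_zp) ?re1 ?im1; field.
Qed.

Lemma zp_sub x y w : zp x y - w = zp (x - re w) (y - im w).
Proof. by rewrite [in LHS](zpE w) /zp !cRB; ring. Qed.

(* The two horizontal sides of a square taken together: the integrand is
   2 i eta / ((t - y)^2 + eta^2), with an atan as primitive. *)
Lemma kap_integral w eta y : 0 < eta ->
  cint (y - eta) (y + eta) (fun t => (zp (t - y) (- eta))^-1 - (zp (t - y) eta)^-1)
  = ci R * cR pi.
Proof.
move=> e0; have e1 : eta != 0 by rewrite gt_eqF.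
have qE t : (zp (t - y) (- eta))^-1 - (zp (t - y) eta)^-1 =
   zp 0 (2 * eta / ((t - y) ^+ 2 + eta ^+ 2)).
  rewrite !inv_zp ?oppr_eq0; try by right.
  rewrite sqrrN; apply: re_im_eq; rewrite ?reB ?imB ?re_zp ?im_zp ?subrr//.
  by rewrite opprK mulNr opprK -mulrDl mulr_natl mulr2n.
have cgd : cgood (y - eta) (y + eta)
    (fun t => (zp (t - y) (- eta))^-1 - (zp (t - y) eta)^-1).
  move=> t _; have H e : e != 0 -> gcont (fun t => (zp (t - y) e)^-1) t.
    move=> en0 ep /(@hol1_ccts _ (fun z => (z - zp y (- e))^-1) (zp t 0)) h.
    have /h[] : hol1 (fun z => (z - zp y (- e))^-1) (zp t 0).
      apply: hol1_inv; apply/eqP => /(congr1 (@im R)); rewrite !im_zp => /eqP.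
      by rewrite eq_sym oppr_eq0 (negbTE en0).
    move=> d d0 hd; exists d => // s st.
    have := hd (cR (s - t)); rewrite cabs_cR => /(_ st).
    have -> : zp t 0 + cR (s - t) = zp s 0 by rewrite /zp !cRB; ring.
    by rewrite !zp_sub !re_zp !im_zp !sub0r opprK.
  by apply: gcontD; [apply: H; rewrite oppr_eq0|apply: gcontN; exact: H].
rewrite /cint (@rI_ext _ _ _ (fun t => re _) (fun=> 0)); last first.
  by move=> t _; rewrite qE re_zp.
rewrite rI_cst; last by lra.
rewrite mul0r cR0 add0r; congr (_ * cR _).
have cgi := cgood_im cgd.
rewrite (@rI_ext _ _ _ _ (fun t => 2 * eta / ((t - y) ^+ 2 + eta ^+ 2))); last first.
  by move=> t _; rewrite qE im_zp.
rewrite (rI_FTC _ _ (fun t => is_derive_kap y t e0)).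
- rewrite addrAC subrr add0r divff// addrAC subrr add0r mulNr divff// atanN atan1.
  by field.
- by lra.
- move=> t /cgi; rewrite (_ : (fun t0 => im _) =
    (fun t => 2 * eta / ((t - y) ^+ 2 + eta ^+ 2)))//.
  by apply/funext => r; rewrite qE im_zp.
Qed.

(* The integral of 1 / (z - w) along a square around w. *)
Definition kap : C := 2%:R * (ci R * cR pi).

(** The horizontal sides give i pi by [kap_integral]. Since i / (r + i y) = 1 / (y - i r), the
    factor i of the vertical sides turns them into the same integral. *)
Lemma kap_small w eta : 0 < eta ->
  rint (fun z => (z - w)^-1) (re w - eta) (re w + eta) (im w - eta) (im w + eta) = kap.
Proof.
move=> e0; set u := re w; set v := im w.
have hb : onb (ccts (fun z => (z - w)^-1)) (u - eta) (u + eta) (v - eta) (v + eta).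
  split=> t _; split; apply/hol1_ccts/hol1_inv; apply: zp_neq.
  - by right; rewrite lt_eqF// gtrDl oppr_lt0.
  - by right; rewrite gt_eqF// ltrDl.
  - by left; rewrite lt_eqF// gtrDl oppr_lt0.
  - by left; rewrite gt_eqF// ltrDl.
have [g1 g2 g3 g4] := bgoodP hb.
have ci0 : ci R != 0 by rewrite -cabs_gt0 cabs_ci.
rewrite /rint.
have E1 : cint (u - eta) (u + eta) (fun t => (zp t (v - eta) - w)^-1) -
    cint (u - eta) (u + eta) (fun t => (zp t (v + eta) - w)^-1) = ci R * cR pi.
  rewrite -cintB// -(kap_integral w u e0); apply: cint_ext => t _.
  by rewrite !zp_sub -/u -/v; congr ((zp _ _)^-1 - (zp _ _)^-1); ring.
have E2 : ci R * (cint (v - eta) (v + eta) (fun t => (zp (u + eta) t - w)^-1) -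
    cint (v - eta) (v + eta) (fun t => (zp (u - eta) t - w)^-1)) = ci R * cR pi.
  rewrite -cintB// -cintZ; last first.
    by move=> t tt; apply: gcontD; [exact: g4|apply: gcontN; exact: g3].
  rewrite -(kap_integral w v e0); apply: cint_ext => t _.
  have H r y : ci R * (zp r y)^-1 = (zp y (- r))^-1.
    have -> : zp r y = ci R * zp y (- r).
      by apply: re_im_eq; rewrite !(reM, imM, re_zp, im_zp, re_ci, im_ci); ring.
    by rewrite invfM mulrA divff// mul1r.
  rewrite mulrBr !zp_sub -/u -/v !H.
  by congr ((zp _ _)^-1 - (zp _ _)^-1); ring.
rewrite /kap mulr_natl mulr2n -{1}E1 -E2.
by clear; do ![move: (cint _ _ _) => ?]; ring.
Qed.

Lemma cabs_kap_ge1 : 1 <= cabs kap.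
Proof.
rewrite /kap !cabsM cabs_ci mul1r cabs_n cabs_cR ger0_norm ?pi_ge0//.
have := pi_ge2 R; lra.
Qed.

Lemma kap_neq0 : kap != 0.
Proof. by rewrite -cabs_gt0 (lt_le_trans ltr01 cabs_kap_ge1). Qed.

Definition sq s z := `|re z| <= s /\ `|im z| <= s.

Lemma sq_zp s x y : - s <= x <= s -> - s <= y <= s -> sq s (zp x y).
Proof. by move=> hx hy; split; rewrite ?re_zp ?im_zp ler_norml. Qed.

Lemma onb_sq (P : C -> Prop) s : 0 < s ->
  (forall z, sq s z -> s <= cabs z -> P z) -> onb P (- s) s (- s) s.
Proof.
move=> s0 h.
have A x y : - s <= x <= s -> `|y| = s -> P (zp x y).
  move=> hx hy; apply: h.
    by apply: sq_zp => //; rewrite -ler_norml hy.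
  by rewrite -hy -[y in leLHS](im_zp x) im_le_cabs.
have B x y : - s <= y <= s -> `|x| = s -> P (zp x y).
  move=> hx hy; apply: h.
    by apply: sq_zp => //; rewrite -ler_norml hy.
  by rewrite -hy -[x in leLHS](re_zp x y) re_le_cabs.
split=> t tt; split.
- by apply: A => //; rewrite normrN gtr0_norm.
- by apply: A => //; rewrite gtr0_norm.
- by apply: B => //; rewrite normrN gtr0_norm.
- by apply: B => //; rewrite gtr0_norm.
Qed.

(** The contour shrinks to a square of half-side eta around w. There f(z) / (z - w) splits into f(w)
    / (z - w) and a difference quotient bounded by B, whose integral is O(eta). *)
Lemma cauchy_formula f s w : cabs w < s -> (forall z, sq s z -> hol1 f z) ->
  rint (fun z => f z * (z - w)^-1) (- s) s (- s) s = f w * kap.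
Proof.
move=> ws hf.
have s0 : 0 < s by apply: le_lt_trans ws; exact: cabs_ge0.
have hol z : z != w -> sq s z -> hol1 (fun z => f z * (z - w)^-1) z.
  by move=> zw sz; apply: hol1M; [exact: hf|exact: hol1_inv].
set F := fun z => _.
have rw := le_lt_trans (re_le_cabs w) ws; have iw := le_lt_trans (im_le_cabs w) ws.
move: (rw) (iw); rewrite !ltr_norml => /andP[rw1 rw2] /andP[iw1 iw2].
have sw : sq s w by split; exact: ltW.
have [D hD] := hf w sw.
have [dl dl0 hdl] := hD 1 ltr01.
pose B := cabs D + 1.
have B0 : 0 < B by rewrite ltr_wpDl ?cabs_ge0.
pose m := Num.min (Num.min (s - `|re w|) (s - `|im w|)) dl.
have m0 : 0 < m by rewrite !lt_min !subr_gt0 rw iw.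
apply/eqP; rewrite -subr_eq0 -cabs_eq0 eq_le cabs_ge0 andbT.
apply/ler_addgt0Pr => e e0; rewrite add0r.
(* The bound m/3 keeps the small square inside the large one and within distance [dl] of w; the
   other bound makes the error 4 B (4 eta) at most e. *)
pose eta := Num.min (m / 3) (e / (16 * B)).
have eta0 : 0 < eta by rewrite lt_min !divr_gt0// mulr_gt0.
have eta1 : eta <= m / 3 by rewrite ge_min lexx.
have eta2 : 16 * B * eta <= e.
  by rewrite mulrC -ler_pdivlMr ?mulr_gt0// ge_min lexx orbT.
have m1 : m <= s - `|re w| by rewrite !ge_min lexx.
have m2 : m <= s - `|im w| by rewrite !ge_min lexx orbT.
have m3 : m <= dl by rewrite !ge_min lexx orbT.
clearbody eta m.
have [r1 r2] : re w <= `|re w| /\ - re w <= `|re w| by split; rewrite ?ler_norm// -normrN ler_norm.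
have [i1 i2] : im w <= `|im w| /\ - im w <= `|im w| by split; rewrite ?ler_norm// -normrN ler_norm.
have [p1 p2 p3 p4] : [/\ - s < re w - eta, re w + eta < s, - s < im w - eta & im w + eta < s].
  by split; lra.
rewrite (rint_puncture eta0 p1 p2 p3 p4); last first.
  by move=> z z1 z2 zw; apply: hol => //; split; rewrite ler_norml.
rewrite -(kap_small w eta0).
set u := re w in p1 p2 *; set v := im w in p3 p4 *.
have bnd (P : C -> Prop) : (forall x y, u - eta <= x <= u + eta -> v - eta <= y <= v + eta ->
     zp x y != w -> P (zp x y)) -> onb P (u - eta) (u + eta) (v - eta) (v + eta).
  have u1 : u - eta <= u - eta <= u + eta by rewrite lexx; lra.
  have u2 : u - eta <= u + eta <= u + eta by rewrite lexx; lra.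
  have v1 : v - eta <= v - eta <= v + eta by rewrite lexx; lra.
  have v2 : v - eta <= v + eta <= v + eta by rewrite lexx; lra.
  move=> hP; split=> t tt; split; apply: hP => //; apply: zp_neq.
  - by right; rewrite lt_eqF// gtrDl oppr_lt0.
  - by right; rewrite gt_eqF// ltrDl.
  - by left; rewrite lt_eqF// gtrDl oppr_lt0.
  - by left; rewrite gt_eqF// ltrDl.
have sqz x y : u - eta <= x <= u + eta -> v - eta <= y <= v + eta -> sq s (zp x y).
  by move=> /andP[x1 x2] /andP[y1 y2]; apply: sq_zp; apply/andP; split; lra.
have cI : onb (ccts (fun z => (z - w)^-1)) (u - eta) (u + eta) (v - eta) (v + eta).
  by apply: bnd => x y _ _ h; apply/hol1_ccts/hol1_inv.
pose g z := (f z + - f w) * (z - w)^-1.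
have cg : onb (ccts g) (u - eta) (u + eta) (v - eta) (v + eta).
  apply: bnd => x y hx hy h; apply: hol1_ccts; apply: hol1M; last exact: hol1_inv.
  have [D' hD'] := hf _ (sqz _ _ hx hy); exists D' => e' /hD'[d' d'0 h'].
  exists d' => // h0 /h'; congr (cabs _ <= _); ring.
have cw : onb (ccts (fun z => f w * (z - w)^-1)) (u - eta) (u + eta) (v - eta) (v + eta).
  apply: bnd => x y hx hy h; apply: hol1_ccts; apply: hol1M; last exact: hol1_inv.
  exact: hol1_cst.
have -> : rint F (u - eta) (u + eta) (v - eta) (v + eta) =
  rint g (u - eta) (u + eta) (v - eta) (v + eta) +
  f w * rint (fun z => (z - w)^-1) (u - eta) (u + eta) (v - eta) (v + eta).
  rewrite -rintZ// -rintD//; apply: rint_ext; apply: bnd => x y _ _ _.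
  by rewrite /F /g mulrDl mulNr subrK.
rewrite addrK.
have gb : onb (fun z => cabs (g z) <= B) (u - eta) (u + eta) (v - eta) (v + eta).
  apply: bnd => x y hx hy zw.
  have dz : cabs (zp x y - w) < dl.
    apply: (@le_lt_trans _ _ (eta + eta)); last by lra.
    rewrite {1}(zpE w); apply: zp_bound; rewrite ler_distlC -/u -/v.
      by move: hx => /andP[x1 x2]; apply/andP; split; lra.
    by move: hy => /andP[x1 x2]; apply/andP; split; lra.
  have zz : w + (zp x y - w) = zp x y by rewrite addrC subrK.
  have := hdl _ dz; rewrite zz mul1r => h.
  have zw0 : 0 < cabs (zp x y - w) by rewrite cabs_gt0 subr_eq0.
  rewrite /g cabsM cabsV ler_pdivrMr//.
  have -> : f (zp x y) + - f w = (f (zp x y) - f w - D * (zp x y - w)) + D * (zp x y - w) by rewrite subrK.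
  apply: le_trans (cabsD _ _) _; rewrite cabsM /B [leRHS]mulrDl mul1r addrC lerD//.
have ue : u - eta <= u + eta by lra.
have ve : v - eta <= v + eta by lra.
have := rint_bound ue ve cg gb => h; apply: (le_trans h); clear - eta2 eta0 B0; lra.
Qed.
End Cauchy.

(** * Taylor coefficients *)

Section Expand.
Variable R : realType.
Local Notation C := (Cplx R).
Implicit Types (a b c d t s x y M : R) (f g : C -> C) (z w D : C).

Lemma hol1_pinv k z : z != 0 -> hol1 (fun z => z^-1 ^+ k) z.
Proof.
move=> z0; elim: k => [|k IH]; first exact: hol1_cst.
have h1 : hol1 (fun z => z^-1) z.
  by have := hol1_inv z0; congr (hol1 _ _); apply/funext => x; rewrite subr0.
by have := hol1M h1 IH; congr (hol1 _ _); apply/funext => x; rewrite exprS.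
Qed.

Lemma cabs_pinv s k z : 0 < s -> s <= cabs z -> cabs (z^-1 ^+ k) <= s ^- k.
Proof.
move=> s0 sz; rewrite cabsX cabsV -exprVn lerXn2r ?nnegrE ?invr_ge0 ?cabs_ge0 ?(ltW s0)//.
by rewrite lef_pV2 ?posrE// (lt_le_trans s0).
Qed.

Lemma neq0_le s z : 0 < s -> s <= cabs z -> z != 0.
Proof. by move=> s0 sz; rewrite -cabs_gt0 (lt_le_trans s0). Qed.

Definition mom s f k : C := rint (fun z => f z * z^-1 ^+ k.+1) (- s) s (- s) s.
(* The k-th Taylor coefficient of f at 0, from the square of half-side s. *)
Definition cf s f k : C := (kap R)^-1 * mom s f k.

Lemma ccts_mom s f k : 0 < s -> (forall z, sq s z -> s <= cabs z -> hol1 f z) ->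
  onb (ccts (fun z => f z * z^-1 ^+ k)) (- s) s (- s) s.
Proof.
move=> s0 hf; apply: onb_sq => // z sz sc; apply/hol1_ccts/hol1M; first exact: hf.
exact/hol1_pinv/(neq0_le s0 sc).
Qed.

Lemma rint_sq_bound s M f : 0 < s -> onb (ccts f) (- s) s (- s) s ->
  (forall z, sq s z -> s <= cabs z -> cabs (f z) <= M) ->
  cabs (rint f (- s) s (- s) s) <= 16 * s * M.
Proof.
move=> s0 cf h; have ss : - s <= s by lra.
have := rint_bound ss ss cf (onb_sq s0 h).
by move=> k; apply: le_trans k _; lra.
Qed.

Lemma cabs_kapV : cabs (kap R)^-1 <= 1.
Proof.
by rewrite cabsV invf_le1 ?cabs_kap_ge1// (lt_le_trans ltr01)// cabs_kap_ge1.
Qed.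

(** Cauchy's estimate; the constant 16 comes from [rint_sq_bound], and 1/(2 pi) is bounded by 1. *)
Lemma cf_bound s M f k : 0 < s -> onb (ccts (fun z => f z * z^-1 ^+ k.+1)) (- s) s (- s) s ->
  (forall z, sq s z -> s <= cabs z -> cabs (f z) <= M) -> 0 <= M ->
  cabs (cf s f k) <= 16 * M / s ^+ k.
Proof.
move=> s0 hc hM M0.
have h : cabs (mom s f k) <= 16 * s * (M * s ^- k.+1).
  apply: rint_sq_bound => // z sz sc; rewrite cabsM.
  by apply: ler_pM; rewrite ?cabs_ge0 ?cabs_pinv// hM.
rewrite /cf cabsM; apply: le_trans (_ : 1 * (16 * s * (M * s ^- k.+1)) <= _).
  by apply: ler_pM; rewrite ?cabs_ge0 ?cabs_kapV.
rewrite mul1r exprS invfM le_eqVlt; apply/orP; left; apply/eqP.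
by field; rewrite expf_neq0 gt_eqF.
Qed.

(** The Cauchy kernel is expanded N times by 1/(z - w) = 1/z + (w/z) / (z - w). The remainder [T N]
    is estimated on the boundary, where |z| >= s and |z - w| >= s - |w|. *)
Lemma cf_expand s M f w N : cabs w < s -> (forall z, sq s z -> hol1 f z) ->
  (forall z, sq s z -> cabs (f z) <= M) ->
  cabs (f w - \sum_(k < N) cf s f k * w ^+ k) <=
    16 * M * s / (s - cabs w) * (cabs w / s) ^+ N.
Proof.
move=> ws hf hM.
have s0 : 0 < s by apply: le_lt_trans ws; exact: cabs_ge0.
have sw0 : 0 < s - cabs w by rewrite subr_gt0.
pose T k := rint (fun z => f z * z^-1 ^+ k * (z - w)^-1) (- s) s (- s) s.
have zw z : s <= cabs z -> z != w.
  by move=> sz; apply/eqP => e; move: sz; rewrite e leNgt ws.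
have hT k : onb (ccts (fun z => f z * z^-1 ^+ k * (z - w)^-1)) (- s) s (- s) s.
  apply: onb_sq => // z sz sc; apply/hol1_ccts/hol1M; last exact/hol1_inv/zw.
  by apply: hol1M; [exact: hf|exact/hol1_pinv/(neq0_le s0 sc)].
have hm k := @ccts_mom s f k s0 (fun z sz _ => hf z sz).
have step k : T k = mom s f k + w * T k.+1.
  rewrite /T /mom -rintZ// -rintD//; last first.
    apply: onb_sq => // z sz sc; apply: hol1_ccts; apply: hol1M; first exact: hol1_cst.
    apply: hol1M; last exact/hol1_inv/zw.
    by apply: hol1M; [exact: hf|exact/hol1_pinv/(neq0_le s0 sc)].
  apply: rint_ext; apply: onb_sq => // z sz sc.
  have z0 := neq0_le s0 sc; have zw0 : z - w != 0 by rewrite subr_eq0 zw.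
  by rewrite exprS; field; rewrite zw0 z0.
have TN : T 0%N = \sum_(k < N) mom s f k * w ^+ k + w ^+ N * T N.
  elim: N => [|N IH]; first by rewrite big_ord0 add0r expr0 mul1r.
  by rewrite IH big_ord_recr /= step exprS; ring.
have T0 : T 0%N = f w * kap R.
  rewrite -(cauchy_formula ws hf); apply: rint_ext; apply: onb_sq => // z _ _.
  by rewrite expr0 mulr1.
have E : f w - \sum_(k < N) cf s f k * w ^+ k = (kap R)^-1 * (w ^+ N * T N).
  apply: (@mulIf _ (kap R)); first exact: kap_neq0.
  rewrite mulrBl -T0 TN mulr_suml.
  have -> : \sum_(k < N) cf s f k * w ^+ k * kap R = \sum_(k < N) mom s f k * w ^+ k.
    apply: eq_bigr => k _; rewrite /cf; field; exact: kap_neq0.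
  by rewrite addrAC subrr add0r; field; exact: kap_neq0.
have M0 : 0 <= M by apply: le_trans (hM 0 _); rewrite ?cabs_ge0//; split; rewrite ?re0 ?im0 normr0 ltW.
have TB : cabs (T N) <= 16 * s * (M * s ^- N * (s - cabs w)^-1).
  apply: rint_sq_bound => // z sz sc; rewrite !cabsM.
  apply: ler_pM; rewrite ?mulr_ge0 ?cabs_ge0//.
    by apply: ler_pM; rewrite ?cabs_ge0 ?cabs_pinv// hM.
  have zs : s - cabs w <= cabs (z - w).
    by have := cabsD (z - w) w; rewrite subrK; lra.
  by rewrite cabsV lef_pV2 ?posrE// (lt_le_trans sw0).
rewrite E cabsM; apply: le_trans (_ : 1 * (cabs w ^+ N * (16 * s * (M * s ^- N * (s - cabs w)^-1))) <= _).
  apply: ler_pM; rewrite ?cabs_ge0 ?cabs_kapV//.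
  by rewrite cabsM cabsX ler_wpM2l ?exprn_ge0 ?cabs_ge0.
rewrite mul1r expr_div_n le_eqVlt; apply/orP; left; apply/eqP.
by field; rewrite expf_neq0 ?(gt_eqF s0)//= gt_eqF.
Qed.

Lemma cf0 s M f : 0 < s -> (forall z, sq s z -> hol1 f z) ->
  (forall z, sq s z -> cabs (f z) <= M) -> cf s f 0 = f 0.
Proof.
move=> s0 hf hM; have := @cf_expand s M f 0 1; rewrite cabs0 => /(_ s0 hf hM).
rewrite big_ord1 expr0 mulr1 mul0r expr1 mulr0 => h.
by apply/esym/eqP; rewrite -subr_eq0 -cabs_eq0 eq_le h cabs_ge0.
Qed.

Lemma taylor2 s M f w : 0 < s -> cabs w <= s / 2 -> (forall z, sq s z -> hol1 f z) ->
  (forall z, sq s z -> cabs (f z) <= M) ->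
  cabs (f w - f 0 - w * cf s f 1) <= 32 * M / s ^+ 2 * cabs w ^+ 2.
Proof.
move=> s0 ws hf hM; have ws' : cabs w < s by lra.
have M0 : 0 <= M by apply: le_trans (hM 0 _); rewrite ?cabs_ge0//; split; rewrite ?re0 ?im0 normr0 ltW.
have := cf_expand 2 ws' hf hM.
rewrite big_ord_recl big_ord1 /= (cf0 s0 hf hM) expr0 mulr1 expr1 opprD addrA.
rewrite [_ * w]mulrC => h; apply: (le_trans h).
have sw : 0 < s - cabs w by lra.
have e : s / (s - cabs w) <= 2 by rewrite ler_pdivrMr//; lra.
have k0 : 0 <= 16 * M * (cabs w / s) ^+ 2 by apply: mulr_ge0; [rewrite mulr_ge0|exact: sqr_ge0].
apply: le_trans (_ : 16 * M * (cabs w / s) ^+ 2 * (s / (s - cabs w)) <= _).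
  by rewrite le_eqVlt; apply/orP; left; apply/eqP; ring.
apply: le_trans (ler_wpM2l k0 e) _.
rewrite le_eqVlt; apply/orP; left; apply/eqP.
by field; rewrite gt_eqF.
Qed.

Definition osq s z := `|re z| < s /\ `|im z| < s.

Lemma sq_osq s t z : s < t -> sq s z -> osq t z.
Proof. by move=> st [h1 h2]; split; exact: le_lt_trans st. Qed.

Lemma cctsM f g z : ccts f z -> ccts g z -> ccts (fun z => f z * g z) z.
Proof.
move=> hf hg e e0.
pose A := cabs (f z); pose B := cabs (g z).
have A0 : 0 <= A by exact: cabs_ge0.
have B0 : 0 <= B by exact: cabs_ge0.
pose k := Num.min 1 (e / (2 * (A + B + 1))).
have k0 : 0 < k by rewrite lt_min ltr01 divr_gt0//; lra.
have k1 : k <= 1 by rewrite ge_min lexx.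
have k2 : k * (2 * (A + B + 1)) <= e.
  by rewrite -ler_pdivlMr ?ge_min ?lexx ?orbT//; lra.
have [d1 d10 h1] := hf _ k0; have [d2 d20 h2] := hg _ k0.
exists (Num.min d1 d2); first by rewrite lt_min d10.
move=> s; rewrite lt_min => /andP[/h1 s1 /h2 s2].
have -> : f (z + s) * g (z + s) - f z * g z =
   (f (z + s) - f z) * (g (z + s) - g z) + (f (z + s) - f z) * g z + f z * (g (z + s) - g z) by ring.
rewrite (le_lt_trans (cabsD _ _))// (@le_lt_trans _ _ (k * k + k * B + A * k))//.
  apply: lerD; last by rewrite cabsM ler_wpM2l// ltW.
  rewrite (le_trans (cabsD _ _))// !cabsM lerD//.
    by apply: ler_pM; rewrite ?cabs_ge0// ltW.
  by rewrite ler_wpM2r// ltW.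
clearbody k; nra.
Qed.

(** G is a locally uniform limit of the quotients (F lam - F 0) / lam, each continuous at z; one
    small lam is enough for a given e. *)
Lemma param_ccts (F : C -> C -> C) (G : C -> C) (r K : R) (z : C) : 0 < r ->
  0 <= K ->
  (exists2 d, 0 < d & forall h lam, cabs h < d -> cabs lam < r ->
    cabs (F lam (z + h) - F 0 (z + h) - lam * G (z + h)) <= K * cabs lam ^+ 2) ->
  (forall lam, cabs lam < r -> ccts (F lam) z) -> ccts G z.
Proof.
move=> r0 K0 [d d0 hd] hF e e0.
pose l := Num.min (r / 2) (e / (4 * (K + 1))).
have K1 : 0 < 4 * (K + 1) by lra.
have l0 : 0 < l by rewrite lt_min !divr_gt0.
have lr : l <= r / 2 by rewrite ge_min lexx.
have le' : l * (4 * (K + 1)) <= e by rewrite -ler_pdivlMr// ge_min lexx orbT.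
clearbody l.
pose lam := cR l.
have cl : cabs lam = l by rewrite cabs_cR gtr0_norm.
have lamr : cabs lam < r by rewrite cl; lra.
have z0r : cabs (0 : C) < r by rewrite cabs0.
have lam0 : lam != 0 by rewrite -cabs_gt0 cl.
have e4 : 0 < e * l / 4 by rewrite divr_gt0 ?mulr_gt0.
have [d1 d10 h1] := hF _ lamr _ e4; have [d2 d20 h2] := hF _ z0r _ e4.
exists (Num.min d (Num.min d1 d2)); first by rewrite !lt_min d0 d10.
move=> h; rewrite !lt_min => /and3P[hh /h1 k1 /h2 k2].
have k3 := hd h lam hh lamr.
have := hd 0 lam; rewrite cabs0 addr0 => /(_ d0 lamr) k4.
rewrite -(ltr_pM2l l0) -{1}cl -cabsM.
have -> : lam * (G (z + h) - G z) =
  - (F lam (z + h) - F 0 (z + h) - lam * G (z + h)) +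
  (F lam z - F 0 z - lam * G z) + (F lam (z + h) - F lam z) - (F 0 (z + h) - F 0 z) by ring.
apply: le_lt_trans (cabsB _ _) _.
apply: le_lt_trans (lerD (cabsD _ _) (lexx _)) _.
apply: le_lt_trans (lerD (lerD (cabsD _ _) (lexx _)) (lexx _)) _.
rewrite cabsN; rewrite cl in k3 k4.
move: k1 k2 k3 k4; move: (cabs _) (cabs (F lam z - _ - _)) (cabs (F lam (z + h) - _)) (cabs (F 0 (z + h) - _)).
move=> q1 q2 q3 q4 k1 k2 k3 k4.
nra.
Qed.

(** Differentiation under the contour integral: a remainder K |lam|^2 uniform in z integrates to
    O(|lam|^2), so the derivative at 0 is the coefficient of G. *)
Lemma param_hol (F : C -> C -> C) (G : C -> C) (s s0 r K : R) k :
  0 < s -> s < s0 -> 0 < r -> 0 <= K ->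
  (forall z lam, osq s0 z -> cabs lam < r ->
    cabs (F lam z - F 0 z - lam * G z) <= K * cabs lam ^+ 2) ->
  (forall z lam, osq s0 z -> cabs lam < r -> ccts (F lam) z) ->
  hol1 (fun lam => cf s (F lam) k) 0.
Proof.
move=> s1 ss r0 K0 hb hc.
have s00 : 0 < s0 by lra.
have rr0 : cabs (0 : C) < r by rewrite cabs0.
have hG z : sq s z -> ccts G z.
  move=> [z1 z2]; have osz : osq s0 z by split; lra.
  apply: (param_ccts r0 K0) => [|lam lr]; last exact: (hc z lam osz lr).
  exists (s0 - s); first by rewrite subr_gt0.
  move=> h lam hh lr; apply: hb => //; split.
    by rewrite reD (le_lt_trans (ler_normD _ _))//; have := re_le_cabs h; lra.
  by rewrite imD (le_lt_trans (ler_normD _ _))//; have := im_le_cabs h; lra.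
have cp z : sq s z -> s <= cabs z -> ccts (fun z => z^-1 ^+ k.+1) z.
  by move=> _ sc; exact/hol1_ccts/hol1_pinv/(neq0_le s1 sc).
have cF lam : cabs lam < r -> onb (ccts (fun z => F lam z * z^-1 ^+ k.+1)) (- s) s (- s) s.
  move=> lr; apply: onb_sq => // z sz sc; apply: cctsM; last exact: cp.
  by apply: hc => //; apply: sq_osq ss sz.
have cG : onb (ccts (fun z => G z * z^-1 ^+ k.+1)) (- s) s (- s) s.
  by apply: onb_sq => // z sz sc; apply: cctsM; [exact: hG|exact: cp].
exists (cf s G k) => e e0.
pose B := 16 * (K + 1) / s ^+ k.
have B0 : 0 < B by rewrite divr_gt0 ?exprn_gt0// mulr_gt0//; lra.
exists (Num.min r (e / B)); first by rewrite lt_min r0 divr_gt0.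
move=> lam; rewrite lt_min add0r => /andP[lr le'].
rewrite ltr_pdivlMr// mulrC in le'.
pose E z := F lam z + (-1) * F 0 z + (- lam) * G z.
have Eb z : sq s z -> s <= cabs z -> cabs (E z) <= (K + 1) * cabs lam ^+ 2.
  move=> sz _; have := hb z lam (sq_osq ss sz) lr.
  rewrite /E mulN1r mulNr => h; apply: le_trans h _.
  by rewrite ler_wpM2r ?sqr_ge0//; lra.
have EE : cf s (F lam) k - cf s (F 0) k - cf s G k * lam = cf s E k.
  rewrite /cf /mom.
  have -> : rint (fun z => E z * z^-1 ^+ k.+1) (- s) s (- s) s =
     rint (fun z => F lam z * z^-1 ^+ k.+1) (- s) s (- s) s +
     (-1) * rint (fun z => F 0 z * z^-1 ^+ k.+1) (- s) s (- s) s +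
     (- lam) * rint (fun z => G z * z^-1 ^+ k.+1) (- s) s (- s) s.
    have cZ (c : C) f : onb (ccts f) (- s) s (- s) s -> onb (ccts (fun z => c * f z)) (- s) s (- s) s.
      move=> [h1 h2]; split=> t tt; split; apply: cctsM; try exact/hol1_ccts/hol1_cst.
      - by case: (h1 t tt).
      - by case: (h1 t tt).
      - by case: (h2 t tt).
      - by case: (h2 t tt).
    have cD f g : onb (ccts f) (- s) s (- s) s -> onb (ccts g) (- s) s (- s) s ->
        onb (ccts (fun z => f z + g z)) (- s) s (- s) s.
      move=> [h1 h2] [h3 h4]; split=> t tt; split; apply: cctsD.
      - by case: (h1 t tt).
      - by case: (h3 t tt).
      - by case: (h1 t tt).
      - by case: (h3 t tt).
      - by case: (h2 t tt).
      - by case: (h4 t tt).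
      - by case: (h2 t tt).
      - by case: (h4 t tt).
    rewrite -!rintZ//; try exact: cF; rewrite -rintD; last 2 first.
    - exact: cF.
    - exact/cZ/cF.
    rewrite -rintD; last 2 first.
    - by apply: cD; [exact: cF|exact/cZ/cF].
    - exact: cZ.
    apply: rint_ext; apply: onb_sq => // z _ _; rewrite /E; ring.
  by move: (rint _ _ _ _ _) (rint _ _ _ _ _) (rint _ _ _ _ _) => *; ring.
rewrite EE.
have cE : onb (ccts (fun z => E z * z^-1 ^+ k.+1)) (- s) s (- s) s.
  apply: onb_sq => // z sz sc; apply: cctsM; last exact: cp.
  have c1 := hc z lam (sq_osq ss sz) lr; have c2 := hc z 0 (sq_osq ss sz) rr0.
  apply: cctsD; last by apply: cctsM; [exact/hol1_ccts/hol1_cst|exact: hG].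
  by apply: cctsD => //; apply: cctsM => //; exact/hol1_ccts/hol1_cst.
have M0 : 0 <= (K + 1) * cabs lam ^+ 2 by rewrite mulr_ge0 ?sqr_ge0//; lra.
apply: le_trans (cf_bound s1 cE Eb M0) _.
apply: le_trans (_ : B * cabs lam * cabs lam <= _).
  by rewrite /B le_eqVlt; apply/orP; left; apply/eqP; ring.
by rewrite ler_wpM2r ?cabs_ge0// ltW.
Qed.
End Expand.

(** * Series of complex numbers *)

Section Seq.
Variable R : realType.
Local Notation C := (Cplx R).
Implicit Types (u v : nat -> C) (l : C) (M th : R).

Lemma geom_sum_le th N : 0 <= th < 1 -> \sum_(k < N) th ^+ k <= (1 - th)^-1.
Proof.
move=> /andP[t0 t1]; have t2 : 0 < 1 - th by rewrite subr_gt0.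
have E : (1 - th) * \sum_(k < N) th ^+ k = 1 - th ^+ N.
  elim: N => [|N IH]; first by rewrite big_ord0 mulr0 expr0 subrr.
  by rewrite big_ord_recr mulrDr IH exprS; ring.
by rewrite -(ler_pM2l t2) divff ?gt_eqF// E lerBlDr lerDl exprn_ge0.
Qed.

Lemma mul_geom_bound th : 0 <= th < 1 -> exists2 K, 0 <= K &
  forall m, m.+1%:R * th ^+ m <= K :> R.
Proof.
move=> /andP[]; rewrite le_eqVlt => /orP[/eqP <- _|t0 t1].
  by exists 1 => // -[|m]; rewrite ?expr0 ?mulr1// expr0n mulr0.
pose x := th^-1 - 1.
have x0 : 0 < x by rewrite subr_gt0 invf_gt1.
have B m : 1 + m%:R * x <= (1 + x) ^+ m.
  elim: m => [|m IH]; first by rewrite expr0 mul0r addr0.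
  rewrite exprS; apply: le_trans (ler_wpM2l _ IH); last by lra.
  rewrite -natr1; have : 0 <= m%:R * x ^+ 2 by rewrite mulr_ge0// sqr_ge0.
  by move: (m%:R) => q; lra.
exists (x^-1 + 1); first by rewrite addr_ge0// invr_ge0 ltW.
move=> m; have E : th = (1 + x)^-1 by rewrite /x addrC subrK invrK.
rewrite E exprVn ler_pdivrMr ?exprn_gt0//; last by lra.
have h := B m.
apply: le_trans (_ : (x^-1 + 1) * (1 + m%:R * x) <= _).
  rewrite -natr1 mulrDl mul1r mulrDr mulr1 mulrCA mulVf ?gt_eqF// mulr1.
  have : 0 <= x^-1 by rewrite invr_ge0 ltW.
  have : 0 <= m%:R * x by rewrite mulr_ge0// ltW.
  by move: (m%:R * x) (m%:R) => q q'; lra.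
by rewrite ler_wpM2l// addr_ge0// invr_ge0 ltW.
Qed.

(** With th = ps (th / ps), both factors below 1, one power of m+1 is absorbed by (th / ps)^m and
    the others, by induction, by ps^m. *)
Lemma poly_geom_bound k th : 0 <= th < 1 -> exists2 K, 0 <= K &
  forall m, m.+1%:R ^+ k * th ^+ m <= K :> R.
Proof.
elim: k th => [|k IH] th /andP[t0 t1].
  by exists 1 => // m; rewrite expr0 mul1r exprn_ile1// ltW.
pose ps := (1 + th) / 2.
have p0 : 0 < ps by rewrite /ps; lra.
have p1 : ps < 1 by rewrite /ps; lra.
have pt : th < ps by rewrite /ps; lra.
have [K1 K10 h1] : exists2 K, 0 <= K & forall m, m.+1%:R ^+ k * ps ^+ m <= K :> R.
  by apply: IH; rewrite ltW.
have [K2 K20 h2] : exists2 K, 0 <= K & forall m, m.+1%:R * (th / ps) ^+ m <= K :> R.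
  by apply: mul_geom_bound; apply/andP; split; [rewrite divr_ge0// ltW|rewrite ltr_pdivrMr ?mul1r].
exists (K1 * K2); first exact: mulr_ge0.
move=> m.
have -> : m.+1%:R ^+ k.+1 * th ^+ m = (m.+1%:R ^+ k * ps ^+ m) * (m.+1%:R * (th / ps) ^+ m) :> R.
  have pm : ps ^+ m != 0 by rewrite expf_neq0// gt_eqF.
  rewrite [m.+1%:R ^+ k.+1]exprS [(th / ps) ^+ m]exprMn exprVn.
  by clear -pm; move: (ps ^+ m) (th ^+ m) pm => a b pm; field.
have [q0 q1] := (ltW p0, divr_ge0 t0 (ltW p0)).
by apply: ler_pM => //; rewrite mulr_ge0// exprn_ge0.
Qed.

Lemma geom_small th M e : 0 <= th < 1 -> 0 < e -> exists N, forall k, (N <= k)%N ->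
  M * th ^+ k <= e.
Proof.
move=> /andP[t0 t1] e0.
have : `|th| < 1 by rewrite ger0_norm.
move=> /(@cvg_geometric R M) /cvgrPdist_le /(_ _ e0) [N _ h].
exists N => k /h /=; rewrite sub0r normrN => h'.
by apply: le_trans h'; exact: ler_norm.
Qed.

Lemma ngeom_small th M e : 0 <= th < 1 -> 0 < e -> exists N, forall k, (N <= k)%N ->
  M * k%:R * th ^+ k <= e.
Proof.
move=> /andP[t0 t1] e0; have [M0|M0] := leP M 0.
  exists 0%N => k _; apply: le_trans (ltW e0).
  by rewrite mulr_le0_ge0 ?exprn_ge0// mulr_le0_ge0.
pose ps := (1 + th) / 2.
have p0 : 0 < ps by rewrite /ps; lra.
have p1 : ps < 1 by rewrite /ps; lra.
have pt : th < ps by rewrite /ps; lra.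
have [K2 K20 h2] : exists2 K, 0 <= K & forall m, m.+1%:R * (th / ps) ^+ m <= K :> R.
  by apply: mul_geom_bound; apply/andP; split; [rewrite divr_ge0// ltW|rewrite ltr_pdivrMr ?mul1r].
have [N hN] : exists N, forall k, (N <= k)%N -> (M * K2) * ps ^+ k <= e.
  by apply: geom_small => //; rewrite ltW.
exists N => k /hN h; apply: le_trans h.
have -> : M * k%:R * th ^+ k = M * (k%:R * (th / ps) ^+ k) * ps ^+ k.
  have pm : ps ^+ k != 0 by rewrite expf_neq0// gt_eqF.
  rewrite [(th / ps) ^+ k]exprMn exprVn.
  by clear -pm; move: (ps ^+ k) (th ^+ k) pm => a b pm; field.
rewrite ler_wpM2r ?exprn_ge0 ?(ltW p0)// ler_wpM2l ?(ltW M0)//.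
apply: le_trans (h2 k); apply: ler_wpM2r; last by rewrite ler_nat.
by rewrite exprn_ge0// divr_ge0// ltW.
Qed.

Definition ctends u l := forall e, 0 < e -> exists N, forall k, (N <= k)%N ->
  cabs (u k - l) <= e.

Lemma ctends_uniq u l l' : ctends u l -> ctends u l' -> l = l'.
Proof.
move=> h h'; apply/eqP; rewrite -subr_eq0 -cabs_eq0 eq_le cabs_ge0 andbT.
apply/ler_addgt0Pr => e e0; rewrite add0r.
have e2 : 0 < e / 2 by rewrite divr_gt0.
have [N hN] := h _ e2; have [N' hN'] := h' _ e2.
have k1 := hN _ (leq_maxl N N'); have k2 := hN' _ (leq_maxr N N').
have -> : l - l' = - (u (maxn N N') - l) + (u (maxn N N') - l') by ring.
apply: le_trans (cabsD _ _) _; rewrite cabsN [leRHS](splitr e); exact: lerD.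
Qed.

Lemma ctendsD u v l l' : ctends u l -> ctends v l' ->
  ctends (fun k => u k + v k) (l + l').
Proof.
move=> h h' e e0; have e2 : 0 < e / 2 by rewrite divr_gt0.
have [N hN] := h _ e2; have [N' hN'] := h' _ e2.
exists (maxn N N') => k; rewrite geq_max => /andP[/hN k1 /hN' k2].
rewrite opprD addrACA; apply: le_trans (cabsD _ _) _.
rewrite [leRHS](splitr e); exact: lerD.
Qed.

Lemma ctendsZ c u l : ctends u l -> ctends (fun k => c * u k) (c * l).
Proof.
move=> h e e0; have c1 : 0 < cabs c + 1 by rewrite ltr_wpDl ?cabs_ge0.
have [N hN] := h _ (divr_gt0 e0 c1).
exists N => k /hN k1; rewrite -mulrBr cabsM.
apply: le_trans (_ : (cabs c + 1) * (e / (cabs c + 1)) <= _).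
  by apply: ler_pM; rewrite ?cabs_ge0// lerDl.
by rewrite mulrC divfK// gt_eqF.
Qed.

Lemma ctends_ext u v l : (forall k, u k = v k) -> ctends u l -> ctends v l.
Proof. by move=> /funext ->. Qed.

Lemma ctends_eventually u v l N0 : (forall k, (N0 <= k)%N -> u k = v k) ->
  ctends u l -> ctends v l.
Proof.
move=> E h e /h[N hN]; exists (maxn N N0) => k.
by rewrite geq_max => /andP[/hN k1 /E <-].
Qed.

Lemma ctends_cst l : ctends (fun=> l) l.
Proof. by move=> e e0; exists 0%N => k _; rewrite subrr cabs0 ltW. Qed.

Lemma ctends_shift u l : ctends u l -> ctends (fun k => u k.+1) l.
Proof. by move=> h e /h[N hN]; exists N => k k1; apply: hN; exact: leqW. Qed.

Lemma ctends_le u l B : ctends u l -> (forall k, cabs (u k) <= B) -> cabs l <= B.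
Proof.
move=> h hB; apply/ler_addgt0Pr => e /h[N /(_ N (leqnn N)) k].
have -> : l = u N - (u N - l) by ring.
apply: le_trans (cabsB _ _) _; exact: lerD.
Qed.

Definition psums u N : C := \sum_(k < N) u k.

Lemma geom_cvg u M th : 0 <= th < 1 -> (forall k, cabs (u k) <= M * th ^+ k) ->
  exists l, ctends (psums u) l.
Proof.
move=> /andP[t0 t1] hu.
have real_cvg (a : nat -> R) : (forall k, `|a k| <= M * th ^+ k) ->
    exists l : R, forall e, 0 < e -> exists N, forall k, (N <= k)%N ->
      `|\sum_(j < k) a j - l| <= e.
  move=> ha.
  have /normed_cvg/cvg_ex[/= l hl] : cvgn [normed series a].
    apply: (series_le_cvg _ _ ha) => //.
    - by move=> k; apply: le_trans (ha k); exact: normr_ge0.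
    - by apply: is_cvg_geometric_series; rewrite ger0_norm.
  exists l => e e0; move: hl => /cvgrPdist_le /(_ _ e0) [N _ hN].
  by exists N => k /hN; rewrite /= /series/= big_mkord distrC.
have [l1 h1] : exists l : R, forall e, 0 < e -> exists N, forall k, (N <= k)%N ->
      `|\sum_(j < k) re (u j) - l| <= e.
  by apply: (real_cvg (fun j => re (u j))) => k; apply: le_trans (hu k); exact: re_le_cabs.
have [l2 h2] : exists l : R, forall e, 0 < e -> exists N, forall k, (N <= k)%N ->
      `|\sum_(j < k) im (u j) - l| <= e.
  by apply: (real_cvg (fun j => im (u j))) => k; apply: le_trans (hu k); exact: im_le_cabs.
exists (cR l1 + ci R * cR l2) => e e0; have e2 : 0 < e / 2 by rewrite divr_gt0.
have [N1 k1] := h1 _ e2; have [N2 k2] := h2 _ e2.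
exists (maxn N1 N2) => k; rewrite geq_max => /andP[/k1 q1 /k2 q2].
apply: le_trans (cabs_le_reim _) _; rewrite [leRHS](splitr e).
apply: lerD; rewrite /psums.
  by rewrite reB re_sum !(reD, reM, re_cR, im_cR, re_ci, im_ci) mul0r mulr0 subrr addr0.
by rewrite imB im_sum !(imD, imM, re_cR, im_cR, re_ci, im_ci) mul0r mul1r !add0r.
Qed.

Lemma geom_tail u M th l N : 0 <= th < 1 -> (forall k, cabs (u k) <= M * th ^+ k) ->
  ctends (psums u) l -> cabs (l - psums u N) <= M * th ^+ N / (1 - th).
Proof.
move=> t01 hu hl; have /andP[t0 t1] := t01.
have M0 : 0 <= M by have := hu 0%N; rewrite expr0 mulr1; apply: le_trans; exact: cabs_ge0.
apply/ler_addgt0Pr => e /hl[N' hN'].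
have := hN' (N + N')%N (leq_addl _ _) => k1.
have -> : l - psums u N = - (psums u (N + N') - l) + (psums u (N + N') - psums u N) by ring.
apply: le_trans (cabsD _ _) _; rewrite cabsN [leRHS]addrC; apply: lerD => //.
rewrite /psums big_split_ord /= [_ + \sum_(i < N') _]addrC addrK.
apply: le_trans (cabs_sum _ _ _) _.
apply: le_trans (_ : \sum_(i < N') M * th ^+ N * th ^+ i <= _).
  by apply: ler_sum => i _; apply: le_trans (hu _) _; rewrite exprD mulrA.
rewrite -mulr_sumr ler_wpM2l ?mulr_ge0 ?exprn_ge0//.
exact: geom_sum_le.
Qed.

Lemma diag_sum (u : nat -> nat -> C) N :
  \sum_(j < N) \sum_(k < j.+1) u k (j - k)%N = \sum_(k < N) \sum_(m < N - k) u k m.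
Proof.
elim: N => [|N IH]; first by rewrite !big_ord0.
rewrite big_ord_recr /= IH [RHS]big_ord_recr /= [X in _ + X]big_ord_recr /= !subnn.
rewrite subSn// subnn big_ord1 addrA; congr (_ + _).
rewrite -big_split; apply: eq_bigr => k _ /=.
by rewrite subSn ?(ltnW (ltn_ord k))// big_ord_recr.
Qed.

(** The triangle k + m < N differs from the first N full rows by N tails, each at most M th^N / (1 -
    th), and N th^N tends to 0. *)
Lemma double_series (u : nat -> nat -> C) (U : nat -> C) V M th : 0 <= th < 1 ->
  (forall k m, cabs (u k m) <= M * th ^+ (k + m)) ->
  (forall k, ctends (psums (u k)) (U k)) -> ctends (psums U) V ->
  ctends (psums (fun j => \sum_(k < j.+1) u k (j - k)%N)) V.
Proof.
move=> t01 hu hU hV; have /andP[t0 t1] := t01.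
have M0 : 0 <= M by have := hu 0%N 0%N; rewrite expr0 mulr1; apply: le_trans; exact: cabs_ge0.
have t2 : 0 < 1 - th by rewrite subr_gt0.
have D N : cabs (psums (fun j => \sum_(k < j.+1) u k (j - k)%N) N - psums U N) <=
    M / (1 - th) * N%:R * th ^+ N.
  rewrite /psums diag_sum -sumrB; apply: le_trans (cabs_sum _ _ _) _.
  apply: le_trans (_ : \sum_(k < N) (M / (1 - th) * th ^+ N) <= _); last first.
    rewrite sumr_const card_ord -[_ *+ N]mulr_natl.
    by rewrite le_eqVlt; apply/orP; left; apply/eqP; ring.
  apply: ler_sum => k _; rewrite cabs_distC.
  have hk m : cabs (u k m) <= M * th ^+ k * th ^+ m by rewrite -mulrA -exprD.
  apply: le_trans (geom_tail (N - k) t01 hk (hU k)) _.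
  have <- : th ^+ k * th ^+ (N - k) = th ^+ N by rewrite -exprD subnKC ?(ltnW (ltn_ord k)).
  by rewrite le_eqVlt; apply/orP; left; apply/eqP; ring.
move=> e e0; have e2 : 0 < e / 2 by rewrite divr_gt0.
have [N1 h1] := hV _ e2; have [N2 h2] := ngeom_small (M / (1 - th)) t01 e2.
exists (maxn N1 N2) => k; rewrite geq_max => /andP[/h1 k1 /h2 k2].
rewrite -(subrK (psums U k) (psums _ k)) -addrA.
apply: le_trans (cabsD _ _) _; rewrite [leRHS](splitr e); apply: lerD => //.
exact: le_trans (D k) k2.
Qed.
End Seq.

(** * Power series in several variables *)

Section VecNorm.
Variables (R : realType) (n : nat).
Local Notation C := (Cplx R).
Local Notation X := 'cV[Cplx R]_n.
Implicit Types (z h : X) (t r : R).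

(** The norm on C^n has values in [Cplx R]; this is the same number in R, the largest modulus of a
    coordinate. *)
Definition vn h : R := re `|h|.

Lemma vn_norm h : `|h| = cR (vn h).
Proof.
have := normr_ge0 h; rewrite cR_ge0_le => /andP[/eqP i0 _].
by apply: re_im_eq; rewrite ?im_cR.
Qed.

Lemma vn_ge0 h : 0 <= vn h.
Proof. by have := normr_ge0 h; rewrite vn_norm cR_ge0_le => /andP[]. Qed.

Lemma cabs_vn h i : cabs (h i 0) <= vn h.
Proof.
rewrite -cR_le -vn_norm -norm_cabs -[`|h|]/(mx_norm h) mx_normE.
by rewrite -[leLHS]nngE num_le; exact: (le_bigmax _ _ (i, 0)).
Qed.

Lemma vn_le h t : 0 <= t -> (forall i, cabs (h i 0) <= t) -> vn h <= t.
Proof.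
move=> t0 H; have [E|N] := eqVneq (mx_norm h) 0.
  by rewrite -cR_le -vn_norm -[`|h|]/(mx_norm h) E -cR0 cR_le.
have [[i j] E] := mx_norm_neq0 N.
by rewrite -cR_le -vn_norm -[`|h|]/(mx_norm h) E /= norm_cabs cR_le (ord1 j).
Qed.

Lemma nbhs_vn (A : set X) z : nbhs z A <->
  exists2 d, 0 < d & forall h, vn h < d -> A (z + h).
Proof.
split=> [/nbhs_ballP[e /= e0 he]|[d d0 hd]].
  have [d d0 E] : exists2 d, 0 < d & e = cR d.
    move: e0; rewrite ltcE /= => /andP[/eqP i0 r0]; exists (re e) => //.
    by apply: re_im_eq; rewrite ?im_cR.
  exists d => // h hh; apply: he; rewrite -ball_normE /= opprD addNKr.
  by rewrite normrN vn_norm E cR_lt.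
apply/nbhs_ballP; exists (cR d); first by rewrite /= ltcE /= eqxx.
move=> y; rewrite -ball_normE /= vn_norm cR_lt => H.
by rewrite -(subrK z y) addrC; apply: hd; rewrite -opprB; move: H; rewrite /vn normrN.
Qed.

Definition cform (c : 'I_n -> C) (h : X) : C := \sum_j c j * h j 0.

Lemma cform_linear c : linear (cform c).
Proof.
move=> k x y; rewrite /cform scaler_sumr -big_split; apply: eq_bigr => j _ /=.
by rewrite !mxE mulrDr mulrCA.
Qed.
HB.instance Definition _ c := GRing.isLinear.Build C X C _ (cform c) (cform_linear c).

Lemma cabs_cform c h : cabs (cform c h) <= (\sum_j cabs (c j)) * vn h.
Proof.
apply: le_trans (cabs_sum _ _ _) _; rewrite mulr_suml; apply: ler_sum => j _.
by rewrite cabsM ler_wpM2l ?cabs_ge0// cabs_vn.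
Qed.

Lemma cform_continuous c : continuous (cform c).
Proof.
apply/bounded_linear_continuous/ex_bound.
exists (cR (\sum_j cabs (c j))); apply/nbhs_vn; exists 1 => // h h1.
rewrite /= add0r norm_cabs cR_le; apply: le_trans (cabs_cform _ _) _.
rewrite -[leRHS]mulr1 ler_wpM2l ?(ltW h1)//.
by apply: sumr_ge0 => j _; apply: cabs_ge0.
Qed.

Lemma diff_small f z e : differentiable f z -> 0 < e ->
  exists2 d, 0 < d & forall h, vn h < d ->
    cabs (f (z + h) - f z - 'd f z h) <= e * vn h.
Proof.
move=> /diff_locally /eqaddoP H e0.
have e1 : 0 < cR e by rewrite -cR0 cR_lt.
have /nbhs_vn[d d0 hd] := H _ e1.
exists d => // h /hd; rewrite add0r norm_cabs vn_norm -cRM cR_le.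
rewrite /= !fctE /=.
by congr (cabs _ <= _); rewrite opprD addrA (addrC h).
Qed.

(** Uniqueness of the differential identifies it with the form c, whose value at a basis vector is
    the partial derivative. *)
Lemma diff_form f z c : (forall e, 0 < e -> exists2 d, 0 < d & forall h, vn h < d ->
    cabs (f (z + h) - f z - cform c h) <= e * vn h) ->
  differentiable f z /\ forall j, partial j f z = c j.
Proof.
move=> H.
have O : f \o shift z = cst (f z) + cform c +o_ (0 : X) id.
  apply/eqaddoP => e; rewrite ltcE /= => /andP[/eqP i0 r0].
  have -> : e = cR (re e) by apply: re_im_eq; rewrite ?im_cR.
  have [d d0 hd] := H _ r0; apply/nbhs_vn; exists d => // h /hd h1.
  rewrite add0r norm_cabs vn_norm -cRM cR_le /= !fctE /=.
  by move: h1; congr (cabs _ <= _); rewrite opprD addrA (addrC h).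
have D := diff_unique (@cform_continuous c) O.
have df : differentiable f z.
  by apply/diff_locallyP; rewrite D; split => //; exact: cform_continuous.
split=> // j; rewrite /partial deriveE// D -[LHS]/(cform c (delta_mx j 0)) /cform (bigD1 j)//= big1 => [|i ij].
  by rewrite mxE !eqxx mulr1 addr0.
by rewrite mxE (negbTE ij) mulr0.
Qed.

End VecNorm.

(** * Taylor remainders of forms *)

Section PolyRem.
Variables (R : realType) (n : nat).
Local Notation C := (Cplx R).
Local Notation X := 'cV[Cplx R]_n.
Local Notation mp := (mpoly n C).
Local Notation hom := (@hom R n).
Local Notation mX := (@mX R n).
Implicit Types (z h : X) (f g : mp) (m : multinom n).

Lemma pevalD f g z : peval (f + g) z = peval f z + peval g z.
Proof. exact: mevalD. Qed.
Lemma pevalM f g z : peval (f * g) z = peval f z * peval g z.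
Proof. exact: mevalM. Qed.
Lemma pevalZ c f z : peval (c *: f) z = c * peval f z.
Proof. exact: mevalZ. Qed.
Lemma peval0 z : peval (0 : mp) z = 0.
Proof. exact: meval0. Qed.
Lemma peval1 z : peval (1 : mp) z = 1.
Proof. exact: meval1. Qed.
Lemma peval_sum (I : Type) (r : seq I) (P : pred I) (F : I -> mp) z :
  peval (\sum_(i <- r | P i) F i) z = \sum_(i <- r | P i) peval (F i) z.
Proof. exact: (big_morph (fun f => peval f z) (fun f g => pevalD f g z) (peval0 z)). Qed.
Lemma peval_mX i z : peval (mX i) z = z i 0.
Proof. by rewrite /peval /mX mevalXU. Qed.

Lemma mpolyX_mulmX d m : mdeg m = d.+1 -> exists i m', mdeg m' = d /\
  mpolyX C m = mX i * mpolyX C m'.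
Proof.
move=> md; have [i mi] : exists i, (0 < m i)%N.
  apply/existsP; move: md; apply: contra_eqT => /existsPn H.
  by rewrite mdegE big1// => i _; apply/eqP; rewrite -leqn0 leqNgt.
have E : mnm_add (mnm_sub m (mnm1 i)) (mnm1 i) = m.
  by apply: submK; apply/mnm_lepP => j; rewrite mnm1E; case: eqP => [<-|].
exists i, (mnm_sub m (mnm1 i)); split.
  by move: md; rewrite -{1}E mdegD mdeg1 addn1 => -[].
by rewrite -{1}E mpolyXD mulrC.
Qed.

Definition pgrad f z : 'I_n -> C := fun j => peval (mderiv j f) z.

Lemma cformD c c' h : cform (fun j => c j + c' j) h = cform c h + cform c' h :> C.
Proof. by rewrite /cform -big_split; apply: eq_bigr => j _; rewrite mulrDl. Qed.
Lemma cformZ k c h : cform (fun j => k * c j) h = k * cform c h :> C.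
Proof. by rewrite /cform mulr_sumr; apply: eq_bigr => j _; rewrite mulrA. Qed.

Lemma cform_pgrad_mX i f z h :
  cform (pgrad (mX i * f) z) h = h i 0 * peval f z + z i 0 * cform (pgrad f z) h.
Proof.
have -> : pgrad (mX i * f) z = fun j => (j == i)%:R * peval f z + z i 0 * pgrad f z j.
  apply/funext => j; rewrite /pgrad mderivM pevalD !pevalM peval_mX mderiv_mX.
  by congr (_ * _ + _); case: eqP => _; rewrite ?peval1 ?peval0.
rewrite cformD cformZ; congr (_ + _).
rewrite /cform (bigD1 i)//= eqxx big1 => [|j ji].
  by rewrite mul1r addr0 mulrC.
by rewrite (negbTE ji) !mul0r.
Qed.

Lemma pgrad0 z : cform (pgrad 0 z) =1 fun=> 0.
Proof.
move=> h; rewrite /cform big1// => j _; rewrite /pgrad.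
by rewrite -(scale0r 0) mderivZ scale0r peval0 mul0r.
Qed.
Lemma pgradD f g z h : cform (pgrad (f + g) z) h = cform (pgrad f z) h + cform (pgrad g z) h.
Proof.
by rewrite -cformD; congr cform; apply/funext => j; rewrite /pgrad mderivD pevalD.
Qed.
Lemma pgradZ c f z h : cform (pgrad (c *: f) z) h = c * cform (pgrad f z) h.
Proof.
by rewrite -cformZ; congr cform; apply/funext => j; rewrite /pgrad mderivZ pevalZ.
Qed.

Lemma peval_le d f z (t : R) : f \is hom d -> 0 <= t ->
  (forall i, cabs (z i 0) <= t) -> cabs (peval f z) <= nrm f * t ^+ d.
Proof. exact: meval_le. Qed.

Section Rem.
Variables (z h : X) (s t eta : R).
Hypotheses (s0 : 0 <= s) (e0 : 0 < eta) (t0 : 0 <= t) (te : t <= eta).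
Hypotheses (zs : forall i, cabs (z i 0) <= s) (hs : vn h <= t).

Let q := t / eta.
Let q0 : 0 <= q. Proof. by rewrite divr_ge0// ltW. Qed.
Let tq : t = q * eta. Proof. by rewrite /q divfK// gt_eqF. Qed.
Let hi i : cabs (h i 0) <= t. Proof. exact: le_trans (cabs_vn _ _) hs. Qed.

(** A majorant argument: the moduli are dominated by (s + q eta)^d, whose coefficients are
    nonnegative, so q <= 1 lets q, respectively q^2, come out of the terms of order at least 1,
    respectively 2. Adding one variable at a time, the first estimate feeds the second. *)
Lemma peval_shift_mono d m : mdeg m = d ->
  let f := mpolyX C m in
  cabs (peval f (z + h) - peval f z) <= q * (s + eta) ^+ d /\
  cabs (peval f (z + h) - peval f z - cform (pgrad f z) h) <= q ^+ 2 * (s + eta) ^+ d.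
Proof.
elim: d m => [|d IH] m md /=.
  have -> : m = mnm0 by apply/eqP; rewrite -mdeg_eq0 md.
  rewrite mpolyX0 !peval1 subrr cabs0 expr0 !mulr1; split => //.
  have -> : cform (pgrad 1 z) h = 0.
    rewrite /cform big1// => j _; rewrite /pgrad.
    by rewrite -mpolyC1 mderivC peval0 mul0r.
  by rewrite subr0 cabs0 exprn_ge0.
have [i [m' [m'd ->]]] := mpolyX_mulmX md; have [h1 h2] := IH _ m'd.
have h3 : cabs (peval (mpolyX C m') (z + h)) <= (s + eta) ^+ d.
  have H : mpolyX C m' \is hom d by rewrite -m'd; apply: hom_X.
  rewrite -[leRHS]mul1r -(nrmX R m'); apply: (peval_le H).
    by rewrite addr_ge0// ltW.
  move=> j; rewrite mxE; apply: le_trans (cabsD _ _) _; apply: lerD => //.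
  exact: le_trans te.
rewrite cform_pgrad_mX !pevalM !peval_mX mxE.
move: (peval _ (z + h)) (peval _ z) (cform _ h) h1 h2 h3 => a b c h1 h2 h3.
have S0 : 0 <= (s + eta) ^+ d by rewrite exprn_ge0// addr_ge0// ltW.
rewrite exprS; move: ((s + eta) ^+ d) S0 h1 h2 h3 => S S0 h1 h2 h3; split.
  have -> : (z i 0 + h i 0) * a - z i 0 * b = z i 0 * (a - b) + h i 0 * a by ring.
  apply: le_trans (cabsD _ _) _; rewrite !cabsM.
  apply: le_trans (_ : s * (q * S) + t * S <= _).
    by apply: lerD; apply: ler_pM; rewrite ?cabs_ge0.
  by rewrite tq le_eqVlt; apply/orP; left; apply/eqP; ring.
have -> : (z i 0 + h i 0) * a - z i 0 * b - (h i 0 * b + z i 0 * c) =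
  z i 0 * (a - b - c) + h i 0 * (a - b) by ring.
apply: le_trans (cabsD _ _) _; rewrite !cabsM.
apply: le_trans (_ : s * (q ^+ 2 * S) + t * (q * S) <= _).
  by apply: lerD; apply: ler_pM; rewrite ?cabs_ge0.
by rewrite {1}tq le_eqVlt; apply/orP; left; apply/eqP; ring.
Qed.

(** The bound is quadratic in h with a rate (s + eta)^d independent of h, so the remainders of all
    degrees can be summed. *)
Lemma peval_taylor d f : f \is hom d ->
  cabs (peval f (z + h) - peval f z - cform (pgrad f z) h)
    <= nrm f * (s + eta) ^+ d * (t / eta) ^+ 2.
Proof.
move=> /dhomogP hf; rewrite {1 2 3}(mpolyE f).
pose D g := peval g (z + h) - peval g z - cform (pgrad g z) h.
have addE (a a' b b' c c' : C) :
  a + a' - (b + b') - (c + c') = (a - b - c) + (a' - b' - c') by ring.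
have scaleE (k a b c : C) : k * a - k * b - k * c = k * (a - b - c) by ring.
have DD g1 g2 : D (g1 + g2) = D g1 + D g2.
  apply: etrans (addE _ _ _ _ _ _).
  by congr (_ - _ - _); [exact: pevalD|exact: pevalD|exact: pgradD].
have D0 : D 0 = 0 by rewrite /D !peval0 pgrad0 !subr0.
have DZ c g : D (c *: g) = c * D g.
  apply: etrans (scaleE _ _ _ _).
  by congr (_ - _ - _); [exact: pevalZ|exact: pevalZ|exact: pgradZ].
rewrite -/(D _) (big_morph D DD D0); apply: le_trans (cabs_sum _ _ _) _.
rewrite nrmE mulrAC -mulrA mulr_suml big_seq [leRHS]big_seq; apply: ler_sum => m /hf /= md.
rewrite DZ cabsM ler_wpM2l ?cabs_ge0//.
by have [_] := peval_shift_mono md.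
Qed.
End Rem.
End PolyRem.

(** * Sums of forms: termwise derivatives and products *)

Section PowerSeries.
Variables (R : realType) (n : nat).
Local Notation C := (Cplx R).
Local Notation X := 'cV[Cplx R]_n.
Local Notation mp := (mpoly n C).
Local Notation hom := (@hom R n).
Local Notation mX := (@mX R n).
Implicit Types (z h : X) (r s t : R) (f g : X -> C) (F G : nat -> mp).

(** A bound at every radius below r rather than at r: derivatives and products lose powers of m,
    which a slightly larger radius absorbs. *)
Definition psb r F := (forall m, F m \is hom m) /\
  forall s, 0 < s < r -> exists M, forall m, nrm (F m) * s ^+ m <= M.

Definition psat F z l := ctends (psums (fun m => peval (F m) z)) l.

(* f is the sum on the polydisc of radius r of the forms F m. *)
Definition ps r f F := psb r F /\ forall z, vn z < r -> psat F z (f z).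

Lemma psb_term r F t : psb r F -> 0 <= t < r -> exists M th, 0 <= th < 1 /\
  forall z, vn z <= t -> forall m, cabs (peval (F m) z) <= M * th ^+ m.
Proof.
move=> [hF hb] /andP[t0 tr].
have s0 : 0 < (t + r) / 2 < r by apply/andP; split; lra.
have [M hM] := hb _ s0; have {s0}/andP[s0 s1] := s0.
exists M, (t / ((t + r) / 2)); split=> [|z zt m].
  by rewrite divr_ge0 ?(ltW s0)//= ltr_pdivrMr// mul1r; lra.
apply: le_trans (peval_le (hF m) t0 _) _.
  by move=> i; exact: le_trans (cabs_vn z i) zt.
apply: le_trans (ler_wpM2r _ (hM m)); last by rewrite exprn_ge0// divr_ge0// ltW.
by rewrite -mulrA -exprMn [_ * (t / _)]mulrC divfK// gt_eqF.
Qed.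

Lemma psb_cvg r F z : psb r F -> vn z < r -> exists l, psat F z l.
Proof.
move=> hF zr; have [M [th [t01 hM]]] := psb_term hF (introT andP (conj (vn_ge0 z) zr)).
exact: (geom_cvg t01 (hM z (lexx _))).
Qed.

Lemma ps_exists r F : psb r F -> exists f, ps r f F.
Proof.
move=> hF; have H z : exists l, vn z < r -> psat F z l.
  have [zr|zr] := boolP (vn z < r); last by exists 0.
  by have [l hl] := psb_cvg hF zr; exists l.
by exists (fun z => sval (cid (H z))); split => // z; exact: (svalP (cid (H z))).
Qed.

Lemma psb_mderiv j r F : psb r F -> psb r (fun m => mderiv j (F m.+1)).
Proof.
move=> [hF hb]; split=> [m|s /andP[s0 sr]]; first exact: (hom_mderiv j (hF m.+1)).
have t0 : 0 < (s + r) / 2 < r by apply/andP; split; lra.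
have [M hM] := hb _ t0; have {t0}/andP[t0 t1] := t0.
set t := (s + r) / 2 in hM t0 t1.
have st : s < t by rewrite /t; lra.
clearbody t.
have th : 0 <= s / t < 1 by rewrite divr_ge0 ?(ltW s0) ?(ltW t0)//= ltr_pdivrMr// mul1r.
have [K K0 hK] := mul_geom_bound th.
exists (K * (M / t)) => m.
apply: le_trans (_ : m.+1%:R * nrm (F m.+1) * s ^+ m <= _).
  by rewrite ler_wpM2r ?exprn_ge0 ?(ltW s0)//; exact: nrm_mderiv.
have -> : m.+1%:R * nrm (F m.+1) * s ^+ m =
    (m.+1%:R * (s / t) ^+ m) * (nrm (F m.+1) * t ^+ m.+1 / t).
  rewrite exprMn exprVn exprS; have tm : t ^+ m != 0 by rewrite expf_neq0// gt_eqF.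
  have t2 : t != 0 by rewrite gt_eqF.
  move: (t ^+ m) (s ^+ m) (nrm _) tm => a b c tm; field.
  by rewrite tm t2.
apply: ler_pM => //.
- by rewrite mulr_ge0// exprn_ge0; case/andP: th.
- by rewrite divr_ge0 ?mulr_ge0 ?nrm_ge0 ?exprn_ge0 ?(ltW t0).
- by rewrite ler_pM2r ?invr_gt0.
Qed.

Lemma ctends_cform (u : 'I_n -> nat -> C) (l : 'I_n -> C) h :
  (forall j, ctends (u j) (l j)) -> ctends (fun N => cform (fun j => u j N) h) (cform l h).
Proof.
move=> H; rewrite /cform.
suff : forall s : seq 'I_n, ctends (fun N => \sum_(j <- s) u j N * h j 0) (\sum_(j <- s) l j * h j 0).
  by move=> /(_ (index_enum 'I_n)).
elim=> [|j s IH].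
  by rewrite big_nil; apply: ctends_ext (ctends_cst 0) => N; rewrite big_nil.
rewrite big_cons (mulrC (l j)); apply: ctends_ext (ctendsD (ctendsZ (h j 0) (H j)) IH) => N.
by rewrite big_cons mulrC.
Qed.

Lemma peval_mderiv_hom0 j (f : mp) z : f \is hom 0 -> peval (mderiv j f) z = 0.
Proof.
move=> hf; apply/eqP; rewrite -cabs_eq0 eq_le cabs_ge0 andbT.
have := @peval_le _ _ _ _ z (vn z) (hom_mderiv j hf) (vn_ge0 z) (cabs_vn z).
move/le_trans; apply; rewrite expr0 mulr1.
by have := nrm_mderiv j hf; rewrite mul0r.
Qed.

(** The Taylor remainders of the forms [F k] sum to a geometric series times |h|^2, so the termwise
    gradient is the differential. *)
Lemma ps_diff r f F z c : ps r f F -> vn z < r ->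
  (forall j, psat (fun m => mderiv j (F m.+1)) z (c j)) ->
  differentiable f z /\ forall j, partial j f z = c j.
Proof.
move=> [[hF hb] hf] zr hc.
(* One eta leaves room for h, a second one makes the ratio (s + eta) / r' smaller than 1, a third
   keeps r' below r. *)
pose s := vn z; pose eta := (r - s) / 3; pose r' := s + eta + eta.
have s0 : 0 <= s := vn_ge0 z.
have e0 : 0 < eta by rewrite /eta; move: zr; rewrite -/s => zr; lra.
have r01 : 0 < r' < r by rewrite /r' /eta; move: zr s0; rewrite -/s => zr s0; apply/andP; split; lra.
have [M hM] := hb _ r01; have /andP[r0 r1] := r01.
pose th := (s + eta) / r'.
have t01 : 0 <= th < 1.
  by rewrite /th divr_ge0 ?addr_ge0 ?(ltW r0) ?(ltW e0)//= ltr_pdivrMr// mul1r /r' ltrDl.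
pose D h k := peval (F k) (z + h) - peval (F k) z - cform (pgrad (F k) z) h.
have hD h k : vn h <= eta -> cabs (D h k) <= M * (vn h / eta) ^+ 2 * th ^+ k.
  move=> he; apply: le_trans (peval_taylor s0 e0 (vn_ge0 h) he (cabs_vn z) (lexx _) (hF k)) _.
  rewrite [leRHS]mulrAC ler_wpM2r ?sqr_ge0//.
  apply: le_trans (ler_wpM2r _ (hM k)); last by rewrite exprn_ge0//; case/andP: t01.
  by rewrite -mulrA -exprMn /th [_ * (_ / r')]mulrC divfK// gt_eqF.
pose K := M / (1 - th) / eta ^+ 2.
have M0 : 0 <= M by apply: le_trans (hM 0%N); rewrite mulr_ge0 ?nrm_ge0.
have [t0 t1] := andP t01; have t2 : 0 < 1 - th by rewrite subr_gt0.
have K0 : 0 <= K by rewrite /K !divr_ge0 ?sqr_ge0 ?(ltW t2).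
have quad h : vn h <= eta -> cabs (f (z + h) - f z - cform c h) <= K * vn h ^+ 2.
  move=> he; have zh : vn (z + h) < r.
    apply: le_lt_trans (_ : s + eta < r); last by apply: le_lt_trans r1; rewrite /r' lerDl ltW.
    apply: vn_le => [|i]; first by rewrite addr_ge0// ltW.
    rewrite mxE; apply: le_trans (cabsD _ _) _; apply: lerD; first exact: cabs_vn.
    exact: le_trans (cabs_vn h i) he.
  (* The gradient series starts at [F 1], so the other partial sums are shifted by one; the form of
     degree 0 has zero gradient. *)
  have L : ctends (fun N => psums (D h) N.+1) (f (z + h) - f z - cform c h).
    have L1 := ctends_shift (hf _ zh).
    have L2 := ctendsZ (-1) (ctends_shift (hf _ zr)).
    have L3 := ctendsZ (-1) (ctends_cform h hc).
    have := ctendsD (ctendsD L1 L2) L3; rewrite !mulN1r.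
    apply: ctends_ext => N; rewrite /psums /D !sumrB !mulN1r.
    congr (_ - _ - _); rewrite big_ord_recl /cform exchange_big /=.
    rewrite [X in _ = X + _]big1 => [|j _]; last by rewrite /pgrad (peval_mderiv_hom0 _ _ (hF 0%N)) mul0r.
    by rewrite add0r; apply: eq_bigr => j _; rewrite mulr_suml.
  apply: (ctends_le L) => N.
  apply: le_trans (cabs_sum _ _ _) _.
  apply: le_trans (_ : \sum_(k < N.+1) M * (vn h / eta) ^+ 2 * th ^+ k <= _).
    by apply: ler_sum => k _; apply: hD.
  rewrite -mulr_sumr.
  apply: le_trans (ler_wpM2l _ (geom_sum_le N.+1 t01)) _; first by rewrite mulr_ge0 ?sqr_ge0.
  by rewrite le_eqVlt; apply/orP; left; apply/eqP; rewrite /K exprMn exprVn; ring.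
apply: diff_form => e ep; have K1 : 0 < K + 1 by rewrite ltr_wpDl.
exists (Num.min eta (e / (K + 1))); first by rewrite lt_min e0 divr_gt0.
move=> h; rewrite lt_min => /andP[h1 h2].
apply: le_trans (quad h (ltW h1)) _; rewrite expr2 mulrA ler_wpM2r ?vn_ge0//.
apply: le_trans (_ : (K + 1) * vn h <= _); first by rewrite ler_wpM2r ?vn_ge0// lerDl.
by rewrite mulrC -ler_pdivlMr// ltW.
Qed.

Lemma ps_differentiable r f F z : ps r f F -> vn z < r -> differentiable f z.
Proof.
move=> h zr; have H j : exists l, psat (fun m => mderiv j (F m.+1)) z l.
  exact: (psb_cvg (psb_mderiv j (proj1 h)) zr).
by have [] := ps_diff h zr (fun j => svalP (cid (H j))).
Qed.

Lemma ps_partial j r f F : ps r f F -> ps r (partial j f) (fun m => mderiv j (F m.+1)).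
Proof.
move=> h; split; first exact: psb_mderiv (proj1 h).
move=> z zr; have H i : exists l, psat (fun m => mderiv i (F m.+1)) z l.
  exact: (psb_cvg (psb_mderiv i (proj1 h)) zr).
have [_ ->] := ps_diff h zr (fun j => svalP (cid (H j))).
exact: (svalP (cid (H j))).
Qed.

Lemma ps_eqF r f F G : (forall m, F m = G m) -> ps r f F -> ps r f G.
Proof. by move=> /funext ->. Qed.

Lemma ps_eqf r f g F : (forall z, vn z < r -> f z = g z) -> ps r f F -> ps r g F.
Proof. by move=> E [h1 h2]; split=> // z zr; rewrite -E//; exact: h2. Qed.

Lemma ps_sub r r' f F : r' <= r -> ps r f F -> ps r' f F.
Proof.
move=> rr [[h1 h2] h3]; split; first split=> // s /andP[s0 s1].
  by apply: h2; rewrite s0 (lt_le_trans s1).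
by move=> z zr; apply: h3; exact: lt_le_trans zr rr.
Qed.

Lemma ps_iter_partial j k r f F : ps r f F ->
  ps r (iter k (partial j) f) (fun m => iter k (mderiv j) (F (m + k)%N)).
Proof.
move=> h; elim: k => [|k IH]; first by apply: ps_eqF h => m; rewrite addn0.
by apply: ps_eqF (ps_partial j IH) => m /=; rewrite addSnnS.
Qed.

Lemma ps_foldr (al : 'I_n -> nat) (s : seq 'I_n) r f F : ps r f F ->
  ps r (foldr (fun j v => iter (al j) (partial j) v) f s)
   (fun m => foldr (fun j => iter (al j) (mderiv j)) (F (m + \sum_(j <- s) al j)%N) s).
Proof.
move=> h; elim: s => [|j s IH]; first by apply: ps_eqF h => m; rewrite big_nil addn0.
by apply: ps_eqF (ps_iter_partial j (al j) IH) => m /=; rewrite big_cons addnA.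
Qed.

Lemma ps_mpartial al r f F : ps r f F ->
  ps r (mpartial al f) (fun m => mderivm al (F (m + mdeg al)%N)).
Proof.
move=> /(ps_foldr al (enum 'I_n)); apply: ps_eqF => m.
by rewrite /mderivm mdegE -big_enum.
Qed.

Lemma psD r f g F G : ps r f F -> ps r g G ->
  ps r (fun z => f z + g z) (fun m => F m + G m).
Proof.
move=> [[hF bF] sF] [[hG bG] sG]; split; first split=> [m|s sr].
- exact: homD.
- have [M hM] := bF s sr; have [M' hM'] := bG s sr; exists (M + M') => m.
  apply: le_trans (_ : (nrm (F m) + nrm (G m)) * s ^+ m <= _).
    by rewrite ler_wpM2r ?nrmD// exprn_ge0// ltW//; case/andP: sr.
  by rewrite mulrDl lerD.
- move=> z zr; apply: ctends_ext (ctendsD (sF z zr) (sG z zr)) => N.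
  by rewrite /psums -big_split; apply: eq_bigr => k _; rewrite pevalD.
Qed.

Lemma psZ c r f F : ps r f F -> ps r (fun z => c * f z) (fun m => c *: F m).
Proof.
move=> [[hF bF] sF]; split; first split=> [m|s sr].
- exact: homZ.
- have [M hM] := bF s sr; exists (cabs c * M) => m.
  by rewrite nrmZ -mulrA ler_wpM2l ?cabs_ge0.
- move=> z zr; apply: ctends_ext (ctendsZ c (sF z zr)) => N.
  by rewrite /psums mulr_sumr; apply: eq_bigr => k _; rewrite pevalZ.
Qed.

Lemma ps_fin r f (F : nat -> mp) d : (forall m, F m \is hom m) ->
  (forall m, (d <= m)%N -> F m = 0) -> (forall z, f z = \sum_(m < d) peval (F m) z) -> ps r f F.
Proof.
move=> hF F0 fE; split; first split=> // s /andP[s0 _].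
  exists (\sum_(m < d) nrm (F m) * s ^+ m) => m.
  have S0 k : 0 <= nrm (F k) * s ^+ k by rewrite mulr_ge0 ?nrm_ge0 ?exprn_ge0 ?(ltW s0).
  have [dm|md] := leqP d m; last by rewrite (bigD1 (Ordinal md))//= lerDl sumr_ge0.
  by rewrite F0// nrm0 mul0r sumr_ge0.
move=> z _; rewrite /psat; apply: (@ctends_eventually _ (fun=> f z) _ _ d); last exact: ctends_cst.
move=> k dk; rewrite /psums fE (big_ord_widen _ (fun m => peval (F m) z) dk) big_mkcond /=.
apply: eq_bigr => i _; case: ltnP => // /F0 ->; by rewrite peval0.
Qed.

Lemma ps0 r : ps r (fun=> 0) (fun=> 0).
Proof.
apply: (@ps_fin r _ _ 0%N) => // [m|z]; first exact: hom0.
by rewrite big_ord0.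
Qed.

Lemma ps_sum (I : Type) (q : seq I) r (f : I -> X -> C) (F : I -> nat -> mp) :
  (forall i, ps r (f i) (F i)) ->
  ps r (fun z => \sum_(i <- q) f i z) (fun m => \sum_(i <- q) F i m).
Proof.
move=> h; elim: q => [|i q IH].
  by apply: ps_eqF (ps_eqf _ (ps0 r)) => [m|z _]; rewrite big_nil.
apply: ps_eqF (ps_eqf _ (psD (h i) IH)) => [m|z _]; by rewrite big_cons.
Qed.

(** Cauchy product. The m+1 terms of degree m are paid for by a radius t > s, and [double_series]
    identifies the sum. *)
Lemma psM r f g F G : ps r f F -> ps r g G ->
  ps r (fun z => f z * g z) (fun m => \sum_(k < m.+1) F k * G (m - k)%N).
Proof.
move=> [hbF sF] [hbG sG]; have [hF bF] := hbF; have [hG bG] := hbG.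
split; first split=> [m|s /andP[s0 sr]].
- apply: hom_sumT => k _; have E : (k + (m - k))%N = m by apply: subnKC; rewrite -ltnS.
  move: (homM (hF k) (hG (m - k)%N)); move: (F k * _) => P; by rewrite E.
- have t0 : 0 < (s + r) / 2 < r by apply/andP; split; lra.
  have [M hM] := bF _ t0; have [M' hM'] := bG _ t0; have {t0}/andP[t0 t1] := t0.
  set t := (s + r) / 2 in hM hM' t0 t1.
  have st : s < t by rewrite /t; lra.
  clearbody t.
  have th : 0 <= s / t < 1 by rewrite divr_ge0 ?(ltW s0) ?(ltW t0)//= ltr_pdivrMr// mul1r.
  have [K K0 hK] := mul_geom_bound th.
  have N0 k : 0 <= nrm (F k) * t ^+ k by rewrite mulr_ge0 ?nrm_ge0 ?exprn_ge0 ?(ltW t0).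
  have N0' k : 0 <= nrm (G k) * t ^+ k by rewrite mulr_ge0 ?nrm_ge0 ?exprn_ge0 ?(ltW t0).
  have MM : 0 <= M * M' by apply: mulr_ge0; [exact: le_trans (N0 0%N) (hM 0%N)|exact: le_trans (N0' 0%N) (hM' 0%N)].
  exists (M * M' * K) => m.
  have -> : s ^+ m = t ^+ m * (s / t) ^+ m.
    by rewrite -exprMn [_ * (s / _)]mulrC divfK// gt_eqF.
  rewrite mulrA; apply: le_trans (_ : m.+1%:R * (M * M') * (s / t) ^+ m <= _).
    rewrite ler_wpM2r ?exprn_ge0//; first by case/andP: th.
    apply: le_trans (ler_wpM2r _ (nrm_sum _ _ _)) _; first by rewrite exprn_ge0// ltW.
    rewrite mulr_suml; apply: le_trans (_ : \sum_(k < m.+1) M * M' <= _); last first.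
      by rewrite sumr_const card_ord mulr_natl.
    apply: ler_sum => k _; have -> : t ^+ m = t ^+ k * t ^+ (m - k).
      by rewrite -exprD subnKC// -ltnS.
    apply: le_trans (ler_wpM2r _ (nrmM _ _)) _; first by rewrite mulr_ge0// exprn_ge0// ltW.
    by rewrite mulrACA; apply: ler_pM.
  by rewrite mulrAC [leRHS]mulrC; apply: ler_wpM2r.
- move=> z zr; have [M [th [t01 hM]]] := psb_term hbF (introT andP (conj (vn_ge0 z) zr)).
  have [M' [th' [t01' hM']]] := psb_term hbG (introT andP (conj (vn_ge0 z) zr)).
  pose T := Num.max th th'.
  have T01 : 0 <= T < 1 by case/andP: t01 t01' => a b /andP[c d]; rewrite le_max a gt_max b d.
  have := @double_series _ (fun k m => peval (F k) z * peval (G m) z)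
    (fun k => peval (F k) z * g z) (f z * g z) (M * M') T T01.
  rewrite /psat => H; apply: ctends_ext (H _ _ _) => [N|k m|k|].
  + apply: eq_bigr => i _; rewrite peval_sum; apply: eq_bigr => k _.
    by rewrite pevalM.
  + have A := hM z (lexx _) k; have B := hM' z (lexx _) m.
    have A0 := le_trans (cabs_ge0 _) A; have B0 := le_trans (cabs_ge0 _) B.
    have M0 : 0 <= M by have := le_trans (cabs_ge0 _) (hM z (lexx _) 0%N); rewrite expr0 mulr1.
    have M0' : 0 <= M' by have := le_trans (cabs_ge0 _) (hM' z (lexx _) 0%N); rewrite expr0 mulr1.
    have [th0 _] := andP t01; have [th0' _] := andP t01'.
    rewrite cabsM exprD mulrACA; apply: ler_pM; rewrite ?cabs_ge0//.
      by apply: le_trans A _; rewrite ler_wpM2l// lerXn2r ?nnegrE ?le_max ?th0 ?lexx.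
    by apply: le_trans B _; rewrite ler_wpM2l// lerXn2r ?nnegrE ?le_max ?th0' ?lexx ?orbT.
  + apply: ctends_ext (ctendsZ (peval (F k) z) (sG z zr)) => N.
    by rewrite /psums mulr_sumr.
  + rewrite mulrC; apply: ctends_ext (ctendsZ (g z) (sF z zr)) => N.
    by rewrite /psums mulr_sumr; apply: eq_bigr => k _; rewrite mulrC.
Qed.
End PowerSeries.

(** * Differential operators on power series, and uniqueness of the expansion *)

Section PowerSeriesOps.
Variables (R : realType) (n : nat).
Local Notation C := (Cplx R).
Local Notation X := 'cV[Cplx R]_n.
Local Notation mp := (mpoly n C).
Local Notation hom := (@hom R n).
Implicit Types (z h : X) (r s t : R) (f g : X -> C) (F G : nat -> mp).

(** The part of degree m of P f, for P of degree d; the test guards the truncated subtraction. *)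
Definition pmul d (P : mp) F m : mp := if (m < d)%N then 0 else P * F (m - d)%N.

Lemma pmulD d P F m : pmul d P F (m + d) = P * F m.
Proof. by rewrite /pmul ltnNge leq_addl /= addnK. Qed.

Lemma ps_peval r d (P : mp) : P \is hom d ->
  ps r (peval P) (fun m => if m == d then P else 0).
Proof.
move=> hP; apply: (@ps_fin _ _ r _ _ d.+1) => [m|m dm|z].
- by case: eqP => [->//|_]; exact: hom0.
- by rewrite gtn_eqF.
- rewrite big_ord_recr /= eqxx big1 ?add0r// => i _.
  by rewrite ltn_eqF// peval0.
Qed.

Lemma psP r d (P : mp) f F : P \is hom d -> ps r f F ->
  ps r (fun z => peval P z * f z) (pmul d P F).
Proof.
move=> hP hf; apply: ps_eqF (psM (ps_peval r hP) hf) => m; rewrite /pmul.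
have [md|dm] := ltnP m d.
  by rewrite big1// => k _; rewrite ltn_eqF ?mul0r// (leq_ltn_trans _ md)// -ltnS.
have dm1 : (d < m.+1)%N by [].
rewrite (bigD1 (Ordinal dm1))//= eqxx big1 ?addr0// => k kd.
by have /negbTE -> : (k : nat) != d by []; rewrite mul0r.
Qed.

Lemma ps_diff_op r e (Q : mp) f F : Q \is hom e -> ps r f F ->
  ps r (diff_op Q f) (fun m => pdiff Q (F (m + e)%N)).
Proof.
move=> /dhomogP hQ hf.
apply: ps_eqF (ps_sum _ (fun al => psZ (mcoeff al Q) (ps_mpartial al hf))) => m.
by rewrite pdiffE !big_seq; apply: eq_bigr => al /hQ /= ->.
Qed.

Lemma ps_hol_op r B p (a : multinom n -> X -> C) A f F : ps r f F ->
  (forall al, (mdeg al <= p)%N -> ps r (a al) (A al)) ->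
  ps r (hol_op B p a f) (fun m => pdiff (qform B ^+ p) (F (m + 2 * p)%N) +
    \sum_(al : bmultinom n p.+1) \sum_(k < m.+1) A al k * mderivm al (F (m - k + mdeg al)%N)).
Proof.
move=> hf ha; apply: psD; first exact: (ps_diff_op (homX p (hom_qform B)) hf).
apply: (ps_sum (index_enum _)) => al; have hal : (mdeg al <= p)%N by rewrite -ltnS; exact: bmdeg.
exact: (psM (ha _ hal) (ps_mpartial al hf)).
Qed.

Lemma peval_scale d (f : mp) c z : f \is hom d -> peval f (c *: z) = c ^+ d * peval f z.
Proof.
move: f; apply: hom_ind => [|k m md|f g IHf IHg].
- by rewrite !peval0 mulr0.
- rewrite !pevalZ mulrCA; congr (_ * _); rewrite /peval !mevalX.
  rewrite -md mdegE -prodrXr -big_split; apply: eq_bigr => i _ /=.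
  by rewrite mxE exprMn.
- by rewrite !pevalD IHf IHg mulrDr.
Qed.

(** Vanishing at real points already makes the norm of the sphere 0, and [sg_def] concludes. *)
Lemma peval_eq0 d (f : mp) : (0 < n)%N -> f \is hom d ->
  (forall z, peval f z = 0) -> f = 0.
Proof.
move=> n0 hf f0; apply: (sg_def n0 hf); apply/eqP; rewrite eq_le (sg_ge0 n0 hf) andbT.
have hff : - (f * cj f) \is hom (d + d) by apply/homN/homM => //; exact: hom_cj.
have := gS_ge0 n0 hff; rewrite sgE /gS lformN reN oppr_ge0; apply => x.
rewrite mevalN mevalM (_ : meval _ f = 0) ?mul0r ?oppr0//.
have := f0 (\col_i rpt x i); rewrite /peval => <-; apply: meval_eq => i.
by rewrite mxE.
Qed.

(** If the coefficients before u_d vanish, the tail estimate divided by c^d gives |u_d| <= M c / (1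
    - c) for every small c. *)
Lemma cseries_eq0 (u : nat -> C) M : (forall m, cabs (u m) <= M) ->
  (forall c : R, 0 < c < 1 -> ctends (psums (fun m => cR c ^+ m * u m)) 0) ->
  forall m, u m = 0.
Proof.
move=> hM h0; have M0 : 0 <= M := le_trans (cabs_ge0 _) (hM 0%N).
apply: ltn_ind => d IH; apply/eqP; rewrite -cabs_eq0 eq_le cabs_ge0 andbT.
apply/ler_addgt0Pr => e e0; rewrite add0r.
(* Then M c <= e/2 and 1 - c >= 1/2, so that M c / (1 - c) <= e. *)
pose c := Num.min (1 / 2) (e / (2 * (M + 1))) : R.
have M1 : 0 < 2 * (M + 1) by lra.
have c0 : 0 < c by rewrite lt_min !divr_gt0.
have c2 : c <= 1 / 2 by rewrite ge_min lexx.
have ce : c <= e / (2 * (M + 1)) by rewrite ge_min lexx orbT.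
clearbody c; have c1 : 0 <= c < 1 by rewrite ltW//=; lra.
have hu k : cabs (cR c ^+ k * u k) <= M * c ^+ k.
  by rewrite cabsM cabsX cabs_cR ger0_norm ?(ltW c0)// mulrC ler_wpM2r ?exprn_ge0 ?(ltW c0).
have c01 : 0 < c < 1 by rewrite c0; case/andP: c1.
have := geom_tail d.+1 c1 hu (h0 _ c01).
rewrite /psums big_ord_recr /= big1 => [|k _]; last by rewrite IH ?mulr0.
rewrite !add0r cabsN cabsM cabsX cabs_cR ger0_norm ?(ltW c0)// exprSr.
have cd : 0 < c ^+ d by rewrite exprn_gt0.
have -> : M * (c ^+ d * c) / (1 - c) = c ^+ d * (M * c / (1 - c)) by ring.
rewrite ler_pM2l// => /le_trans; apply.
have c3 : 0 < 1 - c by lra.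
rewrite ler_pdivrMr//; apply: le_trans (_ : e / 2 <= _); last first.
  by rewrite ler_pM2l//; lra.
move: ce; rewrite ler_pdivlMr// => ce.
have : M * c <= c * (M + 1) by rewrite mulrC ler_pM2l//; lra.
by lra.
Qed.

(** On the ray c z the part of degree m is c^m times its value at z, so the one-variable statement
    [cseries_eq0] applies for each z. *)
Lemma ps_eq0 r f F : (0 < n)%N -> 0 < r -> ps r f F -> (forall z, vn z < r -> f z = 0) ->
  forall m, F m = 0.
Proof.
move=> n0 r0 [hbF sF] f0 m; have [hF _] := hbF.
have small z : vn z < r -> forall k, peval (F k) z = 0.
  move=> zr; have [M [th [t01 hM]]] := psb_term hbF (introT andP (conj (vn_ge0 z) zr)).
  have /andP[t0 t1] := t01.
  have M0 : 0 <= M by have := le_trans (cabs_ge0 _) (hM z (lexx _) 0%N); rewrite expr0 mulr1.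
  apply: (@cseries_eq0 _ M) => [k|c /andP[c0 c1]].
    apply: le_trans (hM z (lexx _) k) _; rewrite -[leRHS]mulr1 ler_wpM2l//.
    by rewrite exprn_ile1// ltW.
  have cz : vn (cR c *: z) < r.
    apply: le_lt_trans zr; apply: vn_le (vn_ge0 z) _ => i.
    rewrite mxE cabsM cabs_cR ger0_norm ?(ltW c0)//.
    apply: le_trans (cabs_vn z i); rewrite -[leRHS]mul1r ler_wpM2r ?cabs_ge0//.
    exact: ltW.
  rewrite -(f0 _ cz); apply: ctends_ext (sF _ cz) => N.
  by apply: eq_bigr => k _; exact: peval_scale (hF k).
(* Homogeneity carries the vanishing from the ball to all of C^n. *)
apply: (peval_eq0 n0 (hF m)) => z.
have v1 : 0 < vn z + 1 by rewrite ltr_wpDl ?vn_ge0.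
pose c := r / (vn z + 1).
have c0 : 0 < c by rewrite divr_gt0.
have cz : vn (cR c *: z) < r.
  apply: le_lt_trans (_ : c * vn z < r).
    apply: vn_le => [|i]; first by rewrite mulr_ge0 ?vn_ge0 ?(ltW c0).
    by rewrite mxE cabsM cabs_cR gtr0_norm// ler_pM2l// cabs_vn.
  by rewrite /c mulrAC ltr_pdivrMr// ltr_pM2l// ltrDl.
have := small _ cz m; rewrite (peval_scale _ _ (hF m)) => /eqP.
rewrite mulf_eq0 expf_eq0 => /orP[/andP[_ /eqP c00]|/eqP//].
by move: c0; rewrite -(re_cR c) c00 re0 ltxx.
Qed.

Lemma ps_uniq r f F G : (0 < n)%N -> 0 < r -> ps r f F -> ps r f G -> forall m, F m = G m.
Proof.
move=> n0 r0 hF hG m; apply/eqP; rewrite -subr_eq0; apply/eqP.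
have := psD hF (psZ (-1) hG) => h.
rewrite -(ps_eq0 n0 r0 h _ m) ?scaleN1r// => z _.
by rewrite mulN1r subrr.
Qed.
End PowerSeriesOps.

(** * Expansion of holomorphic functions *)

Section Expansion.
Variables (R : realType) (n : nat).
Local Notation C := (Cplx R).
Local Notation X := 'cV[Cplx R]_n.
Local Notation mp := (mpoly n C).
Local Notation hom := (@hom R n).
Local Notation mX := (@mX R n).
Implicit Types (h : X) (r s M : R) (g : X -> C) (t : C).

Definition upd h (j : 'I_n) t : X := \col_i (if i == j then t else h i 0).

Lemma upd_id h j : upd h j (h j 0) = h.
Proof. by apply/matrixP => i k; rewrite !mxE (ord1 k); case: eqP => [->|]. Qed.
Lemma updj h j t : upd h j t j 0 = t. Proof. by rewrite mxE eqxx. Qed.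
Lemma upd_neq h j t i : i != j -> upd h j t i 0 = h i 0.
Proof. by rewrite mxE => /negbTE ->. Qed.
Lemma upd_upd h j t t' : upd (upd h j t) j t' = upd h j t'.
Proof. by apply/matrixP => i k; rewrite !mxE; case: eqP. Qed.
Lemma updC h i j t t' : i != j -> upd (upd h j t) i t' = upd (upd h i t') j t.
Proof.
move=> ij; apply/matrixP => k l; rewrite !mxE.
by case: eqP => [->|//]; rewrite (negbTE ij).
Qed.

Definition osqv s h := forall i, osq s (h i 0).

Lemma osqv_upd s h j t : osqv s h -> osq s t -> osqv s (upd h j t).
Proof. by move=> hh ht i; rewrite mxE; case: eqP. Qed.

(* The hypothesis of Osgood's lemma. *)
Definition sephol s M g := (forall h, osqv s h -> cabs (g h) <= M) /\
  forall h j, osqv s h -> hol1 (fun t => g (upd h j t)) (h j 0).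

Lemma sephol_hol1 s M g h j t : sephol s M g -> osqv s h -> osq s t ->
  hol1 (fun t => g (upd h j t)) t.
Proof.
move=> [_ H] hh ht; have := H _ j (osqv_upd j hh ht).
by rewrite updj; under eq_fun do rewrite upd_upd.
Qed.

Lemma hol1_shift (f : C -> C) t : hol1 (fun l => f (t + l)) 0 -> hol1 f t.
Proof.
move=> [D H]; exists D => e /H[d d0 hd]; exists d => // h /hd.
by rewrite addr0 add0r.
Qed.

Lemma hol1_unshift (f : C -> C) t l : hol1 f (t + l) -> hol1 (fun l => f (t + l)) l.
Proof.
move=> [D H]; exists D => e /H[d d0 hd]; exists d => // h /hd.
by rewrite addrA.
Qed.

Lemma osq_room s t : osq s t -> exists2 r, 0 < r & forall l, sq r l -> osq s (t + l).
Proof.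
move=> [h1 h2]; pose r := Num.min (s - `|re t|) (s - `|im t|) / 2.
have r0 : 0 < r by rewrite divr_gt0// lt_min !subr_gt0 h1.
have r1 : r < s - `|re t|.
  have : Num.min (s - `|re t|) (s - `|im t|) <= s - `|re t| by rewrite ge_min lexx.
  by move: r0; rewrite /r; lra.
have r2 : r < s - `|im t|.
  have : Num.min (s - `|re t|) (s - `|im t|) <= s - `|im t| by rewrite ge_min lexx orbT.
  by move: r0; rewrite /r; lra.
exists r => // l [l1 l2]; split; [rewrite reD|rewrite imD];
  apply: le_lt_trans (ler_normD _ _) _; rewrite addrC -ltrBrDr.
  exact: le_lt_trans l1 r1.
exact: le_lt_trans l2 r2.
Qed.

Lemma cabs_sq s t : cabs t <= s -> sq s t.
Proof. by move=> h; split; [apply: le_trans (re_le_cabs _) h|apply: le_trans (im_le_cabs _) h]. Qed.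

Lemma sephol_ge0 s M g : 0 < s -> sephol s M g -> 0 <= M.
Proof.
move=> s0 [H _]; apply: le_trans (cabs_ge0 (g 0)) (H _ _) => i.
by rewrite mxE /osq re0 im0 normr0.
Qed.

(** Allows the expansion to proceed one variable at a time: a coefficient taken in the variable j
    stays separately holomorphic, with Cauchy's estimate as its bound. It is constant in the
    variable j; in another variable one differentiates under the integral by [param_hol]. *)
Lemma sephol_coef s s0 M g j k : 0 < s -> s < s0 -> sephol s0 M g ->
  sephol s0 (16 * M / s ^+ k) (fun h => cf s (fun t => g (upd h j t)) k).
Proof.
move=> sp ss H; have M0 := sephol_ge0 (lt_trans sp ss) H.
have sqo t : sq s t -> osq s0 t by exact: sq_osq.
split=> [h hh|h i hh].
  apply: cf_bound => // [|t ts _]; last by case: H => H _; exact/H/osqv_upd/sqo.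
  apply: onb_sq => // t ts st; apply: cctsM; apply: hol1_ccts.
    by apply: sephol_hol1 H hh _; exact: sqo.
  by apply: hol1_pinv; exact: neq0_le st.
have [<-|ij] := eqVneq i j.
  under eq_fun do under eq_fun do rewrite upd_upd.
  exact: hol1_cst.
apply: hol1_shift; have [r r0 hr] := osq_room (hh i).
pose F l t := g (upd (upd h j t) i (h i 0 + l)).
have FE : (fun l => cf s (fun t => g (upd (upd h i (h i 0 + l)) j t)) k) = fun l => cf s (F l) k.
  apply/funext => l; apply: (f_equal (fun u => cf s u k)); apply/funext => t.
  by rewrite /F (updC _ _ _ ij).
(* [G] is the derivative in the variable i, written as a Taylor coefficient; [taylor2] gives the
   quadratic remainder uniformly in t. *)
apply: (eq_ind_r (fun u => hol1 u 0) _ FE) => {FE}; pose G t := cf r (fun l => F l t) 1.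
have r2 : 0 < r / 2 by rewrite divr_gt0.
have K0 : 0 <= 32 * M / r ^+ 2 by rewrite divr_ge0 ?sqr_ge0// mulr_ge0.
apply: (@param_hol _ F G s s0 (r / 2) (32 * M / r ^+ 2) k sp ss r2 K0).
- move=> t l ts lr.
  have hj := osqv_upd j hh ts.
  apply: (@taylor2 _ r M (fun l => F l t) l r0 (ltW lr)).
    move=> z zr; apply: (@hol1_unshift (fun u => g (upd (upd h j t) i u))).
    by apply: (sephol_hol1 i H hj); exact: hr.
  move=> z zr; case: H => H _; apply/H/osqv_upd => //; exact: hr.
- move=> t l ts lr; apply: hol1_ccts.
  have hl : osqv s0 (upd h i (h i 0 + l)).
    apply: osqv_upd => //; apply/hr/cabs_sq; apply: ltW; apply: lt_le_trans lr _; lra.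
  have := sephol_hol1 j H hl ts; congr (hol1 _ _); apply/funext => z.
  by rewrite /F (updC _ _ _ ij).
Qed.

Definition dep k g := forall h h' : X, (forall i : 'I_n, (i < k)%N -> h i 0 = h' i 0) ->
  g h = g h'.

(** Induction on the number k of variables on which g depends: expand in the last one, expand its
    coefficients by induction, and regroup by total degree. Each variable costs a factor 16 from
    Cauchy's estimate and a factor m+1 from the ways of splitting the degree. *)
Lemma sephol_expand s s0 k M g : 0 < s -> s < s0 -> (k <= n)%N -> sephol s0 M g -> dep k g ->
  exists F : nat -> mp, (forall m, F m \is hom m) /\
    (forall m, nrm (F m) <= 16 ^+ k * M * m.+1%:R ^+ k * s ^- m) /\
    forall h, vn h < s -> psat F h (g h).
Proof.
move=> sp ss; elim: k M g => [|k IH] M g kn H hd.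
  exists (fun m => if m == 0%N then g 0 *: 1 else 0); split => [m|]; last split=> [m|h hs].
  - by case: eqP => [->|_]; [apply/homZ/hom1|apply: hom0].
  - have M0 := sephol_ge0 (lt_trans sp ss) H; rewrite !expr0 mul1r mulr1; case: eqP => [->|_].
      rewrite nrmZ nrm1 expr0 invr1 !mulr1; case: H => + _; apply => i.
      by rewrite mxE /osq re0 im0 normr0; split; exact: lt_trans ss.
    by rewrite nrm0 mulr_ge0// invr_ge0 exprn_ge0// ltW.
  - apply: (@ctends_eventually _ (fun=> g h) _ _ 1%N); last exact: ctends_cst.
    case=> // N _; rewrite /psums big_ord_recl /= pevalZ peval1 mulr1 big1 ?addr0.
      by apply: hd => i.
    by move=> i _; rewrite peval0.
pose j := Ordinal kn; pose c m h := cf s (fun t => g (upd h j t)) m.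
have Hc m : sephol s0 (16 * M / s ^+ m) (c m) by exact: sephol_coef.
have dc m : dep k (c m).
  move=> h h' hh; rewrite /c; apply: (f_equal (fun u => cf s u m)); apply/funext => t.
  apply: hd => i; rewrite ltnS leq_eqVlt => /orP[ik|ik].
    by have -> : i = j by [apply/val_inj/eqP]; rewrite !updj.
  have ij : i != j by apply: contraL ik => /eqP ->; rewrite ltnn.
  by rewrite !upd_neq//; exact: hh.
have /choice[Fc hFc] := fun m => IH _ _ (ltnW kn) (Hc m) (dc m).
have hF m := proj1 (hFc m); have nF m := proj1 (proj2 (hFc m)).
have sF m := proj2 (proj2 (hFc m)).
exists (fun N => \sum_(m < N.+1) mX j ^+ m * Fc m (N - m)%N).
split=> [N|]; last split=> [N|h hs].
- apply: hom_sumT => m _; have E : (1 * m + (N - m))%N = N by rewrite mul1n subnKC// -ltnS.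
  move: (homM (homX m (hom_mX R j)) (hF m (N - m)%N)); move: (_ * _) => Q; by rewrite E.
- apply: le_trans (nrm_sum _ _ _) _.
  have -> : 16 ^+ k.+1 * M * N.+1%:R ^+ k.+1 * s ^- N =
      \sum_(m < N.+1) (16 ^+ k.+1 * M * N.+1%:R ^+ k * s ^- N).
    rewrite sumr_const card_ord -mulr_natl [N.+1%:R ^+ k.+1]exprS; ring.
  apply: ler_sum => m _; apply: le_trans (_ : nrm (Fc m (N - m)%N) <= _).
    elim: (m : nat) (Fc m (N - m)%N) => [|l IHl] Q; first by rewrite expr0 mul1r.
    by rewrite exprS -mulrA; apply: le_trans (nrm_mX _ _) (IHl _).
  apply: le_trans (nF m (N - m)%N) _; have M0 := sephol_ge0 (lt_trans sp ss) H.
  have -> : s ^- N = s ^- m * s ^- (N - m).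
    by rewrite -invfM -exprD subnKC// -ltnS.
  apply: le_trans (_ : 16 ^+ k * (16 * M / s ^+ m) * N.+1%:R ^+ k * s ^- (N - m) <= _).
    rewrite ler_wpM2r ?invr_ge0 ?exprn_ge0 ?(ltW sp)// ler_wpM2l//.
      by rewrite !mulr_ge0 ?exprn_ge0 ?invr_ge0 ?exprn_ge0// ltW.
    by rewrite lerXn2r ?nnegrE// ler_nat ltnS leq_subr.
  by rewrite le_eqVlt; apply/orP; left; apply/eqP; rewrite exprS; ring.
- have M0 := sephol_ge0 (lt_trans sp ss) H.
  pose th := vn h / s; have th0 : 0 <= th by rewrite divr_ge0 ?vn_ge0// ltW.
  have th1 : th < 1 by rewrite ltr_pdivrMr// mul1r.
  (* A ratio between th and 1: (th / T)^l absorbs the factor (l+1)^k and leaves the geometric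
     majorant required by [double_series]. *)
  pose T := (1 + th) / 2; have T0 : 0 < T by rewrite /T; lra.
  have T1 : T < 1 by rewrite /T; lra.
  have q0 : 0 <= th / T < 1.
    by rewrite divr_ge0 ?(ltW T0)//= ltr_pdivrMr// mul1r /T; lra.
  have [K K0 hK] := poly_geom_bound k q0.
  pose B := 16 ^+ k.+1 * M.
  have B0 : 0 <= B by rewrite mulr_ge0 ?exprn_ge0.
  have thT : th <= T by rewrite /T; lra.
  clearbody T.
  have ub m l : cabs (h j 0 ^+ m * peval (Fc m l) h) <= B * K * T ^+ (m + l).
    have h1 : cabs (h j 0 ^+ m) <= vn h ^+ m by rewrite cabsX lerXn2r ?nnegrE ?cabs_ge0 ?vn_ge0 ?cabs_vn.
    have h2 := peval_le (hF m l) (vn_ge0 h) (cabs_vn h).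
    have h3 := le_trans h2 (ler_wpM2r (exprn_ge0 _ (vn_ge0 h)) (nF m l)).
    rewrite cabsM; apply: le_trans (ler_pM (cabs_ge0 _) (cabs_ge0 _) h1 h3) _.
    have E : vn h = th * s by rewrite /th divfK// gt_eqF.
    have -> : vn h ^+ m * (16 ^+ k * (16 * M / s ^+ m) * l.+1%:R ^+ k / s ^+ l * vn h ^+ l) =
        B * th ^+ m * (l.+1%:R ^+ k * th ^+ l).
      rewrite {1 2}E !exprMn /B exprS.
      have sm : s ^+ m != 0 by rewrite expf_neq0// gt_eqF.
      have sl : s ^+ l != 0 by rewrite expf_neq0// gt_eqF.
      move: (s ^+ m) (s ^+ l) (th ^+ m) (th ^+ l) (16 ^+ k) (l.+1%:R ^+ k) sm sl.
      by move=> a b x y u v a0 b0; field; rewrite a0 b0.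
    have -> : B * K * T ^+ (m + l) = B * (T ^+ m * (K * T ^+ l)) by rewrite exprD; ring.
    rewrite -mulrA ler_wpM2l//.
    apply: ler_pM.
    + by rewrite exprn_ge0.
    + by rewrite mulr_ge0 ?exprn_ge0.
    + by rewrite lerXn2r ?nnegrE ?(ltW T0).
    + have -> : th ^+ l = (th / T) ^+ l * T ^+ l by rewrite -exprMn divfK// gt_eqF.
      by rewrite mulrA ler_wpM2r ?exprn_ge0 ?(ltW T0).
  have hsq t : sq s t -> osq s0 t by exact: sq_osq.
  have hO : osqv s0 h.
    by move=> i; apply/hsq/cabs_sq; apply: ltW; apply: le_lt_trans (cabs_vn h i) hs.
  have T01 : 0 <= T < 1 by rewrite (ltW T0) T1.
  have := @double_series _ (fun m l => h j 0 ^+ m * peval (Fc m l) h)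
    (fun m => h j 0 ^+ m * c m h) (g h) (B * K) T T01 ub.
  move=> D; apply: ctends_ext (D _ _) => [N|m|].
  + apply: eq_bigr => i _; rewrite peval_sum; apply: eq_bigr => m _.
    rewrite pevalM; congr (_ * _).
    by elim: (m : nat) => [|l IHl]; rewrite ?expr0 ?peval1// !exprS pevalM peval_mX IHl.
  + apply: ctends_ext (ctendsZ (h j 0 ^+ m) (sF m h hs)) => N.
    by rewrite /psums mulr_sumr.
  + have hj : cabs (h j 0) < s by apply: le_lt_trans (cabs_vn h j) hs.
    have e1 t : sq s t -> hol1 (fun t => g (upd h j t)) t by move=> /hsq; exact: sephol_hol1 H hO.
    have e2 t : sq s t -> cabs (g (upd h j t)) <= M.
      by move=> /hsq ts; case: H => H _; apply/H/osqv_upd.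
    move=> e e0; have q1 : 0 <= cabs (h j 0) / s < 1.
      by rewrite divr_ge0 ?cabs_ge0 ?(ltW sp)//= ltr_pdivrMr// mul1r.
    have [N hN] := geom_small (16 * M * s / (s - cabs (h j 0))) q1 e0.
    exists N => l /hN; apply: le_trans; have := cf_expand l hj e1 e2.
    rewrite upd_id cabs_distC; congr (cabs (_ - _) <= _).
    by apply: eq_bigr => i _; rewrite mulrC.
Qed.
End Expansion.

(** * From Fréchet differentiability to power series *)

Section HolExpand.
Variables (R : realType) (n : nat).
Local Notation C := (Cplx R).
Local Notation X := 'cV[Cplx R]_n.
Local Notation mp := (mpoly n C).
Implicit Types (h z : X) (r s M : R) (f g : X -> C) (t : C).

Lemma sephol_ps s s0 M g : 0 < s -> s < s0 -> sephol s0 M g ->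
  exists F : nat -> mp, ps s g F.
Proof.
move=> sp ss H; have hd : dep n g.
  move=> h h' hh; congr g; apply/matrixP => i k.
  by rewrite (ord1 k); apply: hh.
have [F [hF [nF sF]]] := sephol_expand sp ss (leqnn n) H hd.
have M0 := sephol_ge0 (lt_trans sp ss) H.
exists F; split => //; split=> // t /andP[t0 ts].
have q1 : 0 <= t / s < 1 by rewrite divr_ge0 ?(ltW t0) ?(ltW sp)//= ltr_pdivrMr// mul1r.
have [K K0 hK] := poly_geom_bound n q1.
exists (16 ^+ n * M * K) => m.
apply: le_trans (ler_wpM2r _ (nF m)) _; first by rewrite exprn_ge0// ltW.
have -> : 16 ^+ n * M * m.+1%:R ^+ n / s ^+ m * t ^+ m =
    16 ^+ n * M * (m.+1%:R ^+ n * (t / s) ^+ m) by rewrite exprMn exprVn; ring.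
by rewrite ler_wpM2l// mulr_ge0 ?exprn_ge0.
Qed.

Lemma local_bound g z : differentiable g z ->
  exists2 d, 0 < d & forall h, vn h < d -> cabs (g (z + h)) <= cabs (g z) + 1.
Proof.
move=> /differentiable_continuous /(_ [set w | cabs w <= cabs (g z) + 1]) H.
apply/(nbhs_vn [set w | cabs (g w) <= cabs (g z) + 1] z)/H; apply/nbhs_ballP; exists 1 => //= w.
rewrite -ball_normE /= norm_cabs -cR1 cR_lt cabs_distC => h /=.
rewrite -(subrK (g z) w); apply: le_trans (cabsD _ _) _; rewrite addrC.
by rewrite lerD2l ltW.
Qed.

(** The product of closed squares is the image of a compact box of R^(2n), and local bounds spread
    over it by compactness. The condition 2 s < r accounts for |z| <= |re z| + |im z|. *)
Lemma diff_bounded g s r : (forall z, vn z < r -> differentiable g z) -> 0 < s -> 2 * s < r ->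
  exists M, forall h, (forall i, sq s (h i 0)) -> cabs (g h) <= M.
Proof.
move=> hg s0 sr.
pose K := [set v : 'rV[R]_(n + n) | forall i, `[- s, s]%classic (v ord0 i)].
have cK : compact K by apply: (@rV_compact _ _ (fun=> `[- s, s]%classic)) => _; exact: segment_compact.
pose phi (v : 'rV[R]_(n + n)) : X := \col_i zp (v 0 (lshift n i)) (v 0 (rshift n i)).
have phiK h : (forall i, sq s (h i 0)) -> exists2 v, K v & phi v = h.
  move=> hh; exists (\row_j match fintype.split j with inl i => re (h i 0) | inr i => im (h i 0) end).
    move=> j /=; rewrite mxE in_itv /= -ler_norml; case: fintype.split => i; by case: (hh i).
  apply/matrixP => i k; rewrite !mxE (ord1 k).
  by rewrite (unsplitK (inl i)) (unsplitK (inr i)) -zpE.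
have vphi (v : 'rV[R]_(n + n)) e : 0 < e -> (forall j, `|v 0 j| <= e) -> vn (phi v) <= 2 * e.
  move=> e0 hv; apply: vn_le => [|i]; first by rewrite mulr_ge0 ?(ltW e0).
  rewrite mxE; apply: le_trans (cabs_le_reim _) _; rewrite re_zp im_zp.
  by rewrite mulr_natl mulr2n; apply: lerD.
have phiB (u v : 'rV[R]_(n + n)) : phi (u - v) = phi u - phi v.
  apply/matrixP => i k; rewrite !mxE; apply: re_im_eq.
    by rewrite reB !re_zp.
  by rewrite imB !im_zp.
have /compact_near_coveringP/(_ _ (nbhs +oo%R) (fun M v => cabs (g (phi v)) <= M)) := cK.
have FF : Filter (nbhs (+oo%R : set_system R)) by exact: _.
move=> /(_ FF) [].
  move=> v Kv; have vr : vn (phi v) < r.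
    apply: le_lt_trans (vphi v s s0 _) sr => j.
    by have := Kv j; rewrite /= in_itv /= -ler_norml.
  have [d d0 hd] := local_bound (hg _ vr).
  exists (ball v (d / 4), [set M | cabs (g (phi v)) + 1 <= M]).
    split; first by apply: nbhsx_ballx; rewrite divr_gt0.
    by apply: nbhs_pinfty_ge; exact: num_real.
  move=> [u M] [/= hu hM]; apply: le_trans hM.
  rewrite -(subrK (phi v) (phi u)) addrC; apply: hd; rewrite -phiB.
  have d4 : 0 < d / 4 by rewrite divr_gt0.
  apply: le_lt_trans (vphi _ _ d4 _) _; last by lra.
  move=> j; have [_ /(_ 0 j)] := hu.
  rewrite -ball_normE /= !mxE distrC => /ltW; exact.
move=> M [Mr HM]; exists (M + 1) => h /phiK[v Kv <-].
by apply: HM => //; rewrite ltrDl.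
Qed.

Lemma diff_hol1 g h j t : differentiable g (upd h j t) -> hol1 (fun t => g (upd h j t)) t.
Proof.
move=> df; exists ('d g (upd h j t) (delta_mx j 0)) => e e0.
have [d d0 hd] := diff_small df e0; exists d => // l ld.
have vl : vn (l *: delta_mx j 0) <= cabs l.
  apply: vn_le (cabs_ge0 _) _ => i; rewrite !mxE eqxx andbT; case: eqP => _.
    by rewrite mulr1.
  by rewrite mulr0 cabs0 cabs_ge0.
have := hd _ (le_lt_trans vl ld).
have -> : upd h j t + l *: delta_mx j 0 = upd h j (t + l).
  apply/matrixP => i k; rewrite !mxE (ord1 k) eqxx andbT; case: eqP => _.
    by rewrite mulr1.
  by rewrite mulr0 addr0.
rewrite linearZ /= [_ * l in X in _ -> X]mulrC => H; apply: le_trans H _.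
by rewrite ler_wpM2l// ltW.
Qed.

Lemma diff_shift f w z : differentiable f (w + z) -> differentiable (fun h => f (w + h)) z.
Proof.
move=> df; pose c j := 'd f (w + z) (delta_mx j 0).
suff [] : differentiable (fun h => f (w + h)) z /\ forall j, partial j (fun h => f (w + h)) z = c j by [].
apply: diff_form => e e0; have [d d0 hd] := diff_small df e0.
exists d => // h /hd; rewrite addrA; congr (cabs (_ - _) <= _).
have {1}-> : h = \sum_j h j 0 *: delta_mx j 0.
  apply/matrixP => i k; rewrite summxE (ord1 k) (bigD1 i)//= !mxE !eqxx mulr1 big1 ?addr0// => j ji.
  by rewrite !mxE eq_sym (negbTE ji) mulr0.
rewrite linear_sum; apply: eq_bigr => j _; rewrite linearZ /=.
by rewrite mulrC.
Qed.

Lemma hol_expand f w r : 0 < r -> (forall z, vn (z - w) < r -> differentiable f z) ->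
  exists F : nat -> mp, ps (r / 8) (fun h => f (w + h)) F.
Proof.
move=> r0 hf; pose g h := f (w + h).
have hg z : vn z < r -> differentiable g z.
  by move=> zr; apply: diff_shift; apply: hf; rewrite addrC addKr.
(* Squares of half-side r/4 lie in the disc of radius r/2, inside the domain; expanding at radius
   r/8 < r/4 leaves the margin that [sephol_ps] asks for. *)
have r4 : 0 < r / 4 by rewrite divr_gt0.
have r42 : 2 * (r / 4) < r by lra.
have [M hM] := diff_bounded hg r4 r42.
apply: (@sephol_ps _ (r / 4) M); rewrite ?divr_gt0//; first by lra.
have osqsq t : osq (r / 4) t -> sq (r / 4) t by move=> [/ltW a /ltW b].
split=> [h hh|h j hh]; first by apply: hM => i; exact/osqsq.
apply: (@diff_hol1 g); rewrite upd_id; apply: hg.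
apply: (@le_lt_trans _ _ (r / 2)); last by lra.
apply: vn_le => [|i]; first by rewrite divr_ge0// ltW.
apply: le_trans (cabs_le_reim _) _; have [/ltW a /ltW b] := hh i; lra.
Qed.
End HolExpand.

(** * The formal solution *)

Section Formal.
Variables (R : realType) (n : nat).
Local Notation C := (Cplx R).
Local Notation mp := (mpoly n C).
Local Notation hom := (@hom R n).
Variables (Q P : mp) (p : nat) (N : mp -> R) (K : R).
Hypothesis hN : fischer_norm Q P p N K.
Hypothesis hP : P \is hom (2 * p).
Hypothesis p0 : (0 < p)%N.
Variable A : multinom n -> nat -> mp.
Hypothesis hA : forall al, (mdeg al <= p)%N -> forall k, A al k \is hom k.
Implicit Types (q F : nat -> mp).

Let K0 : 0 <= K. Proof. exact: le_trans (fn_K1 hN). Qed.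
Let N0 : N 0 = 0.
Proof. by rewrite -(scale0r 0) (fnZ hN) cabs0 mul0r. Qed.
Let Nge0 f : 0 <= N f. Proof. exact: fn_ge0 hN f. Qed.

Lemma fn_mderivm d al f : f \is hom d -> N (mderivm al f) <= (K * d%:R) ^+ mdeg al * N f.
Proof.
move=> hf; rewrite mderivm_foldr; set s := flatten _.
have -> : mdeg al = size s.
  rewrite size_flatten /shape -map_comp mdegE sumnE big_map -big_enum /=.
  by apply: eq_bigr => i _; rewrite size_nseq.
have Kd : 0 <= K * d%:R by rewrite mulr_ge0.
suff : N (foldr (@mderiv n C) f s) <= (K * d%:R) ^+ size s * N f /\
  foldr (@mderiv n C) f s \is hom (d - size s) by case.
elim: s => [|i s [IH1 IH2]] /=; first by rewrite expr0 mul1r subn0.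
split; last by rewrite subnS; exact: hom_mderiv.
apply: le_trans (fn_mderiv hN i IH2) _; rewrite exprS -[leRHS]mulrA.
apply: ler_pM (mulr_ge0 K0 (ler0n _ _)) (Nge0 _) _ IH1.
by rewrite ler_wpM2l// ler_nat leq_subr.
Qed.

Lemma hom_pmul q j : (forall i, q i \is hom i) -> pmul (2 * p) P q j \is hom j.
Proof.
move=> hq; rewrite /pmul; case: ltnP => [_|pj]; first exact: hom0.
move: (homM hP (hq (j - 2 * p)%N)); move: (P * _) => T; by rewrite subnKC.
Qed.

(** The part of degree m of a_al D^al (P q) in which a_al contributes its form of degree k. *)
Definition lower_term q m (al : multinom n) k : mp :=
  A al k * mderivm al (pmul (2 * p) P q (m - k + mdeg al)%N).

Definition lower_terms q m : mp :=
  \sum_(al : bmultinom n p.+1) \sum_(k < m.+1) lower_term q m al k.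

Lemma bm_le (al : bmultinom n p.+1) : (mdeg al <= p)%N.
Proof. by rewrite -ltnS; exact: bmdeg. Qed.

Lemma hom_lower_term q m al k : (mdeg al <= p)%N -> (k <= m)%N -> (forall i, q i \is hom i) ->
  lower_term q m al k \is hom m.
Proof.
move=> ap km hq; have := homM (hA ap k) (hom_mderivm al (hom_pmul (m - k + mdeg al)%N hq)).
by rewrite /lower_term addnK; move: (_ * _) => T; rewrite subnKC.
Qed.

Lemma hom_lower_terms q m : (forall i, q i \is hom i) -> lower_terms q m \is hom m.
Proof.
move=> hq; apply: hom_sumT => al _; apply: hom_sumT => k _.
by apply: hom_lower_term (bm_le al) _ hq; rewrite -ltnS.
Qed.

Lemma pmul_ext q q' m j : (j < m + 2 * p)%N -> (forall i, (i < m)%N -> q i = q' i) ->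
  pmul (2 * p) P q j = pmul (2 * p) P q' j.
Proof.
move=> jm E; rewrite /pmul; case: ltnP => // pj; rewrite E//.
by rewrite ltn_subLR// addnC.
Qed.

(** Multiplication by P raises the degree by 2p and D^al lowers it by at most p, so degree m
    involves q only in degrees at most m - p, and p > 0. *)
Lemma lower_terms_ext q q' m : (forall i, (i < m)%N -> q i = q' i) -> lower_terms q m = lower_terms q' m.
Proof.
move=> E; apply: eq_bigr => al _; apply: eq_bigr => k _; rewrite /lower_term.
congr (_ * mderivm _ _); apply: pmul_ext E.
by have := bm_le al; have := ltn_ord k; move: (mdeg _) (nat_of_ord k) => a b; lia.
Qed.

Lemma lower_terms_linear c q q' m : lower_terms (fun i => q i + c *: q' i) m = lower_terms q m + c *: lower_terms q' m.
Proof.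
rewrite /lower_terms scaler_sumr -big_split; apply: eq_bigr => al _.
rewrite scaler_sumr -big_split; apply: eq_bigr => k _; rewrite /lower_term /=.
rewrite scalerAr -mulrDr -mderivmZ -mderivmD; congr (_ * mderivm _ _).
rewrite /pmul; case: ltnP => _; first by rewrite scaler0 addr0.
by rewrite mulrDr scalerAr.
Qed.

Definition formal_sol F q := (forall m, q m \is hom m) /\
  forall m, pdiff Q (P * q m) + lower_terms q m = F m.

Lemma formal_exists F : (forall m, F m \is hom m) -> exists q, formal_sol F q.
Proof.
move=> hF.
have H m (g : mp) : exists q : mp, q \is hom m /\ (g \is hom m -> pdiff Q (P * q) = g).
  have [hg|hg] := boolP (g \is hom m); last by exists 0; split; [exact: hom0|].
  by have [q hq e] := fn_solve hN hg; exists q.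
have /choice[sol hsol] : forall mg : nat * mp, exists q : mp,
    q \is hom mg.1 /\ (mg.2 \is hom mg.1 -> pdiff Q (P * q) = mg.2) by move=> [m g]; exact: H.
(* Course-of-values recursion: [L m] lists the first m forms. The default value 0 of [nth] is
   harmless because [lower_terms] in degree m reads only indices below m. *)
pose L := fix L m : seq mp := if m is m'.+1 then
  rcons (L m') (sol (m', F m' - lower_terms (nth 0 (L m')) m')) else [::].
have sL m : size (L m) = m by elim: m => [//|m IH]; rewrite /= size_rcons IH.
pose q m := nth 0 (L m.+1) m.
have qE m i : (i < m)%N -> nth 0 (L m) i = q i.
  elim: m => [//|m IH]; rewrite ltnS leq_eqVlt => /orP[/eqP ->//|im].
  by rewrite /= nth_rcons sL im IH.
have hqs m : q m = sol (m, F m - lower_terms q m).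
  rewrite -[LHS]/(nth 0 (rcons (L m) (sol (m, F m - lower_terms (nth 0 (L m)) m))) m).
  rewrite nth_rcons sL ltnn eqxx; congr (sol (_, _ - _)).
  by apply: lower_terms_ext => i im; rewrite qE.
have hq m : q m \is hom m by rewrite hqs; exact: (proj1 (hsol (m, _))).
exists q; split=> // m; have := proj2 (hsol (m, F m - lower_terms q m)); rewrite /= -hqs => ->.
  by rewrite subrK.
by apply: homB => //; exact: hom_lower_terms.
Qed.

Section Bound.
Variables (Lam Ma : R).
Hypotheses (L1 : 1 <= Lam) (Ma0 : 0 <= Ma).
Hypothesis nA : forall al, (mdeg al <= p)%N -> forall k, K ^+ k * nrm (A al k) <= Ma * Lam ^+ k.

(** The constant of one lower order term: [Ma] for the coefficient, (K (p+1))^p for the derivatives,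
    and the last factor for the multiplication by P. *)
Definition Dterm : R := Ma * (K * p.+1%:R) ^+ p * (K ^+ (2 * p) * nrm P).
Definition Dtot : R := #|{: bmultinom n p.+1}|%:R * Dterm.
(* Chosen so that K * Dtot / (Gam - Lam) <= 1 / 2, which closes the induction
   in formal_bound. *)
Definition Gam : R := Lam + 2 * (K * Dtot) + 1.

Lemma Dterm_ge0 : 0 <= Dterm.
Proof. by rewrite /Dterm !mulr_ge0 ?exprn_ge0 ?nrm_ge0 ?mulr_ge0. Qed.
Lemma Dtot_ge0 : 0 <= Dtot.
Proof. by rewrite mulr_ge0 ?Dterm_ge0. Qed.
Lemma Gam_ge1 : 1 <= Gam.
Proof. by rewrite /Gam; have := mulr_ge0 K0 Dtot_ge0; have := L1; lra. Qed.

(** The form of q involved has degree m - k + |al| - 2p, at most m - 1 - k; this strict loss of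
    degree is the exponent of [Gam]. At most p derivatives of a form of degree at most m + p produce
    the factor (m+1)^p. *)
Lemma lower_term_bound X q m al k : (mdeg al <= p)%N -> (k <= m)%N -> 0 <= X ->
  (forall i, q i \is hom i) -> (forall i, (i < m)%N -> N (q i) <= X * Gam ^+ i) ->
  N (lower_term q m al k) <= Dterm * X * m.+1%:R ^+ p * (Gam ^+ (m.-1 - k) * Lam ^+ k).
Proof.
move=> ap km X0 hq hb; have G1 := Gam_ge1; have G0 : 0 <= Gam by apply: le_trans G1.
have L0 : 0 <= Lam by apply: le_trans L1.
have B0 : 0 <= Dterm * X * m.+1%:R ^+ p * (Gam ^+ (m.-1 - k) * Lam ^+ k).
  apply: mulr_ge0; last by apply: mulr_ge0; exact: exprn_ge0.
  by apply: mulr_ge0 (mulr_ge0 Dterm_ge0 X0) _; exact: exprn_ge0.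
have hpm := hom_pmul (m - k + mdeg al)%N hq.
have hmd := hom_mderivm al hpm.
rewrite /lower_term; apply: le_trans (fnM hN (hA ap k) hmd) _.
have nm := fn_mderivm al hpm.
have [lt|ge] := ltnP (m - k + mdeg al) (2 * p).
  have -> : pmul (2 * p) P q (m - k + mdeg al) = 0 by rewrite /pmul lt.
  by rewrite mderivm0r N0 mulr0.
set i := (m - k + mdeg al - 2 * p)%N.
have im1 : (i <= m.-1 - k)%N by rewrite /i; clear -ap km ge p0; move: (mdeg _) ap ge => a; lia.
have im : (i < m)%N by rewrite /i; clear -ap km ge p0; move: (mdeg _) ap ge => a; lia.
have nP : N (pmul (2 * p) P q (m - k + mdeg al)) <= K ^+ (2 * p) * nrm P * (X * Gam ^+ (m.-1 - k)).
  rewrite /pmul ltnNge ge /=; apply: le_trans (fnM hN hP (hq _)) _.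
  rewrite ler_wpM2l ?mulr_ge0 ?exprn_ge0 ?nrm_ge0//.
  by apply: le_trans (hb _ im) _; rewrite ler_wpM2l// ler_weXn2l.
have c1 : 1 <= K * p.+1%:R.
  by rewrite -[leLHS]mulr1; apply: ler_pM; rewrite ?(fn_K1 hN)// ler1n.
(* Uses m - k + |al| <= m + p <= (p+1)(m+1). *)
have deg : (K * (m - k + mdeg al)%:R) ^+ mdeg al <= (K * p.+1%:R) ^+ p * m.+1%:R ^+ p.
  apply: le_trans (_ : (K * p.+1%:R * m.+1%:R) ^+ mdeg al <= _).
    rewrite lerXn2r ?nnegrE ?mulr_ge0// -mulrA ler_wpM2l// -natrM ler_nat.
    by clear -ap km; move: (mdeg _) ap => a; nia.
  rewrite -exprMn ler_weXn2l//; rewrite -[leLHS]mulr1.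
  by apply: ler_pM => //; rewrite ler1n.
have s1 := le_trans nm (ler_pM (exprn_ge0 _ (mulr_ge0 K0 (ler0n _ _))) (Nge0 _) deg nP).
apply: le_trans (ler_pM (mulr_ge0 (exprn_ge0 _ K0) (nrm_ge0 _)) (Nge0 _) (nA ap k) s1) _.
by rewrite /Dterm le_eqVlt; apply/orP; left; apply/eqP; ring.
Qed.

Lemma N_sum (I : finType) (F : I -> mp) m B : (forall i, F i \is hom m) ->
  (forall i, N (F i) <= B) -> N (\sum_i F i) <= #|I|%:R * B.
Proof.
move=> hF hB; rewrite cardE -[index_enum I]enumT.
elim: (enum I) => [|i s IH]; first by rewrite big_nil N0 mul0r.
rewrite big_cons /= -natr1 mulrDl mul1r [leRHS]addrC.
have hs : \sum_(j <- s) F j \is hom m by apply: hom_sum => j _ _; exact: hF.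
exact: le_trans (fnD hN (hF i) hs) (lerD (hB i) IH).
Qed.

(** The sum of the Gam^(m-1-k) Lam^k over k < m is at most Gam^m / (Gam - Lam), and the choice of
    [Gam] makes the total at most 1/(2K) of the bound aimed at. *)
Lemma lower_terms_bound X q m : 0 <= X ->
  (forall i, q i \is hom i) -> (forall i, (i < m)%N -> N (q i) <= X * Gam ^+ i) ->
  2 * K * N (lower_terms q m) <= X * m.+1%:R ^+ p * Gam ^+ m.
Proof.
move=> X0 hq hb; have G1 := Gam_ge1; have G0 : 0 <= Gam by apply: le_trans G1.
have L0 : 0 <= Lam by apply: le_trans L1.
have GL : 0 < Gam - Lam.
  by rewrite /Gam; have := mulr_ge0 K0 Dtot_ge0; lra.
pose B := Dterm * X * m.+1%:R ^+ p * (Gam ^+ m / (Gam - Lam)).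
have hB (al : bmultinom n p.+1) : N (\sum_(k < m.+1) lower_term q m al k) <= B.
  have ht k : (k <= m)%N -> lower_term q m al k \is hom m.
    by move=> km; exact: hom_lower_term (bm_le al) km hq.
  (* For k = m the derivative would act on the part of P q of degree |al| < 2p, which is 0. *)
  rewrite big_ord_recr /= [lower_term q m al m](_ : _ = 0) ?addr0; last first.
    rewrite /lower_term subnn add0n /pmul (_ : (mdeg al < 2 * p)%N) ?mderivm0r ?mulr0//.
    by apply: leq_ltn_trans (bm_le al) _; rewrite mul2n -addnn -[X in (X < _)%N]addn0 ltn_add2l.
  apply: le_trans (_ : \sum_(k < m) Dterm * X * m.+1%:R ^+ p * (Gam ^+ (m.-1 - k) * Lam ^+ k) <= _).
    suff: forall j, (j <= m)%N -> N (\sum_(k < j) lower_term q m al k) <=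
      \sum_(k < j) Dterm * X * m.+1%:R ^+ p * (Gam ^+ (m.-1 - k) * Lam ^+ k) by apply.
    elim=> [_|j IH jm]; first by rewrite !big_ord0 N0.
    rewrite !big_ord_recr /=; have hs : \sum_(k < j) lower_term q m al k \is hom m.
      by apply: hom_sumT => k _; apply: ht; apply: ltnW; exact: ltn_trans (ltn_ord k) jm.
    apply: le_trans (fnD hN hs (ht _ (ltnW jm))) _; apply: lerD; first exact: IH (ltnW jm).
    by apply: lower_term_bound (bm_le al) (ltnW jm) X0 hq hb.
  rewrite -mulr_sumr ler_wpM2l//.
    by apply: mulr_ge0 (mulr_ge0 Dterm_ge0 X0) _; exact: exprn_ge0.
  (* Times Gam - Lam, the sum telescopes to Gam^m - Lam^m. *)
  rewrite ler_pdivlMr// mulrC -subrXX lerBlDr lerDl exprn_ge0//.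
have hs (al : bmultinom n p.+1) : \sum_(k < m.+1) lower_term q m al k \is hom m.
  by apply: hom_sumT => k _; apply: hom_lower_term (bm_le al) _ hq; rewrite -ltnS.
have h2 := N_sum hs hB; apply: le_trans (ler_wpM2l _ h2) _; first by rewrite mulr_ge0.
have -> : 2 * K * (#|{: bmultinom n p.+1}|%:R * B) =
    X * m.+1%:R ^+ p * Gam ^+ m * (2 * (K * Dtot) / (Gam - Lam)).
  by rewrite /B /Dtot; ring.
rewrite -[leRHS]mulr1 ler_wpM2l ?mulr_ge0 ?exprn_ge0//.
by rewrite ler_pdivrMr// mul1r /Gam; lra.
Qed.

(** Half of X Gam^m comes from F, through X = 2 K Mf, and half from the lower order terms; the
    (m+1)^p of the derivatives cancels against that of the Fischer estimate. The bound holds for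
    every formal solution and is linear in [Mf], so [Mf] = 0 yields uniqueness. *)
Lemma formal_bound F q Mf : 0 <= Mf -> (forall m, F m \is hom m) ->
  (forall m, K ^+ m * nrm (F m) <= Mf * Lam ^+ m) -> formal_sol F q ->
  forall m, nrm (q m) <= 2 * K * Mf * (K * Gam) ^+ m.
Proof.
move=> Mf0 hF nF [hq hs].
have G1 := Gam_ge1; have G0 : 0 <= Gam by apply: le_trans G1.
have L0 : 0 <= Lam by apply: le_trans L1.
have LG : Lam <= Gam by rewrite /Gam; have := mulr_ge0 K0 Dtot_ge0; lra.
pose X := 2 * K * Mf; have X0 : 0 <= X by rewrite !mulr_ge0.
suff hb m : N (q m) <= X * Gam ^+ m.
  move=> m; apply: le_trans (nrm_le_fn hN (hq m)) _.
  by rewrite exprMn mulrCA ler_wpM2l ?exprn_ge0.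
elim/ltn_ind: m => m IH.
have bS := lower_terms_bound X0 hq IH.
have E : pdiff Q (P * q m) = F m + (-1) *: lower_terms q m by rewrite -hs scaleN1r addrK.
have := fn_fischer hN (hq m); rewrite E => h1.
have h2 : N (F m + (-1) *: lower_terms q m) <= Mf * Lam ^+ m + N (lower_terms q m).
  apply: le_trans (fnD hN (hF m) (homZ (-1) (hom_lower_terms m hq))) _; apply: lerD.
    exact: le_trans (fn_le_nrm hN (hF m)) (nF m).
  by rewrite (fnZ hN) cabsN cabs1 mul1r.
have m1 : 0 < m.+1%:R ^+ p :> R by rewrite exprn_gt0// ltr0n.
rewrite -(ler_pM2l m1); apply: le_trans h1 _.
apply: le_trans (ler_wpM2l K0 h2) _.
have h3 : Lam ^+ m <= Gam ^+ m by rewrite lerXn2r.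
have h4 : 2 * (K * Mf * Lam ^+ m) <= X * Gam ^+ m * m.+1%:R ^+ p.
  rewrite -[leLHS]mulr1; apply: ler_pM => //.
  - by rewrite !mulr_ge0 ?exprn_ge0.
  - by rewrite !mulrA -/X ler_wpM2l.
  - by rewrite exprn_ege1// ler1n.
have -> : m.+1%:R ^+ p * (X * Gam ^+ m) = X * Gam ^+ m * m.+1%:R ^+ p by rewrite mulrC.
have h5 : 2 * K * N (lower_terms q m) <= X * Gam ^+ m * m.+1%:R ^+ p by rewrite [leRHS]mulrAC.
move: h4 h5; rewrite mulrDr; move: (X * _ * _) => Z h4 h5.
have -> : K * (Mf * Lam ^+ m) = K * Mf * Lam ^+ m by rewrite mulrA.
by move: h4 h5; rewrite -[2 * K * _]mulrA; lra.
Qed.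

End Bound.
End Formal.

(** * The identity theorem and the main result *)

Section Ident.
Variables (R : realType) (n : nat).
Hypothesis n0 : (0 < n)%N.
Local Notation C := (Cplx R).
Local Notation X := 'cV[Cplx R]_n.
Local Notation mp := (mpoly n C).
Implicit Types (h z c : X) (r s : R) (f g : X -> C).

Lemma vnD z h : vn (z + h) <= vn z + vn h.
Proof. by rewrite -cR_le cRD -!vn_norm ler_normD. Qed.
Lemma vnZ (t : R) z : vn (cR t *: z) = `|t| * vn z.
Proof. by apply: (@cR_inj R); rewrite cRM -!vn_norm normrZ norm_cabs cabs_cR. Qed.
Lemma vn0 : vn (0 : X) = 0.
Proof. by rewrite /vn normr0. Qed.

(** Both functions expand at c on the ball of radius r/8, with the same forms because they agree
    near c. The new radius does not depend on eta, which makes steps of fixed length possible. *)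
Lemma ident_step f g c r eta : 0 < r -> 0 < eta ->
  (forall z, vn (z - c) < r -> differentiable f z /\ differentiable g z) ->
  (forall h, vn h < eta -> f (c + h) = g (c + h)) ->
  forall h, vn h < r / 8 -> f (c + h) = g (c + h).
Proof.
move=> r0 e0 hd E h hr.
have [F hF] := hol_expand r0 (fun z zr => proj1 (hd z zr)).
have [G hG] := hol_expand r0 (fun z zr => proj2 (hd z zr)).
have m0 : 0 < Num.min eta (r / 8) by rewrite lt_min e0 divr_gt0.
have hF' : ps (Num.min eta (r / 8)) (fun h => f (c + h)) F by apply: ps_sub hF; rewrite ge_min lexx orbT.
have hG' : ps (Num.min eta (r / 8)) (fun h => f (c + h)) G.
  apply: (@ps_eqf _ _ _ (fun h => g (c + h))).
    by move=> z; rewrite lt_min => /andP[/E].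
  by apply: ps_sub hG; rewrite ge_min lexx orbT.
have FG := ps_uniq n0 m0 hF' hG'.
apply: ctends_uniq (proj2 hF h hr) _.
by have := ps_eqF (fun m => esym (FG m)) hG; move=> /proj2/(_ h hr).
Qed.

(* Along the segment from 0 to z all expansion radii are at least
   (r - vn z) / 8, so finitely many steps reach z. *)
Lemma ident_ball f g r eta : 0 < eta ->
  (forall z, vn z < r -> differentiable f z /\ differentiable g z) ->
  (forall z, vn z < eta -> f z = g z) ->
  forall z, vn z < r -> f z = g z.
Proof.
move=> e0 hd E z zr; pose t := r - vn z.
have t0 : 0 < t by rewrite subr_gt0.
have r0 : 0 < r by apply: le_lt_trans (vn_ge0 z) zr.
have [k hk] : exists k, vn z / (t / 16) < k.+1%:R.
  have v0 : 0 <= vn z / (t / 16) by rewrite divr_ge0 ?vn_ge0// ltW// divr_gt0.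
  exists (Num.bound (vn z / (t / 16))); apply: lt_le_trans (archi_boundP v0) _.
  by rewrite ler_nat.
have t16 : 0 < t / 16 by rewrite divr_gt0.
have k0 : 0 < k.+1%:R :> R by [].
pose c j : X := cR (j%:R / k.+1%:R) *: z.
have step : vn (cR (k.+1%:R^-1) *: z) < t / 16.
  by rewrite vnZ gtr0_norm ?invr_gt0// mulrC ltr_pdivrMr// -ltr_pdivrMl// mulrC.
suff H j : (j <= k.+1)%N -> forall h, vn h < t / 16 -> f (c j + h) = g (c j + h).
  have := H _ (leqnn _) 0; rewrite vn0 addr0 => /(_ t16).
  by rewrite /c divff ?gt_eqF// cR1 scale1r.
elim: j => [_ h ht|j IH jk h ht].
  have := @ident_step f g 0 r eta r0 e0.
  rewrite /c mul0r cR0 scale0r; apply.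
  - by move=> y; rewrite subr0; exact: hd.
  - by move=> y; rewrite add0r; exact: E.
  - apply: lt_le_trans ht _; have := vn_ge0 z; rewrite /t; lra.
have -> : c j.+1 = c j + cR (k.+1%:R^-1) *: z.
  by rewrite /c -scalerDl -cRD -natr1 mulrDl mul1r.
rewrite -addrA; apply: (@ident_step f g (c j) t (t / 16)) => //.
- move=> y hy; apply: hd; rewrite -(subrK (c j) y); apply: le_lt_trans (vnD _ _) _.
  have : vn (c j) <= vn z.
    rewrite vnZ ger0_norm ?divr_ge0// -[leRHS]mul1r ler_wpM2r ?vn_ge0//.
    by rewrite ler_pdivrMr// mul1r ler_nat ltnW.
  by move=> cz; apply: le_lt_trans (lerD (lexx _) cz) _; rewrite -ltrBrDr.
- exact: IH (ltnW jk).
- by apply: le_lt_trans (vnD _ _) _; lra.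
Qed.

Lemma ball_domain r : 0 < r -> domain [set z : X | vn z < r].
Proof.
move=> r0; split; last by exists 0; rewrite /= vn0.
  rewrite openE => z /= zr; apply/nbhs_vn; exists (r - vn z); first by rewrite subr_gt0.
  by move=> h hr /=; apply: le_lt_trans (vnD _ _) _; lra.
(* The ball is a union of segments that share the point 0, hence connected. *)
have -> : [set z : X | vn z < r] =
    \bigcup_(z in [set z : X | vn z < r]) ((fun t : R => cR t *: z) @` `[0, 1]).
  apply/seteqP; split=> [z zr|y [z /= zr [t]]].
    by exists z => //; exists 1; rewrite ?cR1 ?scale1r//= in_itv /= lexx ler01.
  rewrite /= in_itv /= => /andP[t0 t1] <-; rewrite vnZ ger0_norm//.
  by apply: le_lt_trans zr; rewrite -[leRHS]mul1r ler_wpM2r ?vn_ge0.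
apply: bigcup_connected.
  exists 0 => z _; exists 0; first by rewrite /= in_itv /= lexx ler01.
  by rewrite cR0 scale0r.
move=> z _; apply: connected_continuous_connected; first exact: segment_connected.
apply: continuous_subspaceT => t A /nbhs_vn[d d0 hd].
have v1 : 0 < vn z + 1 by rewrite ltr_wpDl ?vn_ge0.
apply/nbhs_ballP; exists (d / (vn z + 1)); first by rewrite /= divr_gt0.
move=> u; rewrite -ball_normE /= distrC => hu.
have := hd (cR (u - t) *: z); rewrite -scalerDl -cRD [t + _]addrC subrK; apply.
rewrite vnZ; apply: le_lt_trans (_ : `|u - t| * (vn z + 1) < d).
  by rewrite ler_wpM2l// lerDl.
by rewrite -ltr_pdivlMr.
Qed.
End Ident.

(** * Uniqueness of the formal solution *)

Section FormalUniq.
Variables (R : realType) (n : nat).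
Hypothesis n0 : (0 < n)%N.
Local Notation C := (Cplx R).
Local Notation X := 'cV[Cplx R]_n.
Local Notation mp := (mpoly n C).
Local Notation hom := (@hom R n).

Lemma nrm_le0 d (f : mp) : f \is hom d -> nrm f <= 0 -> f = 0.
Proof.
move=> hf nf; apply: (peval_eq0 n0 hf) => z; apply/eqP; rewrite -cabs_eq0 eq_le cabs_ge0 andbT.
apply: le_trans (peval_le hf (vn_ge0 z) (cabs_vn z)) _.
by rewrite mulr_le0_ge0// exprn_ge0// vn_ge0.
Qed.

(** The difference solves the equation with F = 0, to which [formal_bound] applies with [Mf] = 0. *)
Lemma formal_uniq (Q P : mp) p (N : mp -> R) K A Lam Ma F q q' : fischer_norm Q P p N K ->
  P \is hom (2 * p) -> (0 < p)%N ->
  (forall al, (mdeg al <= p)%N -> forall k, A al k \is hom k) ->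
  1 <= Lam -> 0 <= Ma ->
  (forall al, (mdeg al <= p)%N -> forall k, K ^+ k * nrm (A al k) <= Ma * Lam ^+ k) ->
  formal_sol Q P p A F q -> formal_sol Q P p A F q' -> forall m, q' m = q m.
Proof.
move=> hN hP p0 hA L1 Ma0 nA [hq sq] [hq' sq'] m.
pose d i := q' i + (-1) *: q i.
have hd : formal_sol Q P p A (fun=> 0) d.
  split=> [i|i]; first by apply: homD (hq' i) (homZ _ (hq i)).
  rewrite lower_terms_linear /d mulrDr -scalerAr pdiffDr pdiffZr addrACA -scalerDr.
  by rewrite sq sq' scaleN1r subrr.
have := formal_bound hN hP p0 hA L1 Ma0 nA (lexx 0) (fun m => hom0 R n m) _ hd.
have z0 (i : nat) : K ^+ i * nrm (0 : mp) <= 0 * Lam ^+ i by rewrite nrm0 mulr0 mul0r.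
move=> /(_ z0 m); rewrite mulr0 mul0r => nd.
have := nrm_le0 (proj1 hd m) nd; rewrite /d scaleN1r => /eqP.
by rewrite subr_eq0 => /eqP.
Qed.
End FormalUniq.

Section Solve.
Variables (R : realType) (n : nat).
Local Notation C := (Cplx R).
Local Notation X := 'cV[Cplx R]_n.
Local Notation mp := (mpoly n C).
Local Notation hom := (@hom R n).
Variables (B : 'M[C]_n) (p : nat) (P : mp).
Hypothesis hP : P \is hom (2 * p).

Lemma ps_hol_op_mul r (a : multinom n -> X -> C) A u q : ps r u q ->
  (forall al, (mdeg al <= p)%N -> ps r (a al) (A al)) ->
  ps r (hol_op B p a (fun w => peval P w * u w))
    (fun m => pdiff (qform B ^+ p) (P * q m) + lower_terms P p A q m).
Proof.
move=> hu ha; apply: ps_eqF (ps_hol_op B (psP hP hu) ha) => m.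
by rewrite pmulD.
Qed.
End Solve.

Lemma holo0_expand (R : realType) n r f : 0 < r ->
  (forall z : 'cV[Cplx R]_n, vn z < r -> differentiable f z) -> exists F, ps (r / 8) f F.
Proof.
move=> r0 hf; have [z|F hF] := @hol_expand R n f 0 r r0; first by rewrite subr0; exact: hf.
by exists F; apply: ps_eqf hF => z _; rewrite add0r.
Qed.

Theorem theorem2 (R : realType) (n : nat) (hn : (1 <= n)%N)
    (B : 'M[Cplx R]_n) (hBsym : B^T = B) (hBinv : B \in unitmx)
    (p : nat) (hp : (1 <= p)%N)
    (Omega : set 'cV[Cplx R]_n) (hOmega : domain Omega) (h0Omega : Omega 0)
    (a : multinom n -> 'cV[Cplx R]_n -> Cplx R)
    (ha : forall alpha : multinom n, (mdeg alpha <= p)%N ->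
       holomorphic_on Omega (a alpha))
    (P : mpoly n (Cplx R)) (hPhom : P \is ishomog1 (2 * p) mdeg)
    (hPell : B_elliptic B p P)
    (U : set 'cV[Cplx R]_n) (hU : domain U) (hUOmega : U `<=` Omega)
    (h0U : U 0) :
  exists U' : set 'cV[Cplx R]_n,
    [/\ domain U', U' `<=` U, U' 0
      & forall f : 'cV[Cplx R]_n -> Cplx R, holomorphic_on U f ->
          exists q : 'cV[Cplx R]_n -> Cplx R,
            [/\ holomorphic_on U' q,
                forall z, U' z ->
                  hol_op B p a (fun w => peval P w * q w) z = f z
              & forall q' : 'cV[Cplx R]_n -> Cplx R,
                  holomorphic_on U' q' ->
                  (forall z, U' z ->
                    hol_op B p a (fun w => peval P w * q' w) z = f z) ->
                  forall z, U' z -> q' z = q z ] ].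
Proof.
have [N [K hN]] := fischer_norm_exists hn hBsym hPhom hPell.
have K1 := fn_K1 hN; have K0 : 0 < K by apply: lt_le_trans K1.
have [r r0 rU] : exists2 r, 0 < r & forall z, vn z < r -> U z.
  have [oU _ _] := hU; have /nbhs_vn[r r0 h] := open_nbhs_nbhs (conj oU h0U).
  by exists r => // z /h; rewrite add0r.
have r8 : 0 < r / 8 by rewrite divr_gt0.
have /choice[A hA] : forall al : multinom n, exists Al, (mdeg al <= p)%N -> ps (r / 8) (a al) Al.
  move=> al; have [alp|alp] := boolP (mdeg al <= p)%N; last by exists (fun=> 0).
  have [F hF] := holo0_expand r0 (fun z zr => ha al alp z (hUOmega _ (rU _ zr))).
  by exists F.
have homA al : (mdeg al <= p)%N -> forall k, A al k \is @hom R n k.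
  by move=> /hA[[]].
(* Strictly inside r/8, where every a_al and every f expands, so nrm times rho^m is bounded in each
   case at this one radius. *)
pose rho := r / 16.
have rho0 : 0 < rho by rewrite divr_gt0.
have rho8 : rho < r / 8 by rewrite /rho; lra.
have rho08 : 0 < rho < r / 8 by rewrite rho0.
(* 1/rho is the growth rate of the coefficients and K the price per degree of passing to [N]; adding
   1 ensures Lam >= 1. *)
pose Lam := 1 + K / rho.
have Kr : 0 <= K / rho by rewrite divr_ge0// ltW.
have L1 : 1 <= Lam by rewrite lerDl.
have L0 : 0 <= Lam by apply: le_trans L1.
have KL x m M : 0 <= x -> x * rho ^+ m <= M -> K ^+ m * x <= M * Lam ^+ m.
  move=> x0 h; have -> : K ^+ m * x = x * rho ^+ m * (K / rho) ^+ m.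
    by rewrite -mulrA -exprMn [rho * _]mulrC divfK ?gt_eqF// mulrC.
  apply: ler_pM h _; rewrite ?mulr_ge0 ?exprn_ge0 ?(ltW rho0)//.
  by rewrite lerXn2r ?nnegrE// /Lam lerDr.
have /choice[M hM] : forall al : bmultinom n p.+1, exists M, forall k, nrm (A al k) * rho ^+ k <= M.
  by move=> al; have [[_ hb] _] := hA al (bm_le al); exact: hb _ rho08.
pose Ma := \sum_al `|M al|.
have Ma0 : 0 <= Ma by apply: sumr_ge0.
have nA al : (mdeg al <= p)%N -> forall k, K ^+ k * nrm (A al k) <= Ma * Lam ^+ k.
  move=> alp k; apply: (KL _ _ _ (nrm_ge0 _)).
  have alp1 : (mdeg al < p.+1)%N by [].
  apply: le_trans (hM (BMultinom alp1) k) _; apply: le_trans (ler_norm _) _.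
  by rewrite /Ma (bigD1 (BMultinom alp1))//= lerDl sumr_ge0.
pose G := Gam P p K Lam Ma.
have G1 : 1 <= G := Gam_ge1 hN L1 Ma0.
have G0 : 0 < G by apply: lt_le_trans G1.
(* 1/(K G) is the radius of convergence granted by [formal_bound]. G is built from P, p, K and the
   bounds on the a_al, before any f is given. *)
pose eps := Num.min rho (K * G)^-1.
have KG0 : 0 < K * G by rewrite mulr_gt0.
have e0 : 0 < eps by rewrite lt_min rho0 invr_gt0.
have er : eps <= r / 8 by apply: le_trans (ltW rho8); rewrite ge_min lexx.
have eKG : eps <= (K * G)^-1 by rewrite ge_min lexx orbT.
have eU z : vn z < eps -> U z by move=> h; apply: rU; apply: lt_le_trans h _; lra.
clearbody eps.
exists [set z | vn z < eps]; split; [exact: ball_domain|exact: eU|by rewrite /= vn0|].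
move=> f hf.
have [F hF] := holo0_expand r0 (fun z zr => hf z (rU z zr)).
have [[homF bF] _] := hF; have [Mf hMf] := bF _ rho08.
have Mf0 : 0 <= Mf by apply: le_trans (hMf 0%N); rewrite mulr_ge0 ?nrm_ge0 ?exprn_ge0 ?(ltW rho0).
have nF m : K ^+ m * nrm (F m) <= Mf * Lam ^+ m by apply: KL (nrm_ge0 _) (hMf m).
have [qs hqs] := formal_exists hN hPhom hp homA homF.
have nq := formal_bound hN hPhom hp homA L1 Ma0 nA Mf0 homF nF hqs.
have bq : psb eps qs.
  split; first exact: (proj1 hqs); move=> s /andP[s0 se].
  exists (2 * K * Mf) => m; apply: le_trans (ler_wpM2r _ (nq m)) _.
    by rewrite exprn_ge0// ltW.
  rewrite -[leLHS]mulrA -exprMn -[leRHS]mulr1 ler_wpM2l ?mulr_ge0 ?(ltW K0)//.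
  rewrite exprn_ile1//; first by rewrite mulr_ge0 ?(ltW s0)// ltW.
  by rewrite mulrC -ler_pdivlMr// mul1r; apply: le_trans eKG; exact: ltW.
have [q hq] := ps_exists bq.
have solve d u us : d <= eps -> ps d u us ->
    ps d (hol_op B p a (fun w => peval P w * u w))
      (fun m => pdiff (qform B ^+ p) (P * us m) + lower_terms P p A us m).
  move=> de hu; apply: ps_hol_op_mul => // al alp.
  by apply: ps_sub (hA al alp); exact: le_trans er.
exists q; split.
- by move=> z; exact: ps_differentiable hq.
- move=> z ze; have [_ h1] := ps_eqF (proj2 hqs) (solve _ _ _ (lexx _) hq).
  by apply: ctends_uniq (h1 z ze) (proj2 hF z _); exact: lt_le_trans ze er.
(* A competitor q' is holomorphic only on the ball of radius eps, so its expansion is available at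
   radius eps/8; the formal solutions are compared there and [ident_ball] extends the equality. *)
- move=> q' dq' eq'; apply: (@ident_ball _ _ hn _ _ _ (eps / 8)); first by rewrite divr_gt0.
    by move=> z ze; split; [exact: dq'|exact: ps_differentiable hq ze].
  have [qs' hq'] := holo0_expand e0 dq'.
  have e8 : 0 < eps / 8 by rewrite divr_gt0.
  have e88 : eps / 8 <= eps by rewrite ler_pdivrMr// ler_peMr ?(ltW e0)// ler1n.
  have h1 := solve _ _ _ e88 hq'.
  have h2 : ps (eps / 8) (hol_op B p a (fun w => peval P w * q' w)) F.
    apply: (@ps_eqf _ _ _ f) (ps_sub (le_trans e88 er) hF) => z ze.
    by rewrite eq'//=; exact: lt_le_trans ze e88.
  have sq' : formal_sol (qform B ^+ p) P p A F qs'.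
    by split=> [|m]; [exact: (proj1 (proj1 hq'))|exact: (ps_uniq hn e8 h1 h2)].
  have E := formal_uniq hn hN hPhom hp homA L1 Ma0 nA hqs sq'.
  move=> z ze; apply: ctends_uniq (proj2 hq' z ze) _.
  have -> : qs' = qs by apply/funext.
  by apply: (proj2 hq); exact: lt_le_trans ze e88.
Qed.
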